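(* Let $\mathcal{C}$ be a braided monoidal category, $H$ a Hopf algebra in $\mathcal{C}$, $\mathcal{A}=(H\xrightarrow{\pi}A,B,\omega)$ a partial dualization datum for $H$, where $\mathcal{C}$ has equalizers and $A\otimes -$ preserves equalizers. Let $H\cong K\rtimes A$ be the Radford decomposition with $K$ a Hopf algebra in ${}_A^A\mathcal{YD}(\mathcal{C})$, let $L=\Omega(K)$, and let $r_{\mathcal{A}}(H)=L\rtimes B$ be the partial dual of $H$ with respect to $\mathcal{A}$. Then the equivalence of braided categories $\Omega:{}_A^A\mathcal{YD}(\mathcal{C})\to{}_B^B\mathcal{YD}(\mathcal{C})$ induces an equivalence of braided categories $$ {}_H^H\mathcal{YD}(\mathcal{C})\;\cong\;{}_K^K\mathcal{YD}\big({}_A^A\mathcal{YD}(\mathcal{C})\big)\;\xrightarrow{\ \tilde\Omega\ }\;{}_L^L\mathcal{YD}\big({}_B^B\mathcal{YD}(\mathcal{C})\big)\;\cong\;{}_{r_{\mathcal{A}}(H)}^{r_{\mathcal{A}}(H)}\mathcal{YD}(\mathcal{C}). $$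
   Context: $\mathcal{C}$ is a (strict) braided monoidal category with tensor product $\otimes$, unit $\mathbf 1$, braiding $c_{X,Y}:X\otimes Y\to Y\otimes X$. Hopf algebra in $\mathcal{C}$: an object $A$ with a unital associative algebra structure $(\mu,\eta)$, a counital coassociative coalgebra structure $(\Delta,\varepsilon)$, such that $\Delta\mu=(\mu\otimes\mu)(\mathrm{id}\otimes c_{A,A}\otimes \mathrm{id})(\Delta\otimes\Delta)$, $\varepsilon\mu=\varepsilon\otimes\varepsilon$, $\Delta\eta=\eta\otimes\eta$, $\varepsilon\eta=\mathrm{id}_{\mathbf 1}$, and an invertible antipode $S:A\to A$ with $\mu(S\otimes \mathrm{id})\Delta=\eta\varepsilon=\mu(\mathrm{id}\otimes S)\Delta$. Yetter-Drinfel'd modules: ${}_A^A\mathcal{YD}(\mathcal{C})$ has as objects the triples $(X,\rho,\delta)$, with $\rho:A\otimes X\to X$ a left $A$-action and $\delta:X\to A\otimes X$ a left $A$-coaction, satisfying $(\mu\otimes\rho)(\mathrm{id}_A\otimes c_{A,A}\otimes \mathrm{id}_X)(\Delta\otimes\delta)=(\mu\otimes \mathrm{id}_X)(\mathrm{id}_A\otimes c_{X,A})(\delta\otimes \mathrm{id}_A)(\rho\otimes \mathrm{id}_A)(\mathrm{id}_A\otimes c_{A,X})(\Delta\otimes \mathrm{id}_X)$; morphisms are the $A$-linear and $A$-colinear morphisms. It is monoidal with diagonal action $(\rho_X\otimes\rho_Y)(\mathrm{id}_A\otimes c_{A,X}\otimes \mathrm{id}_Y)(\Delta\otimes \mathrm{id}_{X\otimes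 Y})$ and diagonal coaction $(\mu\otimes \mathrm{id}_{X\otimes Y})(\mathrm{id}_A\otimes c_{X,A}\otimes \mathrm{id}_Y)(\delta_X\otimes\delta_Y)$, and braided by $c^{\mathcal{YD}}_{X,Y}=(\rho_Y\otimes \mathrm{id}_X)(\mathrm{id}_A\otimes c_{X,Y})(\delta_X\otimes \mathrm{id}_Y)$. Hopf pairing: $\omega:A\otimes B\to\mathbf 1$ with $\omega(\mu_A\otimes \mathrm{id})=\omega(\mathrm{id}\otimes\omega\otimes \mathrm{id})(\mathrm{id}_{A\otimes A}\otimes\Delta_B)$, $\omega(\eta_A\otimes \mathrm{id})=\varepsilon_B$, $\omega(\mathrm{id}\otimes\mu_B)=\omega(\mathrm{id}\otimes\omega\otimes \mathrm{id})(\Delta_A\otimes \mathrm{id}_{B\otimes B})$, $\omega(\mathrm{id}\otimes\eta_B)=\varepsilon_A$. It is non-degenerate if there is a (unique) inverse copairing $\omega':\mathbf 1\to B\otimes A$ with $(\omega\otimes \mathrm{id}_A)(\mathrm{id}_A\otimes\omega')=\mathrm{id}_A$, $(\mathrm{id}_B\otimes\omega)(\omega'\otimes \mathrm{id}_B)=\mathrm{id}_B$. Braided equivalence $\Omega=\Omega^\omega:{}_A^A\mathcal{YD}(\mathcal{C})\to{}_B^B\mathcal{YD}(\mathcal{C})$: it is the identity on underlying objects and morphisms of $\mathcal{C}$, and $\Omega(X,\rho,\delta)=(X,\rho_\Omega,\delta_\Omega)$ with $\rho_\Omega=(\mathrm{id}_X\otimes\omega)(c^{-1}_{X,A}\otimes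 S_B^{-2})(\delta\otimes \mathrm{id}_B)\,c^{-1}_{X,B}$ and $\delta_\Omega=c_{X,B}\,c_{B,X}\,(S_B^2\otimes\rho)(\omega'\otimes \mathrm{id}_X)$; its monoidal structure is $\Omega_2(X,Y)=c^{\mathcal{YD}}_{Y,X}\circ c^{-1}_{Y,X}:\Omega(X)\otimes\Omega(Y)\to\Omega(X\otimes Y)$. Radford biproduct: for a Hopf algebra $K$ in ${}_A^A\mathcal{YD}(\mathcal{C})$, $K\rtimes A$ is the Hopf algebra in $\mathcal{C}$ on $K\otimes A$ with unit $\eta_K\otimes\eta_A$, counit $\varepsilon_K\otimes\varepsilon_A$, $\mu=(\mu_K\otimes\mu_A)(\mathrm{id}_K\otimes\rho_K\otimes \mathrm{id}_{A\otimes A})(\mathrm{id}_{K\otimes A}\otimes c_{A,K}\otimes \mathrm{id}_A)(\mathrm{id}_K\otimes\Delta_A\otimes \mathrm{id}_{K\otimes A})$, $\Delta=(\mathrm{id}_K\otimes\mu_A\otimes \mathrm{id}_{K\otimes A})(\mathrm{id}_{K\otimes A}\otimes c_{K,A}\otimes \mathrm{id}_A)(\mathrm{id}_K\otimes\delta_K\otimes \mathrm{id}_{A\otimes A})(\Delta_K\otimes\Delta_A)$. There is an isomorphism of braided categories ${}_{K\rtimes A}^{K\rtimes A}\mathcal{YD}(\mathcal{C})\cong{}_K^K\mathcal{YD}({}_A^A\mathcal{YD}(\mathcal{C}))$ which is the identity on underlying objects: the $A$-structures are obtained by restriction along $\eta_K\otimes \mathrm{id}_A$ and corestriction along $\varepsilon_K\otimes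 \mathrm{id}_A$, the $K$-structures by restriction along $\mathrm{id}_K\otimes\eta_A$ and corestriction along $\mathrm{id}_K\otimes\varepsilon_A$. Partial dualization: a partial dualization datum $\mathcal{A}=(H\xrightarrow{\pi}A,B,\omega)$ for $H$ consists of a Hopf algebra projection $\pi:H\to A$ onto a Hopf subalgebra $\iota:A\to H$ (so $\pi\iota=\mathrm{id}_A$), and a Hopf algebra $B$ in $\mathcal{C}$ with a non-degenerate Hopf pairing $\omega:A\otimes B\to\mathbf 1$. By the Radford projection theorem (valid if $\mathcal{C}$ has equalizers and $A\otimes-$ preserves them) there is a Hopf algebra $K$ (the coinvariants of $\pi$) in ${}_A^A\mathcal{YD}(\mathcal{C})$ and an isomorphism of Hopf algebras $H\cong K\rtimes A$ identifying $\pi$ with $\varepsilon_K\otimes \mathrm{id}_A$ and $\iota$ with $\eta_K\otimes \mathrm{id}_A$. Put $L:=\Omega(K)$, a Hopf algebra in ${}_B^B\mathcal{YD}(\mathcal{C})$ with $\mu_L=\mu_K\circ\Omega_2(K,K)$ and $\Delta_L=\Omega_2(K,K)^{-1}\circ\Delta_K$. The partial dual is $r_{\mathcal{A}}(H):=L\rtimes B$. The induced functor $\tilde\Omega$ sends a Yetter-Drinfel'd module $(X,\rho,\delta)$ over $K$ in ${}_A^A\mathcal{YD}(\mathcal{C})$ to $(\Omega(X),\ \Omega(\rho)\circ\Omega_2(K,X),\ \Omega_2(K,X)^{-1}\circ\Omega(\delta))$, with monoidal structure inherited from $\Omega_2$. *)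

(* Defs.v *)
From Stdlib Require Import ClassicalEpsilon.

Set Implicit Arguments.
Unset Strict Implicit.
Unset Printing Implicit Defensive.

Declare Scope ob_scope.
Delimit Scope ob_scope with ob.
Declare Scope mor_scope.
Delimit Scope mor_scope with mor.

Reserved Notation "X ⊗ Y" (at level 38, left associativity).
Reserved Notation "g ∘ f" (at level 40, left associativity).
Reserved Notation "𝟏" (at level 0).

(** * Strict braided monoidal categories

    Strictness is an equality of objects, [(X ⊗ Y) ⊗ Z = X ⊗ (Y ⊗ Z)], under
    which composites of intrinsically typed arrows would need casts.  Arrows
    are therefore typed extrinsically: the objects of the category [C] are the
    [X : ob C] with [isob X], its hom-set from [X] to [Y] is
    [{f : mor C | hom X Y f}], and the operations are total functions whose
    values outside these are irrelevant, since every law is relativised.  The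
    hom-sets may overlap, so that a Yetter-Drinfel'd morphism *is* its
    underlying arrow. *)

Record catData := CatData {
  ob : Type;
  mor : Type;
  isob : ob -> Prop;
  hom : ob -> ob -> mor -> Prop;
  idm : ob -> mor;
  comp : mor -> mor -> mor;      (* [comp g f] is "g after f" *)
  tens : ob -> ob -> ob;
  tensm : mor -> mor -> mor;
  unit1 : ob;
  braid : ob -> ob -> mor
}.

Arguments isob C X%_ob : clear implicits, rename.
Arguments hom C X%_ob Y%_ob f%_mor : clear implicits, rename.
Arguments idm C X%_ob : clear implicits, rename.
Arguments comp C g%_mor f%_mor : clear implicits, rename.
Arguments tens C X%_ob Y%_ob : clear implicits, rename.
Arguments tensm C f%_mor g%_mor : clear implicits, rename.
Arguments unit1 C : clear implicits, rename.
Arguments braid C X%_ob Y%_ob : clear implicits, rename.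

Bind Scope ob_scope with ob.
Bind Scope mor_scope with mor.

Section Categories.

Variable C : catData.
Local Notation "X ⊗ Y" := (tens C X Y) : ob_scope.
Local Notation "f ⊗ g" := (tensm C f g) : mor_scope.
Local Notation "g ∘ f" := (comp C g f) : mor_scope.
Local Notation "𝟏" := (unit1 C) : ob_scope.
Local Notation id := (idm C).
Local Notation c := (braid C).
Local Open Scope mor_scope.

Definition is_inverse (X Y : ob C) (f g : mor C) : Prop :=
  hom C X Y f /\ hom C Y X g /\ g ∘ f = id X /\ f ∘ g = id Y.

Definition is_iso (X Y : ob C) (f : mor C) : Prop :=
  exists g, is_inverse X Y f g.

(* The inverse of [f : X -> Y]; meaningful when [is_iso X Y f]. *)
Definition inv (X Y : ob C) (f : mor C) : mor C :=
  epsilon (inhabits f) (fun g => is_inverse X Y f g).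

Record is_braided_category : Prop := {
  hom_ob : forall X Y f, hom C X Y f -> isob C X /\ isob C Y;
  id_hom : forall X, isob C X -> hom C X X (id X);
  comp_hom : forall X Y Z f g,
    hom C X Y f -> hom C Y Z g -> hom C X Z (g ∘ f);
  id_comp : forall X Y f, hom C X Y f -> id Y ∘ f = f;
  comp_id : forall X Y f, hom C X Y f -> f ∘ id X = f;
  comp_assoc : forall X Y Z W f g h,
    hom C X Y f -> hom C Y Z g -> hom C Z W h -> h ∘ (g ∘ f) = (h ∘ g) ∘ f;

  unit_ob : isob C 𝟏;
  tens_ob : forall X Y, isob C X -> isob C Y -> isob C (X ⊗ Y);
  tens_assoc : forall X Y Z, isob C X -> isob C Y -> isob C Z ->
    (X ⊗ (Y ⊗ Z))%ob = ((X ⊗ Y) ⊗ Z)%ob;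
  unit_tens : forall X, isob C X -> (𝟏 ⊗ X)%ob = X;
  tens_unit : forall X, isob C X -> (X ⊗ 𝟏)%ob = X;

  tensm_hom : forall X X' Y Y' f g,
    hom C X X' f -> hom C Y Y' g -> hom C (X ⊗ Y) (X' ⊗ Y') (f ⊗ g);
  tensm_id : forall X Y, isob C X -> isob C Y -> id X ⊗ id Y = id (X ⊗ Y);
  tensm_comp : forall X X' X'' Y Y' Y'' f f' g g',
    hom C X X' f -> hom C X' X'' f' -> hom C Y Y' g -> hom C Y' Y'' g' ->
    (f' ∘ f) ⊗ (g' ∘ g) = (f' ⊗ g') ∘ (f ⊗ g);
  tensm_assoc : forall X X' Y Y' Z Z' f g h,
    hom C X X' f -> hom C Y Y' g -> hom C Z Z' h ->
    f ⊗ (g ⊗ h) = (f ⊗ g) ⊗ h;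
  unit_tensm : forall X Y f, hom C X Y f -> id 𝟏 ⊗ f = f;
  tensm_unit : forall X Y f, hom C X Y f -> f ⊗ id 𝟏 = f;

  braid_iso : forall X Y, isob C X -> isob C Y ->
    is_iso (X ⊗ Y) (Y ⊗ X) (c X Y);
  braid_natural : forall X X' Y Y' f g,
    hom C X X' f -> hom C Y Y' g -> c X' Y' ∘ (f ⊗ g) = (g ⊗ f) ∘ c X Y;
  braid_tens_r : forall X Y Z, isob C X -> isob C Y -> isob C Z ->
    c X (Y ⊗ Z)%ob = (id Y ⊗ c X Z) ∘ (c X Y ⊗ id Z);
  braid_tens_l : forall X Y Z, isob C X -> isob C Y -> isob C Z ->
    c (X ⊗ Y)%ob Z = (c X Z ⊗ id Y) ∘ (id X ⊗ c Y Z)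
}.

Definition is_equalizer (X Y : ob C) (f g : mor C) (E : ob C) (e : mor C)
    : Prop :=
  hom C E X e /\ f ∘ e = g ∘ e /\
  forall T t, hom C T X t -> f ∘ t = g ∘ t ->
    exists! u, hom C T E u /\ e ∘ u = t.

Definition has_equalizers : Prop :=
  forall X Y f g, hom C X Y f -> hom C X Y g ->
    exists E e, is_equalizer X Y f g E e.

Definition tens_preserves_equalizers (A : ob C) : Prop :=
  forall X Y f g E e, hom C X Y f -> hom C X Y g -> is_equalizer X Y f g E e ->
    is_equalizer (A ⊗ X) (A ⊗ Y) (id A ⊗ f) (id A ⊗ g) (A ⊗ E)%ob (id A ⊗ e).

(** * Hopf algebras and Hopf pairings *)

Record hopfData := HopfData {
  hcar : ob C;
  hmul : mor C;
  hone : mor C;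
  hcomul : mor C;
  hcounit : mor C;
  hanti : mor C
}.

Record is_hopf (A : hopfData) : Prop := {
  hopf_ob : isob C (hcar A);
  hopf_mul_hom : hom C (hcar A ⊗ hcar A) (hcar A) (hmul A);
  hopf_one_hom : hom C 𝟏 (hcar A) (hone A);
  hopf_comul_hom : hom C (hcar A) (hcar A ⊗ hcar A) (hcomul A);
  hopf_counit_hom : hom C (hcar A) 𝟏 (hcounit A);

  hopf_mul_assoc :
    hmul A ∘ (hmul A ⊗ id (hcar A)) = hmul A ∘ (id (hcar A) ⊗ hmul A);
  hopf_one_mul : hmul A ∘ (hone A ⊗ id (hcar A)) = id (hcar A);
  hopf_mul_one : hmul A ∘ (id (hcar A) ⊗ hone A) = id (hcar A);

  hopf_comul_assoc :
    (hcomul A ⊗ id (hcar A)) ∘ hcomul A = (id (hcar A) ⊗ hcomul A) ∘ hcomul A;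
  hopf_counit_comul : (hcounit A ⊗ id (hcar A)) ∘ hcomul A = id (hcar A);
  hopf_comul_counit : (id (hcar A) ⊗ hcounit A) ∘ hcomul A = id (hcar A);

  hopf_comul_mul :
    hcomul A ∘ hmul A =
    (hmul A ⊗ hmul A) ∘ (id (hcar A) ⊗ c (hcar A) (hcar A) ⊗ id (hcar A))
      ∘ (hcomul A ⊗ hcomul A);
  hopf_counit_mul : hcounit A ∘ hmul A = hcounit A ⊗ hcounit A;
  hopf_comul_one : hcomul A ∘ hone A = hone A ⊗ hone A;
  hopf_counit_one : hcounit A ∘ hone A = id 𝟏;

  hopf_anti_iso : is_iso (hcar A) (hcar A) (hanti A);
  hopf_anti_l :
    hmul A ∘ (hanti A ⊗ id (hcar A)) ∘ hcomul A = hone A ∘ hcounit A;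
  hopf_anti_r :
    hmul A ∘ (id (hcar A) ⊗ hanti A) ∘ hcomul A = hone A ∘ hcounit A
}.

Record is_hopf_morphism (A B : hopfData) (f : mor C) : Prop := {
  hopf_morphism_hom : hom C (hcar A) (hcar B) f;
  hopf_morphism_mul : f ∘ hmul A = hmul B ∘ (f ⊗ f);
  hopf_morphism_one : f ∘ hone A = hone B;
  hopf_morphism_comul : hcomul B ∘ f = (f ⊗ f) ∘ hcomul A;
  hopf_morphism_counit : hcounit B ∘ f = hcounit A
}.

Definition is_hopf_iso (A B : hopfData) (f : mor C) : Prop :=
  is_hopf_morphism A B f /\ is_iso (hcar A) (hcar B) f.

Record is_hopf_pairing (A B : hopfData) (w : mor C) : Prop := {
  pairing_hom : hom C (hcar A ⊗ hcar B) 𝟏 w;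
  pairing_mul_l :
    w ∘ (hmul A ⊗ id (hcar B)) =
    w ∘ (id (hcar A) ⊗ w ⊗ id (hcar B))
      ∘ (id (hcar A ⊗ hcar A) ⊗ hcomul B);
  pairing_one_l : w ∘ (hone A ⊗ id (hcar B)) = hcounit B;
  pairing_mul_r :
    w ∘ (id (hcar A) ⊗ hmul B) =
    w ∘ (id (hcar A) ⊗ w ⊗ id (hcar B))
      ∘ (hcomul A ⊗ id (hcar B ⊗ hcar B));
  pairing_one_r : w ∘ (id (hcar A) ⊗ hone B) = hcounit A
}.

Definition is_inverse_copairing (A B : hopfData) (w w' : mor C) : Prop :=
  hom C 𝟏 (hcar B ⊗ hcar A) w' /\
  (w ⊗ id (hcar A)) ∘ (id (hcar A) ⊗ w') = id (hcar A) /\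
  (id (hcar B) ⊗ w) ∘ (w' ⊗ id (hcar B)) = id (hcar B).

Definition is_nondegenerate (A B : hopfData) (w : mor C) : Prop :=
  exists w', is_inverse_copairing A B w w'.

(* The inverse copairing; meaningful when [is_nondegenerate A B w]. *)
Definition copairing (A B : hopfData) (w : mor C) : mor C :=
  epsilon (inhabits w) (fun w' => is_inverse_copairing A B w w').

(** * The braided category of Yetter-Drinfel'd modules *)

Record ydData := YDData { ycar : ob C; yact : mor C; ycoact : mor C }.

Section YetterDrinfeld.

Variable A : hopfData.

Record is_yd (X : ydData) : Prop := {
  yd_ob : isob C (ycar X);
  yd_act_hom : hom C (hcar A ⊗ ycar X) (ycar X) (yact X);
  yd_coact_hom : hom C (ycar X) (hcar A ⊗ ycar X) (ycoact X);
  yd_act_mul :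
    yact X ∘ (hmul A ⊗ id (ycar X)) = yact X ∘ (id (hcar A) ⊗ yact X);
  yd_act_one : yact X ∘ (hone A ⊗ id (ycar X)) = id (ycar X);
  yd_coact_comul :
    (hcomul A ⊗ id (ycar X)) ∘ ycoact X =
    (id (hcar A) ⊗ ycoact X) ∘ ycoact X;
  yd_coact_counit : (hcounit A ⊗ id (ycar X)) ∘ ycoact X = id (ycar X);
  yd_compat :
    (hmul A ⊗ yact X) ∘ (id (hcar A) ⊗ c (hcar A) (hcar A) ⊗ id (ycar X))
      ∘ (hcomul A ⊗ ycoact X) =
    (hmul A ⊗ id (ycar X)) ∘ (id (hcar A) ⊗ c (ycar X) (hcar A))
      ∘ (ycoact X ⊗ id (hcar A)) ∘ (yact X ⊗ id (hcar A))
      ∘ (id (hcar A) ⊗ c (hcar A) (ycar X)) ∘ (hcomul A ⊗ id (ycar X))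
}.

Record is_yd_morphism (X Y : ydData) (f : mor C) : Prop := {
  yd_morphism_dom : is_yd X;
  yd_morphism_cod : is_yd Y;
  yd_morphism_hom : hom C (ycar X) (ycar Y) f;
  yd_morphism_act : f ∘ yact X = yact Y ∘ (id (hcar A) ⊗ f);
  yd_morphism_coact : ycoact Y ∘ f = (id (hcar A) ⊗ f) ∘ ycoact X
}.

Definition yd_tens (X Y : ydData) : ydData := {|
  ycar := (ycar X ⊗ ycar Y)%ob;
  yact := (yact X ⊗ yact Y) ∘ (id (hcar A) ⊗ c (hcar A) (ycar X) ⊗ id (ycar Y))
            ∘ (hcomul A ⊗ id (ycar X ⊗ ycar Y));
  ycoact := (hmul A ⊗ id (ycar X ⊗ ycar Y))
              ∘ (id (hcar A) ⊗ c (ycar X) (hcar A) ⊗ id (ycar Y))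
              ∘ (ycoact X ⊗ ycoact Y)
|}.

Definition yd_unit : ydData :=
  {| ycar := 𝟏%ob; yact := hcounit A; ycoact := hone A |}.

Definition yd_braid (X Y : ydData) : mor C :=
  (yact Y ⊗ id (ycar X)) ∘ (id (hcar A) ⊗ c (ycar X) (ycar Y))
    ∘ (ycoact X ⊗ id (ycar Y)).

Definition YD : catData := {|
  ob := ydData;
  mor := mor C;
  isob := is_yd;
  hom := is_yd_morphism;
  idm := fun X => id (ycar X);
  comp := comp C;
  tens := yd_tens;
  tensm := tensm C;
  unit1 := yd_unit;
  braid := yd_braid
|}.

End YetterDrinfeld.

End Categories.

Arguments hcar {C} A : rename.
Arguments hmul {C} A : rename.
Arguments hone {C} A : rename.
Arguments hcomul {C} A : rename.
Arguments hcounit {C} A : rename.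
Arguments hanti {C} A : rename.
Arguments ycar {C} X : rename.
Arguments yact {C} X : rename.
Arguments ycoact {C} X : rename.

(** * Monoidal functors and braided equivalences *)

(* As hom-sets may overlap, the action on arrows takes source and target.
   [fmu F X Y : F X ⊗ F Y -> F (X ⊗ Y)] and [feta F : 𝟏 -> F 𝟏] are the
   monoidal structure; they are ignored when [F] is used as a plain functor. *)
Record functorData (C D : catData) := FunctorData {
  fob : ob C -> ob D;
  fmap : ob C -> ob C -> mor C -> mor D;
  fmu : ob C -> ob C -> mor D;
  feta : mor D
}.

Definition functor_id (C : catData) : functorData C C := {|
  fob := fun X => X;
  fmap := fun _ _ f => f;
  fmu := fun X Y => idm C (tens C X Y);
  feta := idm C (unit1 C)
|}.

Definition functor_comp (C D E : catData) (G : functorData D E)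
    (F : functorData C D) : functorData C E := {|
  fob := fun X => fob G (fob F X);
  fmap := fun X Y f => fmap G (fob F X) (fob F Y) (fmap F X Y f);
  fmu := fun X Y =>
    comp E (fmap G (tens D (fob F X) (fob F Y)) (fob F (tens C X Y)) (fmu F X Y))
           (fmu G (fob F X) (fob F Y));
  feta := comp E (fmap G (unit1 D) (fob F (unit1 C)) (feta F)) (feta G)
|}.

Section Functors.

Variables C D : catData.

Record is_functor (F : functorData C D) : Prop := {
  functor_ob : forall X, isob C X -> isob D (fob F X);
  functor_hom : forall X Y f,
    hom C X Y f -> hom D (fob F X) (fob F Y) (fmap F X Y f);
  functor_map_id : forall X, isob C X -> fmap F X X (idm C X) = idm D (fob F X);
  functor_map_comp : forall X Y Z f g, hom C X Y f -> hom C Y Z g ->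
    fmap F X Z (comp C g f) = comp D (fmap F Y Z g) (fmap F X Y f)
}.

Definition is_natural_iso (F G : functorData C D) (a : ob C -> mor D) : Prop :=
  (forall X, isob C X -> is_iso (fob F X) (fob G X) (a X)) /\
  (forall X Y f, hom C X Y f ->
     comp D (a Y) (fmap F X Y f) = comp D (fmap G X Y f) (a X)).

Record is_braided_functor (F : functorData C D) : Prop := {
  braided_dom : is_braided_category C;
  braided_cod : is_braided_category D;
  braided_functor : is_functor F;
  braided_mu_iso : forall X Y, isob C X -> isob C Y ->
    is_iso (tens D (fob F X) (fob F Y)) (fob F (tens C X Y)) (fmu F X Y);
  braided_eta_iso : is_iso (unit1 D) (fob F (unit1 C)) (feta F);
  braided_mu_natural : forall X X' Y Y' f g, hom C X X' f -> hom C Y Y' g ->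
    comp D (fmu F X' Y') (tensm D (fmap F X X' f) (fmap F Y Y' g)) =
    comp D (fmap F (tens C X Y) (tens C X' Y') (tensm C f g)) (fmu F X Y);
  braided_mu_assoc : forall X Y Z, isob C X -> isob C Y -> isob C Z ->
    comp D (fmu F (tens C X Y) Z) (tensm D (fmu F X Y) (idm D (fob F Z))) =
    comp D (fmu F X (tens C Y Z)) (tensm D (idm D (fob F X)) (fmu F Y Z));
  braided_mu_unit_l : forall X, isob C X ->
    comp D (fmu F (unit1 C) X) (tensm D (feta F) (idm D (fob F X))) =
    idm D (fob F X);
  braided_mu_unit_r : forall X, isob C X ->
    comp D (fmu F X (unit1 C)) (tensm D (idm D (fob F X)) (feta F)) =
    idm D (fob F X);
  braided_mu_braid : forall X Y, isob C X -> isob C Y ->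
    comp D (fmap F (tens C X Y) (tens C Y X) (braid C X Y)) (fmu F X Y) =
    comp D (fmu F Y X) (braid D (fob F X) (fob F Y))
}.

(* Equality of monoidal functors. *)
Record functor_eq (F G : functorData C D) : Prop := {
  functor_eq_ob : forall X, isob C X -> fob F X = fob G X;
  functor_eq_map : forall X Y f, hom C X Y f -> fmap F X Y f = fmap G X Y f;
  functor_eq_mu : forall X Y, isob C X -> isob C Y -> fmu F X Y = fmu G X Y;
  functor_eq_eta : feta F = feta G
}.

End Functors.

Definition is_equivalence (C D : catData) (F : functorData C D) : Prop :=
  is_functor F /\
  exists G : functorData D C, is_functor G /\
    (exists a, is_natural_iso (functor_comp G F) (functor_id C) a) /\
    (exists b, is_natural_iso (functor_comp F G) (functor_id D) b).

Definition is_braided_equivalence (C D : catData) (F : functorData C D) : Prop :=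
  is_braided_functor F /\ is_equivalence F.

Definition is_inverse_braided_iso (C D : catData) (F : functorData C D)
    (G : functorData D C) : Prop :=
  is_braided_functor F /\ is_braided_functor G /\
  functor_eq (functor_comp G F) (functor_id C) /\
  functor_eq (functor_comp F G) (functor_id D).

Definition is_braided_isomorphism (C D : catData) (F : functorData C D) : Prop :=
  exists G : functorData D C, is_inverse_braided_iso F G.

(** * Radford biproducts and partial dualization *)

Section PartialDualization.

Variable C : catData.
Local Notation "X ⊗ Y" := (tens C X Y) : ob_scope.
Local Notation "f ⊗ g" := (tensm C f g) : mor_scope.
Local Notation "g ∘ f" := (comp C g f) : mor_scope.
Local Notation "𝟏" := (unit1 C) : ob_scope.
Local Notation id := (idm C).
Local Notation c := (braid C).
(* The inverse braiding c_{X,Y}^{-1} : Y ⊗ X -> X ⊗ Y. *)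
Local Notation cinv X Y := (inv (C := C) (tens C X Y) (tens C Y X) (braid C X Y)).
Local Open Scope mor_scope.

Section Biproduct.

Variables (A : hopfData C) (K : hopfData (YD A)).
Local Notation a := (hcar A).
Local Notation k := (ycar (hcar K)).
Local Notation rho := (yact (hcar K)).
Local Notation delta := (ycoact (hcar K)).
Local Notation mulK := (hmul K).
Local Notation oneK := (hone K).
Local Notation comulK := (hcomul K).
Local Notation counitK := (hcounit K).
Local Notation antiK := (hanti K).

(* The antipode of a bialgebra is unique; that of the biproduct is
   [k # a |-> (1 # S_A (k_(-1) a)) (S_K k_(0) # 1)], suitably braided. *)
Definition biproduct : hopfData C := {|
  hcar := (k ⊗ a)%ob;
  hmul := (mulK ⊗ hmul A) ∘ (id k ⊗ rho ⊗ id (a ⊗ a))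
            ∘ (id (k ⊗ a) ⊗ c a k ⊗ id a) ∘ (id k ⊗ hcomul A ⊗ id (k ⊗ a));
  hone := oneK ⊗ hone A;
  hcomul := (id k ⊗ hmul A ⊗ id (k ⊗ a)) ∘ (id (k ⊗ a) ⊗ c k a ⊗ id a)
              ∘ (id k ⊗ delta ⊗ id (a ⊗ a)) ∘ (comulK ⊗ hcomul A);
  hcounit := counitK ⊗ hcounit A;
  hanti := (rho ⊗ id a) ∘ (id a ⊗ c a k) ∘ (hcomul A ⊗ id k)
             ∘ (hanti A ⊗ antiK) ∘ (hmul A ⊗ id k) ∘ (id a ⊗ c k a)
             ∘ (delta ⊗ id a)
|}.

(* The isomorphism YD(K ⋊ A)(C) ≅ YD(K)(YD(A)(C)). *)
Definition biproduct_restriction : functorData (YD biproduct) (YD K) :=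
  FunctorData (C := YD biproduct) (D := YD K)
  (fun X : ob (YD biproduct) => YDData (C := YD A)
    (YDData (C := C) (ycar X)
      (yact X ∘ (oneK ⊗ id a ⊗ id (ycar X)))
      ((counitK ⊗ id a ⊗ id (ycar X)) ∘ ycoact X))
    (yact X ∘ (id k ⊗ hone A ⊗ id (ycar X)))
    ((id k ⊗ hcounit A ⊗ id (ycar X)) ∘ ycoact X))
  (fun _ _ f => f)
  (fun X Y : ob (YD biproduct) => id (ycar X ⊗ ycar Y))
  (id 𝟏).

End Biproduct.

(* Transport of Yetter-Drinfel'd modules along a Hopf isomorphism
   [phi : H' -> H]. *)
Definition yd_transport (H' H : hopfData C) (phi : mor C)
    : functorData (YD H) (YD H') :=
  FunctorData (C := YD H) (D := YD H')
  (fun X : ob (YD H) => YDData (C := C) (ycar X)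
    (yact X ∘ (phi ⊗ id (ycar X)))
    ((inv (C := C) (hcar H') (hcar H) phi ⊗ id (ycar X)) ∘ ycoact X))
  (fun _ _ f => f)
  (fun X Y : ob (YD H) => id (ycar X ⊗ ycar Y))
  (id 𝟏).

Section Omega.

Variables (A B : hopfData C) (w : mor C).
Local Notation a := (hcar A).
Local Notation b := (hcar B).
Local Notation SB2 := (hanti B ∘ hanti B).

Definition Omega_ob (X : ydData C) : ydData C := {|
  ycar := ycar X;
  yact := (id (ycar X) ⊗ w) ∘ (cinv (ycar X) a ⊗ inv (C := C) b b SB2)
            ∘ (ycoact X ⊗ id b) ∘ cinv (ycar X) b;
  ycoact := c (ycar X) b ∘ c b (ycar X) ∘ (SB2 ⊗ yact X)
              ∘ (copairing A B w ⊗ id (ycar X))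
|}.

Definition Omega2 (X Y : ydData C) : mor C :=
  yd_braid A Y X ∘ cinv (ycar Y) (ycar X).

Definition Omega2_inv (X Y : ydData C) : mor C :=
  inv (C := C) (ycar X ⊗ ycar Y) (ycar X ⊗ ycar Y) (Omega2 X Y).

Definition Omega : functorData (YD A) (YD B) :=
  FunctorData (C := YD A) (D := YD B)
  Omega_ob
  (fun _ _ f => f)
  Omega2
  (id 𝟏).

(* The Hopf algebra [L = Omega(K)]. *)
Definition Omega_hopf (K : hopfData (YD A)) : hopfData (YD B) :=
  HopfData (C := YD B)
  (Omega_ob (hcar K))
  (hmul K ∘ Omega2 (hcar K) (hcar K))
  (hone K)
  (Omega2_inv (hcar K) (hcar K) ∘ hcomul K)
  (hcounit K)
  (hanti K).

Definition Omega_tilde (K : hopfData (YD A))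
    : functorData (YD K) (YD (Omega_hopf K)) :=
  FunctorData (C := YD K) (D := YD (Omega_hopf K))
  (fun X : ob (YD K) => YDData (C := YD B)
    (Omega_ob (ycar X))
    (yact X ∘ Omega2 (hcar K) (ycar X))
    (Omega2_inv (hcar K) (ycar X) ∘ ycoact X))
  (fun _ _ f => f)
  (fun X Y : ob (YD K) => Omega2 (ycar X) (ycar Y))
  (id 𝟏).

End Omega.

Record is_partial_dualization_datum (H A : hopfData C) (pi iota : mor C)
    (B : hopfData C) (w : mor C) : Prop := {
  datum_A : is_hopf A;
  datum_pi : is_hopf_morphism H A pi;
  datum_iota : is_hopf_morphism A H iota;
  datum_split : pi ∘ iota = id (hcar A);
  datum_B : is_hopf B;
  datum_pairing : is_hopf_pairing A B w;
  datum_nondegenerate : is_nondegenerate A B w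
}.

(* [phi : K ⋊ A -> H] exhibits [K] as the coinvariants of [pi], i.e. as the
   equalizer of (id ⊗ pi) Delta and id ⊗ eta : H -> H ⊗ A. *)
Record is_radford_decomposition (H A : hopfData C) (pi iota : mor C)
    (K : hopfData (YD A)) (phi : mor C) : Prop := {
  radford_K : is_hopf K;
  radford_iso : is_hopf_iso (biproduct K) H phi;
  radford_pi : pi ∘ phi = hcounit K ⊗ id (hcar A);
  radford_iota : phi ∘ (hone K ⊗ id (hcar A)) = iota;
  radford_coinvariants :
    is_equalizer (C := C) (hcar H) (hcar H ⊗ hcar A)
      ((id (hcar H) ⊗ pi) ∘ hcomul H) (id (hcar H) ⊗ hone A)
      (ycar (hcar K)) (phi ∘ (id (ycar (hcar K)) ⊗ hone A))
}.

(* The partial dual r_A(H) = Omega(K) ⋊ B. *)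
Definition partial_dual (A B : hopfData C) (w : mor C) (K : hopfData (YD A))
    : hopfData C :=
  biproduct (Omega_hopf B w K).

End PartialDualization.

(* Main.v *)
From Stdlib Require Import ClassicalEpsilon List Arith Lia Bool PArith FMapPositive.
Require Import Defs.
Import ListNotations.

(** Why the theorem holds.

    _The functor Omega._  From [w], the square of the antipode of [B] and the inverse
    braiding one obtains a non-degenerate Hopf pairing [turned A B w] from [B ⊗ A] to
    the unit.  In terms of it, [B] acts on [Omega X] by coacting with [A] and pairing
    ([omega_act]), and the coaction of [B] is the transpose of the action of [A]
    ([omega_coact]).  So comodules over [A] become modules over [B] and modules become
    comodules, bijectively, and the same holds for colinear and linear maps.  The
    compatibility condition of Yetter-Drinfel'd modules is reached through braidings:
    [X] satisfies it if and only if the braiding of the regular comodule with [X] is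
    colinear, and if and only if the braiding of [X] with the regular module is linear
    ([colinear_yd_condition], [linear_yd_condition]).  Up to braidings of the base
    category, the braiding over [B] is the one over [A] in the opposite order
    ([omega_braid]), and the inverse braiding is a morphism from [Omega X ⊗ Omega Y] to
    [Omega (Y ⊗ X)] ([omega_tens_linear], [omega_tens_colinear]).  Hence [Omega] is a
    bijection on Yetter-Drinfel'd modules ([omega_yd], [omega_inv_yd]), and composing
    this inverse braiding with the braiding over [A] gives its braided monoidal
    structure ([omega_braided]).

    _The induced functor._  A braided functor that is invertible on objects and arrows
    carries a Hopf algebra [K] to a Hopf algebra and identifies the Yetter-Drinfel'd
    modules over both ([induced_is_hopf], [induced_braided], [induced_inverse_spec]).
    Applied to [Omega], this yields [L] and [Omega_tilde].

    _Biproducts._  The biproduct of [K] with [A] is a Hopf algebra because its coproduct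
    is multiplicative on the two factors and on their exchange, and because its antipode
    is a convolution product of the antipodes of the factors ([biproduct_hopf]).
    Restriction to the factors is a strict braided functor from its Yetter-Drinfel'd
    modules to those over [K] among those over [A]; the compatibility condition is
    multiplicative in the acting element, so that it can be checked on the factors,
    and restriction is bijective ([restriction_inverse]).

    _The projection theorem._  The equalizer that defines the coinvariants of the
    projection is split by the idempotent [x ↦ x_(1) i(S(π(x_(2))))]; with the retraction
    at hand, the structure of [K] and the isomorphism with [H] are given by formulas
    ([radford_projection]).

    The equivalence of the theorem is the composite of these functors, all of which are
    bijective on objects and arrows.

    _Diagrams._  The identities above are equations between arrows of a braided category.
    They are read as string diagrams, and the tactic [diag] looks for a sequence of
    isotopies and of applications of given equations that leads from one side to the
    other; [check_sound] guarantees that a sequence that has been found is a proof. *)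

Set Implicit Arguments.
Unset Strict Implicit.
Unset Printing Implicit Defensive.

(** * String diagrams *)

(** ** Inverses *)

Section Inverses.

Variable C : catData.
Hypothesis hC : is_braided_category C.

Lemma inverse_unique X Y f g g' :
  is_inverse (C := C) X Y f g -> is_inverse (C := C) X Y f g' -> g = g'.
Proof.
  intros (hf & hg & e1 & e2) (_ & hg' & e1' & e2').
  rewrite <- (comp_id hC hg), <- e2', (comp_assoc hC hg' hf hg), e1.
  exact (id_comp hC hg').
Qed.

Lemma inv_spec X Y f : is_iso (C := C) X Y f -> is_inverse X Y f (inv X Y f).
Proof.
  intros [g hg]; unfold inv; apply epsilon_spec; exists g; exact hg.
Qed.

Lemma inv_eq X Y f g : is_inverse (C := C) X Y f g -> inv X Y f = g.
Proof.
  intros h; apply (inverse_unique (X := X) (Y := Y) (f := f)); auto.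
  apply inv_spec; exists g; exact h.
Qed.

End Inverses.

(** ** Diagrams and their values *)

(** A tensor product of atomic objects is the list of their indices, so that
    strictness holds by computation on lists. *)
Definition word := list nat.

(** The arrows that diagrams do not decompose, with their source and target. *)
Record gen (C : catData) := Gen { gdom : word; gcod : word; garr : mor C }.

(** [Br x y] is the braiding of the strands [x] and [y], [Bi x y] its inverse, and
    [Bx i] the [i]-th arrow of the list of generators. *)
Inductive box := Br (x y : nat) | Bi (x y : nat) | Bx (i : nat).

(** One box per layer, with the number of strands on its left; the first layer of
    the list is applied first. *)
Definition diagram := list (nat * box).

Section Diagrams.

Variable C : catData.
Hypothesis hC : is_braided_category C.
Local Notation "X ⊗ Y" := (tens C X Y) : ob_scope.
Local Notation "f ⊗ g" := (tensm C f g) : mor_scope.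
Local Notation "g ∘ f" := (comp C g f) : mor_scope.
Local Notation id := (idm C).
Local Open Scope mor_scope.

Variables (objs : list (ob C)) (gens : list (gen C)).

Definition ob_at (i : nat) : ob C := nth i objs (unit1 C).

Fixpoint ev (w : word) : ob C :=
  match w with nil => unit1 C | x :: w => (ob_at x ⊗ ev w)%ob end.

Definition gen_at (i : nat) : gen C :=
  nth i gens (Gen [] [] (id (unit1 C))).

Definition bdom (b : box) : word :=
  match b with Br x y => [x; y] | Bi x y => [y; x] | Bx i => gdom (gen_at i) end.
Definition bcod (b : box) : word :=
  match b with Br x y => [y; x] | Bi x y => [x; y] | Bx i => gcod (gen_at i) end.
Definition bmor (b : box) : mor C :=
  match b with
  | Br x y => braid C (ob_at x) (ob_at y)
  | Bi x y => inv (C := C) (ob_at x ⊗ ob_at y) (ob_at y ⊗ ob_at x)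
                (braid C (ob_at x) (ob_at y))
  | Bx i => garr (gen_at i)
  end.

Fixpoint weqb (u v : word) : bool :=
  match u, v with
  | nil, nil => true
  | x :: u, y :: v => Nat.eqb x y && weqb u v
  | _, _ => false
  end.

Fixpoint strip (p w : word) : option word :=
  match p, w with
  | nil, _ => Some w
  | x :: p, y :: w => if Nat.eqb x y then strip p w else None
  | _, nil => None
  end.

(** The word above the layer [id ⊗ b ⊗ id], when [b] fits at offset [n]. *)
Fixpoint step_word (w : word) (n : nat) (b : box) {struct n} : option word :=
  match n with
  | O => match strip (bdom b) w with
         | Some v => Some (bcod b ++ v) | None => None end
  | S n => match w with
           | nil => None
           | x :: w => match step_word w n b with
                       | Some v => Some (x :: v) | None => None end
           end
  end.

Fixpoint target (w : word) (d : diagram) : option word :=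
  match d with
  | nil => Some w
  | (n, b) :: d => match step_word w n b with
                   | Some w' => target w' d | None => None end
  end.

Definition layer (w : word) (n : nat) (b : box) : mor C :=
  id (ev (firstn n w)) ⊗ (bmor b ⊗ id (ev (skipn (n + length (bdom b)) w))).

Fixpoint value (w : word) (d : diagram) : mor C :=
  match d with
  | nil => id (ev w)
  | (n, b) :: d =>
      match step_word w n b with
      | Some w' => value w' d ∘ layer w n b
      | None => id (ev w)
      end
  end.

Definition shift (k : nat) (d : diagram) : diagram :=
  map (fun s => (k + fst s, snd s)) d.

Hypothesis objs_ok : Forall (isob C) objs.
Hypothesis gens_ok :
  Forall (fun g => hom C (ev (gdom g)) (ev (gcod g)) (garr g)) gens.

Lemma ob_at_ok i : isob C (ob_at i).
Proof.
  unfold ob_at; destruct (nth_in_or_default i objs (unit1 C)) as [h | ->].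
  - exact (proj1 (Forall_forall _ _) objs_ok _ h).
  - exact (unit_ob hC).
Qed.

Lemma ev_ob w : isob C (ev w).
Proof.
  induction w; simpl; [exact (unit_ob hC) | exact (tens_ob hC (ob_at_ok _) IHw)].
Qed.
Hint Resolve ob_at_ok ev_ob unit_ob tens_ob id_hom comp_hom tensm_hom hC : diag.

Lemma ev_app u v : ev (u ++ v) = (ev u ⊗ ev v)%ob.
Proof.
  induction u as [|x u IH]; simpl.
  - symmetry; apply (unit_tens hC); auto with diag.
  - rewrite IH; apply (tens_assoc hC); auto with diag.
Qed.

Lemma ev1 x : ev [x] = ob_at x.
Proof. simpl; apply (tens_unit hC); auto with diag. Qed.

Lemma ev2 x y : ev [x; y] = (ob_at x ⊗ ob_at y)%ob.
Proof. rewrite <- (ev1 y); reflexivity. Qed.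

Lemma bmor_hom b : hom C (ev (bdom b)) (ev (bcod b)) (bmor b).
Proof.
  destruct b as [x y | x y | i]; simpl bdom; simpl bcod; simpl bmor.
  - rewrite !ev2; destruct (braid_iso hC (ob_at_ok x) (ob_at_ok y)) as [g hg].
    apply hg.
  - rewrite !ev2.
    apply (inv_spec (braid_iso hC (ob_at_ok x) (ob_at_ok y))).
  - unfold gen_at; destruct (nth_in_or_default i gens (Gen [] [] (id (unit1 C))))
      as [h | ->].
    + exact (proj1 (Forall_forall _ _) gens_ok _ h).
    + simpl; apply (id_hom hC (unit_ob hC)).
Qed.
Hint Resolve bmor_hom : diag.

Lemma weqb_eq u v : weqb u v = true -> u = v.
Proof.
  revert v; induction u as [|x u IH]; intros [|y v]; simpl; try discriminate; auto.
  rewrite andb_true_iff; intros [h1 h2]; apply Nat.eqb_eq in h1; subst.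
  f_equal; auto.
Qed.

Lemma strip_spec p w v : strip p w = Some v <-> w = p ++ v.
Proof.
  revert w; induction p as [|x p IH]; intros w; simpl.
  - split; congruence.
  - destruct w as [|y w]; [split; discriminate|].
    destruct (Nat.eqb_spec x y) as [<-|ne].
    + rewrite IH; split; intros h; congruence.
    + split; [discriminate|]; intros h; congruence.
Qed.

Lemma app_inj_length (u v u' v' : word) :
  length u = length u' -> u ++ v = u' ++ v' -> u = u' /\ v = v'.
Proof.
  revert u'; induction u as [|x u IH]; intros [|x' u']; simpl; try discriminate; auto.
  intros [= h] [= -> e]; destruct (IH _ h e); split; congruence.
Qed.

Lemma step_word_spec w n b w' :
  step_word w n b = Some w' <->
  exists u v, w = u ++ bdom b ++ v /\ length u = n /\ w' = u ++ bcod b ++ v.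
Proof.
  revert w w'; induction n as [|n IH]; intros w w'; simpl.
  - destruct (strip (bdom b) w) as [v|] eqn:e.
    + apply strip_spec in e; split.
      * intros h; exists [], v; simpl; repeat split; congruence.
      * intros (u & v' & -> & hu & ->).
        destruct u; [|discriminate]; simpl in *; apply app_inv_head in e; subst; auto.
    + split; [discriminate|]; intros (u & v & -> & hu & ->).
      destruct u; [|discriminate]; simpl in e.
      rewrite (proj2 (strip_spec (bdom b) (bdom b ++ v) v) eq_refl) in e; discriminate.
  - destruct w as [|x w].
    + split; [discriminate|]; intros (u & v & h & hu & _).
      destruct u; discriminate.
    + specialize (IH w); destruct (step_word w n b) as [w1|] eqn:e.
      * destruct (proj1 (IH w1) eq_refl) as (u & v & -> & hu & ->); split.
        -- intros h; exists (x :: u), v; simpl; repeat split; congruence.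
        -- intros (u' & v' & h & hu' & ->); destruct u' as [|x' u']; [discriminate|].
           simpl in h; injection h as <- h; simpl in hu'.
           apply app_inj_length in h; [|congruence]; destruct h as [<- h'].
           apply app_inv_head in h'; subst; reflexivity.
      * split; [discriminate|]; intros (u & v & h & hu & ->).
        destruct u as [|x' u]; [discriminate|]; injection h as <- h.
        enough (None = Some (u ++ bcod b ++ v)) by discriminate.
        apply IH; exists u, v; simpl in hu; repeat split; auto; congruence.
Qed.

Lemma step_word_at u b v : step_word (u ++ bdom b ++ v) (length u) b
  = Some (u ++ bcod b ++ v).
Proof. apply step_word_spec; exists u, v; auto. Qed.

Lemma layer_at u b v :
  layer (u ++ bdom b ++ v) (length u) b = id (ev u) ⊗ (bmor b ⊗ id (ev v)).
Proof.
  unfold layer; rewrite firstn_app, Nat.sub_diag, firstn_O, app_nil_r, firstn_all.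
  rewrite <- length_app, app_assoc, skipn_app, Nat.sub_diag.
  rewrite skipn_all; reflexivity.
Qed.

Lemma whisker_hom u X Y f v : hom C X Y f ->
  hom C (ev u ⊗ (X ⊗ ev v)) (ev u ⊗ (Y ⊗ ev v)) (id (ev u) ⊗ (f ⊗ id (ev v))).
Proof.
  intros h; apply (tensm_hom hC); [|apply (tensm_hom hC)]; auto;
    apply (id_hom hC); apply ev_ob.
Qed.

Lemma layer_hom u b v :
  hom C (ev (u ++ bdom b ++ v)) (ev (u ++ bcod b ++ v))
    (layer (u ++ bdom b ++ v) (length u) b).
Proof.
  rewrite layer_at, !ev_app; apply whisker_hom; apply bmor_hom.
Qed.

Lemma step_hom w n b w' : step_word w n b = Some w' ->
  hom C (ev w) (ev w') (layer w n b).
Proof.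
  intros h; apply step_word_spec in h; destruct h as (u & v & -> & <- & ->).
  apply layer_hom.
Qed.

Lemma value_hom w d w' : target w d = Some w' -> hom C (ev w) (ev w') (value w d).
Proof.
  revert w; induction d as [|[n b] d IH]; simpl; intros w.
  - intros [= <-]; apply (id_hom hC); apply ev_ob.
  - destruct (step_word w n b) as [w1|] eqn:e; [|discriminate]; intros h.
    exact (comp_hom hC (step_hom e) (IH _ h)).
Qed.

Lemma target_app w d1 d2 : target w (d1 ++ d2) =
  match target w d1 with Some w1 => target w1 d2 | None => None end.
Proof.
  revert w; induction d1 as [|[n b] d1 IH]; simpl; intros w; auto.
  destruct (step_word w n b); auto.
Qed.

Lemma value_app w d1 d2 w1 w2 : target w d1 = Some w1 -> target w1 d2 = Some w2 ->
  value w (d1 ++ d2) = value w1 d2 ∘ value w d1.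
Proof.
  revert w; induction d1 as [|[n b] d1 IH]; simpl; intros w.
  - intros [= ->] h; symmetry; apply (comp_id hC (value_hom h)).
  - destruct (step_word w n b) as [w'|] eqn:e; [|discriminate]; intros h1 h2.
    rewrite (IH _ h1 h2); symmetry.
    apply (comp_assoc hC (step_hom e) (value_hom h1) (value_hom h2)).
Qed.

Lemma whisker_id u w v :
  id (ev (u ++ w ++ v)) = id (ev u) ⊗ (id (ev w) ⊗ id (ev v)).
Proof.
  rewrite !ev_app, <- !(tensm_id hC); auto with diag.
Qed.

Lemma whisker_comp u X Y Z f g v : hom C X Y f -> hom C Y Z g ->
  id (ev u) ⊗ ((g ∘ f) ⊗ id (ev v)) =
  (id (ev u) ⊗ (g ⊗ id (ev v))) ∘ (id (ev u) ⊗ (f ⊗ id (ev v))).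
Proof.
  intros hf hg.
  assert (hu := id_hom hC (ev_ob u)); assert (hv := id_hom hC (ev_ob v)).
  rewrite <- (tensm_comp hC hu hu (tensm_hom hC hf hv) (tensm_hom hC hg hv)).
  rewrite <- (tensm_comp hC hf hg hv hv), (id_comp hC hu), (id_comp hC hv).
  reflexivity.
Qed.

Lemma whisker_value u w d w' v : target w d = Some w' ->
  target (u ++ w ++ v) (shift (length u) d) = Some (u ++ w' ++ v) /\
  value (u ++ w ++ v) (shift (length u) d) =
    id (ev u) ⊗ (value w d ⊗ id (ev v)).
Proof.
  revert w; induction d as [|[n b] d IH]; simpl; intros w.
  - intros [= <-]; split; auto; apply whisker_id.
  - destruct (step_word w n b) as [w1|] eqn:e; [|discriminate]; intros h.
    assert (hl := step_hom e).
    apply step_word_spec in e; destruct e as (u' & v' & -> & <- & ->).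
    assert (e2 : step_word (u ++ (u' ++ bdom b ++ v') ++ v)
              (length u + length u') b = Some (u ++ (u' ++ bcod b ++ v') ++ v)).
    { apply step_word_spec; exists (u ++ u'), (v' ++ v).
      rewrite length_app, <- !app_assoc; auto. }
    rewrite e2; destruct (IH _ h) as [h1 h2]; split; [exact h1|].
    rewrite h2, (whisker_comp u v hl (value_hom h)); f_equal.
    rewrite layer_at.
    replace (u ++ (u' ++ bdom b ++ v') ++ v) with
      ((u ++ u') ++ bdom b ++ (v' ++ v)) by (rewrite <- !app_assoc; auto).
    rewrite <- length_app, layer_at, !ev_app, <- !(tensm_id hC); auto with diag.
    assert (hu := id_hom hC (ev_ob u)); assert (hv := id_hom hC (ev_ob v)).
    assert (hu' := id_hom hC (ev_ob u')); assert (hv' := id_hom hC (ev_ob v')).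
    assert (hb := bmor_hom b).
    rewrite <- (tensm_assoc hC hu' (tensm_hom hC hb hv') hv).
    rewrite <- (tensm_assoc hC hb hv' hv).
    rewrite (tensm_assoc hC hu hu' (tensm_hom hC hb (tensm_hom hC hv' hv))).
    reflexivity.
Qed.

(** ** Moves between diagrams *)

(** The common target is part of the relation, which makes it stable under
    prolongation of the diagrams. *)
Definition same (w : word) (d d' : diagram) : Prop :=
  exists w', target w d = Some w' /\ target w d' = Some w' /\ value w d = value w d'.

Lemma same_refl w d w' : target w d = Some w' -> same w d d.
Proof. intros h; exists w'; auto. Qed.

Lemma same_sym w d d' : same w d d' -> same w d' d.
Proof. intros (w' & h1 & h2 & h3); exists w'; auto. Qed.

Lemma same_trans w d1 d2 d3 : same w d1 d2 -> same w d2 d3 -> same w d1 d3.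
Proof.
  intros (w1 & a1 & a2 & a3) (w2 & b1 & b2 & b3); exists w1.
  rewrite a2 in b1; injection b1 as <-; repeat split; congruence.
Qed.

Lemma same_app w p d d' q w1 w2 : target w p = Some w1 -> same w1 d d' ->
  target w (p ++ d ++ q) = Some w2 -> same w (p ++ d ++ q) (p ++ d' ++ q).
Proof.
  intros hp (w1' & h1 & h2 & h3) h; exists w2.
  rewrite target_app, hp, target_app, h1 in h.
  assert (k : target w1 (d ++ q) = Some w2) by (rewrite target_app, h1; auto).
  assert (k' : target w1 (d' ++ q) = Some w2) by (rewrite target_app, h2; auto).
  repeat split; try (rewrite target_app, hp; auto).
  rewrite (value_app hp k), (value_app hp k'), (value_app h1 h), (value_app h2 h).
  congruence.
Qed.

(** By functoriality of the tensor product, distant boxes commute.  The offset of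
    the box on the right changes by the difference between the numbers of inputs
    and outputs of the other one. *)
Lemma same_swap w n g m h w2 : n + length (bcod g) <= m ->
  target w [(n, g); (m, h)] = Some w2 ->
  same w [(n, g); (m, h)] [(m - length (bcod g) + length (bdom g), h); (n, g)].
Proof.
  simpl; intros hm ht.
  destruct (step_word w n g) as [w1|] eqn:e1; [|discriminate].
  destruct (step_word w1 m h) as [w1'|] eqn:e2; [|discriminate].
  injection ht as ->.
  apply step_word_spec in e1; destruct e1 as (u & v & -> & <- & ->).
  apply step_word_spec in e2; destruct e2 as (u2 & v2 & e & <- & ->).
  set (k := length u2 - (length u + length (bcod g))).
  set (t := firstn k v).
  assert (hu2 : u2 = u ++ bcod g ++ t).
  { assert (h1 : firstn (length u2) (u ++ bcod g ++ v) = u2).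
    { rewrite e, firstn_app, Nat.sub_diag, firstn_O, app_nil_r, firstn_all; auto. }
    rewrite <- h1 at 1.
    rewrite firstn_app, firstn_all2 by lia; f_equal.
    rewrite firstn_app, firstn_all2 by lia; f_equal.
    unfold t, k; f_equal; lia. }
  rewrite hu2, <- !app_assoc in e.
  apply app_inv_head in e; apply app_inv_head in e.
  clearbody t k; subst v u2; rewrite !length_app.
  replace (length u + (length (bcod g) + length t) - length (bcod g) +
    length (bdom g)) with (length (u ++ bdom g ++ t)) by (rewrite !length_app; lia).
  set (A := u ++ bdom g ++ t ++ bdom h ++ v2).
  assert (f1 : step_word A (length u) g = Some (u ++ bcod g ++ t ++ bdom h ++ v2)).
  { unfold A; apply step_word_at. }
  assert (f2 : step_word (u ++ bcod g ++ t ++ bdom h ++ v2)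
    (length u + (length (bcod g) + length t)) h =
     Some (u ++ bcod g ++ t ++ bcod h ++ v2)).
  { rewrite <- !length_app.
    replace (u ++ bcod g ++ t ++ bdom h ++ v2) with
      ((u ++ bcod g ++ t) ++ bdom h ++ v2) by (rewrite <- !app_assoc; auto).
    rewrite step_word_at, <- !app_assoc; auto. }
  assert (f3 : step_word A (length (u ++ bdom g ++ t)) h =
    Some (u ++ bdom g ++ t ++ bcod h ++ v2)).
  { unfold A; replace (u ++ bdom g ++ t ++ bdom h ++ v2) with
      ((u ++ bdom g ++ t) ++ bdom h ++ v2) by (rewrite <- !app_assoc; auto).
    rewrite step_word_at, <- !app_assoc; auto. }
  assert (f4 : step_word (u ++ bdom g ++ t ++ bcod h ++ v2) (length u) g =
     Some (u ++ bcod g ++ t ++ bcod h ++ v2)).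
  { apply step_word_at. }
  exists (u ++ bcod g ++ t ++ bcod h ++ v2); simpl.
  rewrite f1, f2, f3, f4; repeat split.
  assert (hi : forall w, hom C (ev w) (ev w) (id (ev w)))
    by (intros; apply (id_hom hC); apply ev_ob).
  assert (hid : forall w, id (ev w) ∘ id (ev w) = id (ev w))
    by (intros x; apply (id_comp hC (hi x))).
  assert (hg := bmor_hom g); assert (hh := bmor_hom h).
  set (hv := tensm_hom hC).
  assert (l1 : layer A (length u) g =
    id (ev u) ⊗ (bmor g ⊗ (id (ev t) ⊗ (id (ev (bdom h)) ⊗ id (ev v2))))).
  { unfold A; rewrite layer_at, !ev_app, <- !(tensm_id hC); auto with diag. }
  assert (l2 : layer (u ++ bcod g ++ t ++ bdom h ++ v2)
    (length u + (length (bcod g) + length t)) h =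
    id (ev u) ⊗ (id (ev (bcod g)) ⊗ (id (ev t) ⊗ (bmor h ⊗ id (ev v2))))).
  { rewrite <- !length_app.
    replace (u ++ bcod g ++ t ++ bdom h ++ v2) with
      ((u ++ bcod g ++ t) ++ bdom h ++ v2) by (rewrite <- !app_assoc; auto).
    rewrite layer_at, !ev_app, <- !(tensm_id hC) by auto with diag.
    rewrite <- (tensm_assoc hC (hi _) (hv _ _ _ _ _ _ (hi _) (hi _))
                  (hv _ _ _ _ _ _ hh (hi _))).
    rewrite <- (tensm_assoc hC (hi _) (hi _) (hv _ _ _ _ _ _ hh (hi _))).
    reflexivity. }
  assert (l3 : layer A (length (u ++ bdom g ++ t)) h =
    id (ev u) ⊗ (id (ev (bdom g)) ⊗ (id (ev t) ⊗ (bmor h ⊗ id (ev v2))))).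
  { unfold A; replace (u ++ bdom g ++ t ++ bdom h ++ v2) with
      ((u ++ bdom g ++ t) ++ bdom h ++ v2) by (rewrite <- !app_assoc; auto).
    rewrite layer_at, !ev_app, <- !(tensm_id hC) by auto with diag.
    rewrite <- (tensm_assoc hC (hi _) (hv _ _ _ _ _ _ (hi _) (hi _))
                  (hv _ _ _ _ _ _ hh (hi _))).
    rewrite <- (tensm_assoc hC (hi _) (hi _) (hv _ _ _ _ _ _ hh (hi _))).
    reflexivity. }
  assert (l4 : layer (u ++ bdom g ++ t ++ bcod h ++ v2) (length u) g =
    id (ev u) ⊗ (bmor g ⊗ (id (ev t) ⊗ (id (ev (bcod h)) ⊗ id (ev v2))))).
  { rewrite layer_at, !ev_app, <- !(tensm_id hC); auto with diag. }
  rewrite (id_comp hC (step_hom f2)), (id_comp hC (step_hom f4)), l1, l2, l3, l4.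
  assert (k1 := hv _ _ _ _ _ _ (hi t) (hv _ _ _ _ _ _ (hi (bdom h)) (hi v2))).
  assert (k2 := hv _ _ _ _ _ _ (hi t) (hv _ _ _ _ _ _ (hi (bcod h)) (hi v2))).
  assert (k3 := hv _ _ _ _ _ _ (hi t) (hv _ _ _ _ _ _ hh (hi v2))).
  rewrite <- (tensm_comp hC (hi u) (hi u) (hv _ _ _ _ _ _ hg k1)
                (hv _ _ _ _ _ _ (hi _) k3)).
  rewrite <- (tensm_comp hC (hi u) (hi u) (hv _ _ _ _ _ _ (hi _) k3)
                (hv _ _ _ _ _ _ hg k2)).
  rewrite <- (tensm_comp hC hg (hi _) k1 k3), <- (tensm_comp hC (hi _) hg k3 k2).
  rewrite (id_comp hC hg), (comp_id hC hg).
  rewrite !(tensm_id hC) by auto with diag.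
  rewrite (comp_id hC k3), (id_comp hC k3); reflexivity.
Qed.

(** ** Strands crossing boxes *)

Lemma braid_inverse X Y : isob C X -> isob C Y ->
  is_inverse (C := C) (X ⊗ Y) (Y ⊗ X) (braid C X Y) (inv (X ⊗ Y) (Y ⊗ X) (braid C X Y)).
Proof. intros; apply inv_spec; apply (braid_iso hC); auto. Qed.

Lemma braid_hom X Y : isob C X -> isob C Y -> hom C (X ⊗ Y) (Y ⊗ X) (braid C X Y).
Proof. intros hX hY; apply (braid_inverse hX hY). Qed.

Local Notation cinv X Y := (inv (C := C) (X ⊗ Y) (Y ⊗ X) (braid C X Y)).

Lemma cinv_hom X Y : isob C X -> isob C Y -> hom C (Y ⊗ X) (X ⊗ Y) (cinv X Y).
Proof. intros hX hY; apply (braid_inverse hX hY). Qed.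
Hint Resolve braid_hom cinv_hom : diag.

Lemma cinv_natural X X' Y Y' f g : hom C X X' f -> hom C Y Y' g ->
  cinv X' Y' ∘ (g ⊗ f) = (f ⊗ g) ∘ cinv X Y.
Proof.
  intros hf hg.
  destruct (hom_ob hC hf) as [hX hX'], (hom_ob hC hg) as [hY hY'].
  destruct (braid_inverse hX hY) as (a1 & a2 & a3 & a4).
  destruct (braid_inverse hX' hY') as (b1 & b2 & b3 & b4).
  assert (hgf := tensm_hom hC hg hf); assert (hfg := tensm_hom hC hf hg).
  rewrite <- (comp_id hC (comp_hom hC hgf b2)), <- a4.
  rewrite (comp_assoc hC a2 a1 (comp_hom hC hgf b2)).
  rewrite <- (comp_assoc hC a1 hgf b2), <- (braid_natural hC hf hg).
  rewrite (comp_assoc hC hfg b1 b2), b3, (id_comp hC hfg); reflexivity.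
Qed.

Lemma inverse_comp X Y Z f f' g g' :
  is_inverse (C := C) X Y f f' -> is_inverse (C := C) Y Z g g' ->
  is_inverse (C := C) X Z (g ∘ f) (f' ∘ g').
Proof.
  intros (a1 & a2 & a3 & a4) (b1 & b2 & b3 & b4).
  repeat split; [exact (comp_hom hC a1 b1) | exact (comp_hom hC b2 a2) | |].
  - rewrite (comp_assoc hC a1 b1 (comp_hom hC b2 a2)), <- (comp_assoc hC b1 b2 a2).
    rewrite b3, (comp_id hC a2); exact a3.
  - rewrite (comp_assoc hC b2 a2 (comp_hom hC a1 b1)), <- (comp_assoc hC a2 a1 b1).
    rewrite a4, (comp_id hC b1); exact b4.
Qed.

Lemma inverse_tens X Y f f' X' Y' g g' :
  is_inverse (C := C) X Y f f' -> is_inverse (C := C) X' Y' g g' ->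
  is_inverse (C := C) (X ⊗ X') (Y ⊗ Y') (f ⊗ g) (f' ⊗ g').
Proof.
  intros (a1 & a2 & a3 & a4) (b1 & b2 & b3 & b4).
  destruct (hom_ob hC a1), (hom_ob hC b1).
  repeat split; [exact (tensm_hom hC a1 b1) | exact (tensm_hom hC a2 b2) | |].
  - rewrite <- (tensm_comp hC a1 a2 b1 b2), a3, b3; apply (tensm_id hC); auto.
  - rewrite <- (tensm_comp hC a2 a1 b2 b1), a4, b4; apply (tensm_id hC); auto.
Qed.

Lemma inverse_id X : isob C X -> is_inverse (C := C) X X (id X) (id X).
Proof.
  intros h; assert (hi := id_hom hC h).
  repeat split; auto; apply (id_comp hC hi).
Qed.

Lemma inverse_sym X Y f g : is_inverse (C := C) X Y f g -> is_inverse (C := C) Y X g f.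
Proof. intros (a & b & c & d); repeat split; auto. Qed.

(** For the braidings with the unit object, which are idempotent by the hexagon
    identities. *)
Lemma iso_idempotent X f g : is_inverse (C := C) X X f g -> f = f ∘ f -> f = id X.
Proof.
  intros (a1 & a2 & a3 & a4) e.
  rewrite <- (id_comp hC a1), <- a3 at 1.
  rewrite <- (comp_assoc hC a1 a1 a2), <- e; exact a3.
Qed.

Lemma braid_unit_l X : isob C X -> braid C (unit1 C) X = id X.
Proof.
  intros hX; assert (h1 := unit_ob hC).
  assert (h := braid_inverse h1 hX).
  rewrite (unit_tens hC hX), (tens_unit hC hX) in h.
  apply (iso_idempotent h).
  rewrite <- (unit_tens hC h1) at 1; rewrite (braid_tens_l hC h1 h1 hX).
  rewrite (tensm_unit hC (proj1 h)), (unit_tensm hC (proj1 h)); reflexivity.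
Qed.

Lemma braid_unit_r X : isob C X -> braid C X (unit1 C) = id X.
Proof.
  intros hX; assert (h1 := unit_ob hC).
  assert (h := braid_inverse hX h1).
  rewrite (unit_tens hC hX), (tens_unit hC hX) in h.
  apply (iso_idempotent h).
  rewrite <- (unit_tens hC h1) at 1; rewrite (braid_tens_r hC hX h1 h1).
  rewrite (tensm_unit hC (proj1 h)), (unit_tensm hC (proj1 h)); reflexivity.
Qed.

Lemma cinv_unit_l X : isob C X -> cinv (unit1 C) X = id X.
Proof.
  intros hX; rewrite (braid_unit_l hX), (tens_unit hC hX), (unit_tens hC hX).
  apply (inv_eq hC (inverse_id hX)).
Qed.

Lemma cinv_unit_r X : isob C X -> cinv X (unit1 C) = id X.
Proof.
  intros hX; rewrite (braid_unit_r hX), (tens_unit hC hX), (unit_tens hC hX).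
  apply (inv_eq hC (inverse_id hX)).
Qed.

Lemma cinv_tens_l X Y Z : isob C X -> isob C Y -> isob C Z ->
  cinv (X ⊗ Y) Z = (id X ⊗ cinv Y Z) ∘ (cinv X Z ⊗ id Y).
Proof.
  intros hX hY hZ; apply (inv_eq hC); rewrite (braid_tens_l hC hX hY hZ).
  assert (h1 := inverse_tens (inverse_id hX) (braid_inverse hY hZ)).
  assert (h2 := inverse_tens (braid_inverse hX hZ) (inverse_id hY)).
  rewrite !(tens_assoc hC) in h1 by auto.
  rewrite <- !(tens_assoc hC hZ) in h2 by auto.
  exact (inverse_comp h1 h2).
Qed.

Lemma cinv_tens_r X Y Z : isob C X -> isob C Y -> isob C Z ->
  cinv X (Y ⊗ Z) = (cinv X Y ⊗ id Z) ∘ (id Y ⊗ cinv X Z).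
Proof.
  intros hX hY hZ; apply (inv_eq hC); rewrite (braid_tens_r hC hX hY hZ).
  assert (h2 := inverse_tens (inverse_id hY) (braid_inverse hX hZ)).
  assert (h1 := inverse_tens (braid_inverse hX hY) (inverse_id hZ)).
  rewrite !(tens_assoc hC) in h2 by auto.
  rewrite <- (tens_assoc hC hX) in h1 by auto.
  exact (inverse_comp h1 h2).
Qed.

(** The strand [z] passing across the strands [w], from the right and from the
    left, under or over. *)
Fixpoint br_r (w : word) (z : nat) : diagram :=
  match w with nil => nil | x :: w => shift 1 (br_r w z) ++ [(0, Br x z)] end.
Fixpoint bi_r (w : word) (z : nat) : diagram :=
  match w with nil => nil | x :: w => shift 1 (bi_r w z) ++ [(0, Bi z x)] end.
Fixpoint br_l (z : nat) (w : word) : diagram :=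
  match w with nil => nil | x :: w => (0, Br z x) :: shift 1 (br_l z w) end.
Fixpoint bi_l (z : nat) (w : word) : diagram :=
  match w with nil => nil | x :: w => (0, Bi x z) :: shift 1 (bi_l z w) end.

Lemma strip_app p v : strip p (p ++ v) = Some v.
Proof. apply strip_spec; reflexivity. Qed.

Lemma box_value b v :
  target (bdom b ++ v) [(0, b)] = Some (bcod b ++ v) /\
  value (bdom b ++ v) [(0, b)] = bmor b ⊗ id (ev v).
Proof.
  assert (e := step_word_at [] b v); simpl in e.
  simpl; rewrite strip_app; split; auto.
  assert (hb := tensm_hom hC (bmor_hom b) (id_hom hC (ev_ob v))).
  assert (h := layer_at [] b v); simpl in h; rewrite h.
  rewrite (unit_tensm hC hb), ev_app, (id_comp hC hb); reflexivity.
Qed.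

Lemma shift0 d : shift 0 d = d.
Proof.
  unfold shift; rewrite <- (map_id d) at 2; apply map_ext; intros [n b]; auto.
Qed.

Lemma br_r_value w z : target (w ++ [z]) (br_r w z) = Some (z :: w) /\
  value (w ++ [z]) (br_r w z) = braid C (ev w) (ob_at z).
Proof.
  induction w as [|x w [IH1 IH2]]; simpl br_r.
  - simpl; rewrite (tens_unit hC (ob_at_ok z)), (braid_unit_l (ob_at_ok z)); auto.
  - destruct (whisker_value [x] [] IH1) as [k1 k2]; rewrite !app_nil_r in *.
    destruct (box_value (Br x z) w) as [b1 b2].
    change ((x :: w) ++ [z]) with ([x] ++ w ++ [z]).
    simpl app in k1, k2, b1, b2 |- *; simpl length in k1, k2.
    split; [rewrite target_app, k1; exact b1|].
    rewrite (value_app k1 b1), b2, k2, IH2; simpl ev; simpl bmor.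
    assert (hxz := braid_hom (ob_at_ok x) (ob_at_ok z)).
    assert (hwz := braid_hom (ev_ob w) (ob_at_ok z)).
    rewrite (tensm_unit hC hwz), (tens_unit hC (ob_at_ok x)).
    rewrite (braid_tens_l hC (ob_at_ok x) (ev_ob w) (ob_at_ok z)); reflexivity.
Qed.

Lemma bi_r_value w z : target (w ++ [z]) (bi_r w z) = Some (z :: w) /\
  value (w ++ [z]) (bi_r w z) = cinv (ob_at z) (ev w).
Proof.
  induction w as [|x w [IH1 IH2]]; simpl bi_r.
  - simpl; split; auto.
    rewrite (cinv_unit_r (ob_at_ok z)), (tens_unit hC (ob_at_ok z)); auto.
  - destruct (whisker_value [x] [] IH1) as [k1 k2]; rewrite !app_nil_r in *.
    destruct (box_value (Bi z x) w) as [b1 b2].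
    change ((x :: w) ++ [z]) with ([x] ++ w ++ [z]).
    simpl app in k1, k2, b1, b2 |- *; simpl length in k1, k2.
    split; [rewrite target_app, k1; exact b1|].
    rewrite (value_app k1 b1), b2, k2, IH2; simpl ev; simpl bmor.
    assert (hxz := cinv_hom (ob_at_ok z) (ob_at_ok x)).
    assert (hwz := cinv_hom (ob_at_ok z) (ev_ob w)).
    rewrite (tensm_unit hC hwz), (tens_unit hC (ob_at_ok x)).
    rewrite (cinv_tens_r (ob_at_ok z) (ob_at_ok x) (ev_ob w)); reflexivity.
Qed.

Lemma br_l_value z w : target (z :: w) (br_l z w) = Some (w ++ [z]) /\
  value (z :: w) (br_l z w) = braid C (ob_at z) (ev w).
Proof.
  induction w as [|x w [IH1 IH2]]; simpl br_l.
  - simpl; split; auto.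
    rewrite (tens_unit hC (ob_at_ok z)), (braid_unit_r (ob_at_ok z)); auto.
  - destruct (box_value (Br z x) w) as [b1 b2].
    destruct (whisker_value [x] [] IH1) as [k1 k2]; rewrite !app_nil_r in *.
    change ((0, Br z x) :: shift 1 (br_l z w)) with ([(0, Br z x)] ++ shift 1 (br_l z w)).
    simpl app in k1, k2, b1, b2; simpl length in k1, k2.
    split; [rewrite target_app; rewrite b1; exact k1|].
    rewrite (value_app b1 k1), b2, k2, IH2; simpl bmor.
    assert (hxz := braid_hom (ob_at_ok z) (ob_at_ok x)).
    assert (hwz := braid_hom (ob_at_ok z) (ev_ob w)).
    change (ev []) with (unit1 C); rewrite (tensm_unit hC hwz), ev1.
    symmetry; apply (braid_tens_r hC (ob_at_ok z) (ob_at_ok x) (ev_ob w)).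
Qed.

Lemma bi_l_value z w : target (z :: w) (bi_l z w) = Some (w ++ [z]) /\
  value (z :: w) (bi_l z w) = cinv (ev w) (ob_at z).
Proof.
  induction w as [|x w [IH1 IH2]]; simpl bi_l.
  - simpl; split; auto.
    rewrite (cinv_unit_l (ob_at_ok z)), (tens_unit hC (ob_at_ok z)); auto.
  - destruct (box_value (Bi x z) w) as [b1 b2].
    destruct (whisker_value [x] [] IH1) as [k1 k2]; rewrite !app_nil_r in *.
    change ((0, Bi x z) :: shift 1 (bi_l z w)) with ([(0, Bi x z)] ++ shift 1 (bi_l z w)).
    simpl app in k1, k2, b1, b2; simpl length in k1, k2.
    split; [rewrite target_app; rewrite b1; exact k1|].
    rewrite (value_app b1 k1), b2, k2, IH2; simpl bmor.
    assert (hxz := cinv_hom (ob_at_ok x) (ob_at_ok z)).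
    assert (hwz := cinv_hom (ev_ob w) (ob_at_ok z)).
    change (ev []) with (unit1 C); rewrite (tensm_unit hC hwz), ev1.
    symmetry; apply (cinv_tens_l (ob_at_ok x) (ev_ob w) (ob_at_ok z)).
Qed.

(** The strands [u] passing across the strands [v]. *)
Fixpoint br_w (u v : word) : diagram :=
  match u with nil => nil | x :: u => shift 1 (br_w u v) ++ br_l x v end.
Fixpoint bi_w (u v : word) : diagram :=
  match u with nil => nil | x :: u => bi_r v x ++ shift 1 (bi_w u v) end.

Lemma br_w_value u v : target (u ++ v) (br_w u v) = Some (v ++ u) /\
  value (u ++ v) (br_w u v) = braid C (ev u) (ev v).
Proof.
  induction u as [|x u [IH1 IH2]]; simpl br_w.
  - simpl; rewrite app_nil_r; split; auto; symmetry; apply braid_unit_l, ev_ob.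
  - destruct (whisker_value [x] [] IH1) as [k1 k2].
    destruct (br_l_value x v) as [b1 b2].
    destruct (whisker_value [] u b1) as [c1 c2].
    rewrite shift0 in c1, c2.
    rewrite !app_nil_r in *; rewrite <- app_assoc in c1; simpl app in k1, k2, c1, c2.
    simpl app; simpl length in k1, k2; split; [rewrite target_app, k1; exact c1|].
    rewrite (value_app k1 c1), k2, c2, b2, IH2; simpl ev.
    assert (h1 := braid_hom (ev_ob u) (ev_ob v)).
    assert (h2 := tensm_hom hC (braid_hom (ob_at_ok x) (ev_ob v))
                    (id_hom hC (ev_ob u))).
    rewrite (tensm_unit hC h1), (unit_tensm hC h2), (tens_unit hC (ob_at_ok x)).
    rewrite (braid_tens_l hC (ob_at_ok x) (ev_ob u) (ev_ob v)); auto.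
Qed.

Lemma bi_w_value u v : target (v ++ u) (bi_w u v) = Some (u ++ v) /\
  value (v ++ u) (bi_w u v) = cinv (ev u) (ev v).
Proof.
  induction u as [|x u [IH1 IH2]]; simpl bi_w.
  - simpl; rewrite app_nil_r; split; auto; symmetry; apply cinv_unit_l, ev_ob.
  - destruct (whisker_value [x] [] IH1) as [k1 k2].
    destruct (bi_r_value v x) as [b1 b2].
    destruct (whisker_value [] u b1) as [c1 c2].
    rewrite shift0 in c1, c2.
    rewrite !app_nil_r in *; rewrite <- app_assoc in c1, c2; simpl app in k1, k2, c1, c2.
    simpl app; simpl length in k1, k2; split; [rewrite target_app, c1; exact k1|].
    rewrite (value_app c1 k1), k2, c2, b2, IH2; simpl ev.
    assert (h1 := cinv_hom (ev_ob u) (ev_ob v)).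
    assert (h2 := tensm_hom hC (cinv_hom (ob_at_ok x) (ev_ob v))
                    (id_hom hC (ev_ob u))).
    rewrite (tensm_unit hC h1), (unit_tensm hC h2), (tens_unit hC (ob_at_ok x)).
    rewrite (cinv_tens_l (ob_at_ok x) (ev_ob u) (ev_ob v)); auto.
Qed.

(** ** Rewriting rules *)

Record rule := Rule { rword : word; rlhs : diagram; rrhs : diagram }.

Definition rule_ok (r : rule) : Prop := same (rword r) (rlhs r) (rrhs r).

Definition flip (r : rule) : rule := Rule (rword r) (rrhs r) (rlhs r).

Lemma flip_ok r : rule_ok r -> rule_ok (flip r).
Proof. apply same_sym. Qed.

(** By naturality, a box moves along a strand that crosses all of its legs.  There
    are four cases, given by the side on which the strand starts and by the sign of
    the crossings. *)
Inductive crossing := BrRight | BiRight | BrLeft | BiLeft.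

Definition slide (k : crossing) (b : box) (z : nat) : rule :=
  match k with
  | BrRight => Rule (bdom b ++ [z]) (br_r (bdom b) z ++ [(1, b)])
                 ([(0, b)] ++ br_r (bcod b) z)
  | BiRight => Rule (bdom b ++ [z]) (bi_r (bdom b) z ++ [(1, b)])
                 ([(0, b)] ++ bi_r (bcod b) z)
  | BrLeft => Rule (z :: bdom b) (br_l z (bdom b) ++ [(0, b)])
                 ([(1, b)] ++ br_l z (bcod b))
  | BiLeft => Rule (z :: bdom b) (bi_l z (bdom b) ++ [(0, b)])
                 ([(1, b)] ++ bi_l z (bcod b))
  end.

Lemma box_right b z :
  target (z :: bdom b) [(1, b)] = Some (z :: bcod b) /\
  value (z :: bdom b) [(1, b)] = id (ob_at z) ⊗ bmor b.
Proof.
  destruct (box_value b []) as [h1 h2]; rewrite !app_nil_r in *.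
  destruct (whisker_value [z] [] h1) as [k1 k2]; rewrite !app_nil_r in *.
  split; [exact k1|]; change [(1, b)] with (shift (length [z]) [(0, b)]).
  simpl app in k2; rewrite k2, h2, ev1; simpl ev.
  rewrite !(tensm_unit hC (bmor_hom b)); auto.
Qed.

Lemma slide_ok k b z : rule_ok (slide k b z).
Proof.
  assert (hz := id_hom hC (ob_at_ok z)); assert (hb := bmor_hom b).
  destruct (box_value b [z]) as [v1 v2]; destruct (box_right b z) as [r1 r2].
  rewrite ev1 in v2.
  destruct (box_value b []) as [n1 n2]; rewrite !app_nil_r in *.
  simpl ev in n2; rewrite (tensm_unit hC hb) in n2.
  assert (l1 : target (bdom b ++ [z]) [(0, b)] = Some (bcod b ++ [z])) by apply v1.
  unfold rule_ok, same; destruct k; cbn [slide rword rlhs rrhs].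
  - exists (z :: bcod b); rewrite !target_app.
    destruct (br_r_value (bdom b) z) as [a1 a2], (br_r_value (bcod b) z) as [c1 c2].
    rewrite a1, l1; repeat split; auto.
    rewrite (value_app a1 r1), (value_app v1 c1), a2, c2, r2, v2; symmetry.
    apply (braid_natural hC hb hz).
  - exists (z :: bcod b); rewrite !target_app.
    destruct (bi_r_value (bdom b) z) as [a1 a2], (bi_r_value (bcod b) z) as [c1 c2].
    rewrite a1, l1; repeat split; auto.
    rewrite (value_app a1 r1), (value_app v1 c1), a2, c2, r2, v2; symmetry.
    apply (cinv_natural hz hb).
  - exists (bcod b ++ [z]); rewrite !target_app.
    destruct (br_l_value z (bdom b)) as [a1 a2], (br_l_value z (bcod b)) as [c1 c2].
    rewrite a1, r1; repeat split; auto.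
    rewrite (value_app a1 v1), (value_app r1 c1), a2, c2, r2, v2; symmetry.
    apply (braid_natural hC hz hb).
  - exists (bcod b ++ [z]); rewrite !target_app.
    destruct (bi_l_value z (bdom b)) as [a1 a2], (bi_l_value z (bcod b)) as [c1 c2].
    rewrite a1, r1; repeat split; auto.
    rewrite (value_app a1 v1), (value_app r1 c1), a2, c2, r2, v2; symmetry.
    apply (cinv_natural hb hz).
Qed.

Definition cancel (s : bool) (x y : nat) : rule :=
  if s then Rule [x; y] [(0, Br x y); (0, Bi x y)] []
  else Rule [y; x] [(0, Bi x y); (0, Br x y)] [].

Lemma cancel_ok s x y : rule_ok (cancel s x y).
Proof.
  destruct (braid_inverse (ob_at_ok x) (ob_at_ok y)) as (a1 & a2 & a3 & a4).
  destruct (box_value (Br x y) []) as [b1 b2], (box_value (Bi x y) []) as [c1 c2].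
  rewrite !app_nil_r in *; simpl bdom in *; simpl bcod in *.
  simpl ev in b2, c2; simpl bmor in b2, c2.
  rewrite (tensm_unit hC a1) in b2; rewrite (tensm_unit hC a2) in c2.
  unfold rule_ok, same; destruct s; cbn [cancel rword rlhs rrhs].
  - exists [x; y].
    change [(0, Br x y); (0, Bi x y)] with ([(0, Br x y)] ++ [(0, Bi x y)]).
    rewrite target_app, (value_app b1 c1), b1, b2, c2; repeat split; auto.
    rewrite a3, <- ev2; reflexivity.
  - exists [y; x].
    change [(0, Bi x y); (0, Br x y)] with ([(0, Bi x y)] ++ [(0, Br x y)]).
    rewrite target_app, (value_app c1 b1), c1, b2, c2; repeat split; auto.
    rewrite a4, <- ev2; reflexivity.
Qed.

(** ** Checking a sequence of moves *)

Definition box_eqb (a b : box) : bool :=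
  match a, b with
  | Br x y, Br x' y' | Bi x y, Bi x' y' => Nat.eqb x x' && Nat.eqb y y'
  | Bx i, Bx j => Nat.eqb i j
  | _, _ => false
  end.

Lemma box_eqb_eq a b : box_eqb a b = true -> a = b.
Proof.
  destruct a, b; simpl; try discriminate; rewrite ?andb_true_iff, ?Nat.eqb_eq;
    intros; f_equal; intuition.
Qed.

Fixpoint strip_diagram (n : nat) (l d : diagram) : option diagram :=
  match l, d with
  | nil, _ => Some d
  | (m, b) :: l, (m', b') :: d =>
      if Nat.eqb (n + m) m' && box_eqb b b' then strip_diagram n l d else None
  | _, nil => None
  end.

Lemma strip_diagram_spec n l d q :
  strip_diagram n l d = Some q -> d = shift n l ++ q.
Proof.
  revert d; induction l as [|[m b] l IH]; intros d; simpl; [congruence|].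
  destruct d as [|[m' b'] d]; [discriminate|].
  destruct (Nat.eqb_spec (n + m) m') as [<-|]; [|discriminate]; simpl.
  destruct (box_eqb b b') eqn:e; [|discriminate]; apply box_eqb_eq in e; subst b'.
  intros h; rewrite (IH _ h); reflexivity.
Qed.

Inductive rule_id :=
| User (k : nat)
| Slide (forward : bool) (k : crossing) (b : box) (z : nat)
| Cancel (s : bool) (x y : nat).

(** [SwapR i] and [SwapL i] exchange the boxes [i] and [i + 1], the second of
    which is on the right, or left, of the first one. *)
Inductive move := SwapR (i : nat) | SwapL (i : nat) | Rewrite (i n : nat) (r : rule_id).

Variable rules : list rule.
Hypothesis rules_ok : Forall rule_ok rules.

Definition rule_of (r : rule_id) : rule :=
  match r with
  | User k => nth k rules (Rule [] [] [])
  | Slide forward k b z => if forward then slide k b z else flip (slide k b z)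
  | Cancel s x y => cancel s x y
  end.

Lemma rule_of_ok r : rule_ok (rule_of r).
Proof.
  destruct r as [k | [|] k b z | s x y]; simpl.
  - destruct (nth_in_or_default k rules (Rule [] [] [])) as [h | ->].
    + exact (proj1 (Forall_forall _ _) rules_ok _ h).
    + exists []; auto.
  - apply slide_ok.
  - apply flip_ok, slide_ok.
  - apply cancel_ok.
Qed.

Definition run_move (w : word) (d : diagram) (mv : move) : option diagram :=
  match mv with
  | SwapR i =>
      match skipn i d with
      | (n, g) :: (m, h) :: q =>
          if n + length (bcod g) <=? m then
            Some (firstn i d ++
              [(m - length (bcod g) + length (bdom g), h); (n, g)] ++ q)
          else None
      | _ => None
      end
  | SwapL i =>
      match skipn i d with
      | (n, g) :: (m, h) :: q =>
          let d' := [(m, h); (n - length (bdom h) + length (bcod h), g)] in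
          if m + length (bdom h) <=? n then
            match target w (firstn i d) with
            | Some w1 => match target w1 d' with
                         | Some _ => Some (firstn i d ++ d' ++ q)
                         | None => None end
            | None => None
            end
          else None
      | _ => None
      end
  | Rewrite i n r =>
      match target w (firstn i d), strip_diagram n (rlhs (rule_of r)) (skipn i d) with
      | Some w1, Some q =>
          match strip (rword (rule_of r)) (skipn n w1) with
          | Some _ => if n <=? length w1
                      then Some (firstn i d ++ shift n (rrhs (rule_of r)) ++ q)
                      else None
          | None => None
          end
      | _, _ => None
      end
  end.

Lemma target_prefix w p q w' : target w (p ++ q) = Some w' ->
  exists w1, target w p = Some w1 /\ target w1 q = Some w'.
Proof.
  rewrite target_app; destruct (target w p) as [w1|]; [|discriminate]; eauto.
Qed.

Lemma run_move_sound w d mv w' d' :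
  target w d = Some w' -> run_move w d mv = Some d' -> same w d d'.
Proof.
  destruct mv as [i | i | i n r]; cbn [run_move]; generalize (firstn_skipn i d);
    generalize (firstn i d) (skipn i d); intros p q <- hd.
  - destruct q as [|[n g] [|[m h] q]]; try discriminate.
    destruct (Nat.leb_spec (n + length (bcod g)) m) as [le|]; [|discriminate].
    intros [= <-].
    change ((n, g) :: (m, h) :: q) with ([(n, g); (m, h)] ++ q) in *.
    destruct (target_prefix hd) as (w1 & h1 & h2).
    destruct (target_prefix h2) as (w2 & h3 & h4).
    exact (same_app h1 (same_swap le h3) hd).
  - destruct q as [|[n g] [|[m h] q]]; try discriminate.
    destruct (Nat.leb_spec (m + length (bdom h)) n) as [le|]; [|discriminate].
    destruct (target w p) as [w1|] eqn:h1; [|discriminate].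
    destruct (target w1 [(m, h); _]) as [w2|] eqn:h2; [|discriminate].
    intros [= <-].
    change ((n, g) :: (m, h) :: q) with ([(n, g); (m, h)] ++ q) in *.
    refine (same_app (d' := [(m, h); _]) h1 (same_sym _) hd).
    assert (k : m + length (bcod h) <= n - length (bdom h) + length (bcod h)) by lia.
    assert (e := same_swap k h2).
    replace (n - length (bdom h) + length (bcod h) - length (bcod h) + length (bdom h))
      with n in e by lia; exact e.
  - destruct (target w p) as [w1|] eqn:h1; [|discriminate].
    destruct (strip_diagram _ _ _) as [q'|] eqn:h2; [|discriminate].
    destruct (strip _ _) as [v|] eqn:h3; [|discriminate].
    destruct (Nat.leb_spec n (length w1)) as [le|]; [|discriminate].
    intros [= <-]; apply strip_diagram_spec in h2; apply strip_spec in h3; subst q.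
    assert (e : w1 = firstn n w1 ++ rword (rule_of r) ++ v)
      by (rewrite <- h3; symmetry; apply firstn_skipn).
    assert (hn : length (firstn n w1) = n) by (apply firstn_length_le; exact le).
    revert hn e h1; generalize (firstn n w1); intros u <- -> h1.
    destruct (rule_of_ok r) as (w2 & a1 & a2 & a3).
    destruct (whisker_value u v a1) as [b1 b2], (whisker_value u v a2) as [c1 c2].
    refine (same_app h1 _ hd); exists (u ++ w2 ++ v); repeat split; auto; congruence.
Qed.

Fixpoint run (w : word) (d : diagram) (mvs : list move) : option diagram :=
  match mvs with
  | nil => Some d
  | mv :: mvs => match run_move w d mv with
                 | Some d' => run w d' mvs | None => None end
  end.

Lemma run_sound w d mvs w' d' :
  target w d = Some w' -> run w d mvs = Some d' -> same w d d'.
Proof.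
  revert d; induction mvs as [|mv mvs IH]; simpl; intros d hd.
  - intros [= <-]; exact (same_refl hd).
  - destruct (run_move w d mv) as [d1|] eqn:e; [|discriminate]; intros h.
    assert (s := run_move_sound hd e).
    destruct s as (w1 & s1 & s2 & s3); rewrite s1 in hd; injection hd as ->.
    apply same_trans with d1; [exists w'; auto | exact (IH _ s2 h)].
Qed.

End Diagrams.

(** ** From arrows to diagrams *)

(** Syntax of objects and arrows, of which words and diagrams are the strictified
    form. *)
Inductive oexp := OUnit | OAtom (i : nat) | OTens (a b : oexp).

Inductive mexp :=
| MId (a : oexp)
| MComp (g f : mexp)
| MTens (f g : mexp)
| MBraid (a b : oexp)
| MCinv (a b : oexp)
| MGen (i : nat).

Fixpoint oflat (a : oexp) : word :=
  match a with OUnit => [] | OAtom i => [i] | OTens a b => oflat a ++ oflat b end.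

Section Reflection.

Variable C : catData.
Hypothesis hC : is_braided_category C.
Local Notation "X ⊗ Y" := (tens C X Y) : ob_scope.
Local Notation "f ⊗ g" := (tensm C f g) : mor_scope.
Local Notation "g ∘ f" := (comp C g f) : mor_scope.
Local Notation id := (idm C).
Local Open Scope mor_scope.

Variables (objs : list (ob C)) (gens : list (gen C)).
Hypothesis objs_ok : Forall (isob C) objs.

Fixpoint oden (a : oexp) : ob C :=
  match a with
  | OUnit => unit1 C
  | OAtom i => ob_at objs i
  | OTens a b => (oden a ⊗ oden b)%ob
  end.

Fixpoint mden (m : mexp) : mor C :=
  match m with
  | MId a => id (oden a)
  | MComp g f => mden g ∘ mden f
  | MTens f g => mden f ⊗ mden g
  | MBraid a b => braid C (oden a) (oden b)
  | MCinv a b => inv (C := C) (oden a ⊗ oden b) (oden b ⊗ oden a)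
                   (braid C (oden a) (oden b))
  | MGen i => garr (gen_at gens i)
  end.

Fixpoint flatten (m : mexp) : option (word * diagram * word) :=
  match m with
  | MId a => Some (oflat a, [], oflat a)
  | MComp g f =>
      match flatten f, flatten g with
      | Some (u, d, v), Some (v', e, w) =>
          if weqb v v' then Some (u, d ++ e, w) else None
      | _, _ => None
      end
  | MTens f g =>
      match flatten f, flatten g with
      | Some (u, d, v), Some (u', e, v') =>
          Some (u ++ u', d ++ shift (length v) e, v ++ v')
      | _, _ => None
      end
  | MBraid a b => Some (oflat a ++ oflat b, br_w (oflat a) (oflat b), oflat b ++ oflat a)
  | MCinv a b => Some (oflat b ++ oflat a, bi_w (oflat a) (oflat b), oflat a ++ oflat b)
  | MGen i => Some (gdom (gen_at gens i), [(0, Bx i)], gcod (gen_at gens i))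
  end.

Lemma oflat_ev a : ev objs (oflat a) = oden a.
Proof.
  induction a as [| i | a IHa b IHb]; simpl; auto.
  - apply (tens_unit hC); apply ob_at_ok; auto.
  - rewrite (ev_app hC objs_ok); congruence.
Qed.

Lemma gen_ok a b f : hom C (oden a) (oden b) f ->
  hom C (ev objs (gdom (Gen (oflat a) (oflat b) f)))
    (ev objs (gcod (Gen (oflat a) (oflat b) f))) (garr (Gen (oflat a) (oflat b) f)).
Proof. simpl; rewrite !oflat_ev; auto. Qed.

Hypothesis gens_ok :
  Forall (fun g => hom C (ev objs (gdom g)) (ev objs (gcod g)) (garr g)) gens.

Local Notation target := (target gens).
Local Notation value := (value objs gens).

Lemma flatten_sound m u d v : flatten m = Some (u, d, v) ->
  target u d = Some v /\ value u d = mden m.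
Proof.
  revert u d v; induction m as [a | g IHg f IHf | f IHf g IHg | a b | a b | i];
    simpl; intros u d v.
  - intros [= <- <- <-]; simpl; rewrite oflat_ev; auto.
  - destruct (flatten f) as [[[u1 d1] v1]|]; [|discriminate].
    destruct (flatten g) as [[[u2 d2] v2]|]; [|discriminate].
    destruct (weqb v1 u2) eqn:e; [|discriminate]; apply weqb_eq in e; subst u2.
    intros [= <- <- <-].
    destruct (IHf _ _ _ eq_refl) as [a1 a2], (IHg _ _ _ eq_refl) as [b1 b2].
    rewrite (target_app gens), a1, (value_app hC objs_ok gens_ok a1 b1); split; congruence.
  - destruct (flatten f) as [[[u1 d1] v1]|]; [|discriminate].
    destruct (flatten g) as [[[u2 d2] v2]|]; [|discriminate].
    intros [= <- <- <-].
    destruct (IHf _ _ _ eq_refl) as [a1 a2], (IHg _ _ _ eq_refl) as [b1 b2].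
    destruct (whisker_value hC objs_ok gens_ok [] u2 a1) as [c1 c2].
    destruct (whisker_value hC objs_ok gens_ok v1 [] b1) as [e1 e2].
    rewrite shift0 in c1, c2; rewrite !app_nil_r in *; simpl app in c1, c2.
    split; [rewrite (target_app gens), c1; exact e1|].
    rewrite (value_app hC objs_ok gens_ok c1 e1), c2, e2, a2, b2; simpl ev.
    assert (hf := value_hom hC objs_ok gens_ok a1); rewrite a2 in hf.
    assert (hg := value_hom hC objs_ok gens_ok b1); rewrite b2 in hg.
    assert (i1 := id_hom hC (proj2 (hom_ob hC hf))).
    assert (i2 := id_hom hC (proj1 (hom_ob hC hg))).
    rewrite (tensm_unit hC hg), (unit_tensm hC (tensm_hom hC hf i2)).
    rewrite <- (tensm_comp hC hf i1 i2 hg), (id_comp hC hf), (comp_id hC hg); auto.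
  - intros [= <- <- <-].
    destruct (br_w_value hC objs_ok gens_ok (oflat a) (oflat b)) as [h1 h2].
    rewrite !oflat_ev in h2; auto.
  - intros [= <- <- <-].
    destruct (bi_w_value hC objs_ok gens_ok (oflat a) (oflat b)) as [h1 h2].
    rewrite !oflat_ev in h2; auto.
  - intros [= <- <- <-].
    destruct (box_value hC objs_ok gens_ok (Bx i) []) as [h1 h2].
    rewrite !app_nil_r in *; split; auto.
    simpl bdom in h2; rewrite h2; simpl.
    apply (tensm_unit hC (bmor_hom hC objs_ok gens_ok (Bx i))).
Qed.

Lemma arrow_hom m a b u d v : flatten m = Some (u, d, v) ->
  u = oflat a -> v = oflat b -> hom C (oden a) (oden b) (mden m).
Proof.
  intros h -> ->; destruct (flatten_sound h) as [h1 h2].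
  rewrite <- !oflat_ev, <- h2; apply (value_hom hC objs_ok gens_ok h1).
Qed.

(** An equation between arrows is a rule in both directions, once the moves
    [s] and [s'] have been applied to its two sides. *)
Definition rules_of (e : mexp * mexp * (list move * list move)) : list rule :=
  match flatten (fst (fst e)), flatten (snd (fst e)) with
  | Some (u, d, v), Some (u', d', v') =>
      match run gens [] u d (fst (snd e)), run gens [] u' d' (snd (snd e)) with
      | Some c, Some c' =>
          if weqb u u' && weqb v v' then [Rule u c c'; Rule u c' c] else []
      | _, _ => []
      end
  | _, _ => []
  end.

Definition equation_holds (e : mexp * mexp) : Prop := mden (fst e) = mden (snd e).

Lemma rules_of_ok es : Forall (fun e => equation_holds (fst e)) es ->
  Forall (rule_ok objs gens) (flat_map rules_of es).
Proof.
  intros h; rewrite Forall_flat_map; revert h; apply Forall_impl.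
  intros [[m m'] [s s']] e; unfold equation_holds, rules_of in *; simpl in *.
  destruct (flatten m) as [[[u d] v]|] eqn:h; [|constructor].
  destruct (flatten m') as [[[u' d'] v']|] eqn:h'; [|constructor].
  destruct (run gens [] u d s) as [c|] eqn:r; [|constructor].
  destruct (run gens [] u' d' s') as [c'|] eqn:r'; [|constructor].
  destruct (weqb u u') eqn:e1; [|constructor]; simpl.
  destruct (weqb v v') eqn:e2; [|constructor].
  apply weqb_eq in e1, e2; subst u' v'.
  destruct (flatten_sound h) as [a1 a2], (flatten_sound h') as [b1 b2].
  assert (k := run_sound hC objs_ok gens_ok (Forall_nil _) a1 r).
  assert (k' := run_sound hC objs_ok gens_ok (Forall_nil _) b1 r').
  assert (t : same objs gens u c c').
  { refine (same_trans (same_sym k) (same_trans _ k')).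
    exists v; repeat split; congruence. }
  constructor; [exact t | constructor; [exact (same_sym t) | constructor]].
Qed.

Fixpoint diagram_eqb (d e : diagram) : bool :=
  match d, e with
  | nil, nil => true
  | (n, b) :: d, (m, c) :: e => Nat.eqb n m && box_eqb b c && diagram_eqb d e
  | _, _ => false
  end.

Lemma diagram_eqb_eq d e : diagram_eqb d e = true -> d = e.
Proof.
  revert e; induction d as [|[n b] d IH]; intros [|[m c] e]; simpl; try discriminate; auto.
  rewrite !andb_true_iff; intros [[h1 h2] h3].
  apply Nat.eqb_eq in h1; apply box_eqb_eq in h2; rewrite (IH _ h3); congruence.
Qed.

(** The moves [s] and [s'] lead from [e] to a common diagram. *)
Definition check (es : list (mexp * mexp * (list move * list move))) (e : mexp * mexp)
  (s s' : list move) : bool :=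
  match flatten (fst e), flatten (snd e) with
  | Some (u, d, v), Some (u', d', v') =>
      weqb u u' &&
      let rs := flat_map rules_of es in
      match run gens rs u d s, run gens rs u d' s' with
      | Some c, Some c' => diagram_eqb c c'
      | _, _ => false
      end
  | _, _ => false
  end.

Lemma check_sound es e s s' :
  Forall (fun e => equation_holds (fst e)) es -> check es e s s' = true -> equation_holds e.
Proof.
  destruct e as [m m']; unfold check, equation_holds; simpl; intros hs.
  destruct (flatten m) as [[[u d] v]|] eqn:h; [|discriminate].
  destruct (flatten m') as [[[u' d'] v']|] eqn:h'; [|discriminate].
  rewrite andb_true_iff; intros [e k]; apply weqb_eq in e; subst u'.
  destruct (run gens _ u d s) as [c|] eqn:r; [|discriminate].
  destruct (run gens _ u d' s') as [c'|] eqn:r'; [|discriminate].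
  apply diagram_eqb_eq in k; subst c'.
  destruct (flatten_sound h) as [a1 a2], (flatten_sound h') as [b1 b2].
  assert (ok := rules_of_ok hs).
  destruct (run_sound hC objs_ok gens_ok ok a1 r) as (w1 & c1 & c2 & c3).
  destruct (run_sound hC objs_ok gens_ok ok b1 r') as (w2 & e1 & e2 & e3).
  congruence.
Qed.

End Reflection.

(** ** Finding the moves

    Nothing is proved about the search below, since its outcome, a list of moves, is
    checked afterwards.  It is a breadth-first search from both sides of an equation,
    in which the diagrams are compared after a structural simplification. *)

Section Search.

Variable C : catData.
Variable gens : list (gen C).
Local Notation dlen b := (length (bdom gens b)).
Local Notation clen b := (length (bcod gens b)).
Local Notation step := (nat * box)%type.

Definition swap_l (a b : step) : option (step * step) :=
  if fst b + dlen (snd b) <=? fst a then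
    Some (b, (fst a - dlen (snd b) + clen (snd b), snd a))
  else None.

Definition swap_r (a b : step) : option (step * step) :=
  if fst a + clen (snd a) <=? fst b then
    Some ((fst b - clen (snd a) + dlen (snd a), snd b), a)
  else None.

(* A diagram with the moves that led to it, latest first *)
Definition state := (list move * diagram)%type.

(* Planar isotopy is decided by sorting: the boxes further to the left come first
   whenever the order of the layers is immaterial. *)
Fixpoint sink (pre : list step) (x : step) (log : list move) : list move * list step :=
  match pre with
  | nil => (log, [x])
  | p :: pre' =>
      match swap_l p x with
      | Some (x', p') =>
          let '(log', l) := sink pre' x' (SwapL (length pre') :: log) in (log', p' :: l)
      | None => (log, x :: pre)
      end
  end.

Fixpoint sort_pass (pre d : list step) (log : list move) : state :=
  match d with
  | nil => (log, rev pre)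
  | x :: d => let '(log', pre') := sink pre x log in sort_pass pre' d log'
  end.

Fixpoint planar (fuel : nat) (s : state) : state :=
  match fuel with
  | O => s
  | S fuel =>
      let s' := sort_pass [] (snd s) (fst s) in
      if Nat.eqb (length (fst s')) (length (fst s)) then s else planar fuel s'
  end.

Definition set2 (d : diagram) (i : nat) (a b : step) : diagram :=
  firstn i d ++ [a; b] ++ skipn (i + 2) d.

(* The box at position [p] moves [k] layers towards the source. *)
Fixpoint lift (k : nat) (p : nat) (s : state) : option state :=
  match k with
  | O => Some s
  | S k =>
      match nth_error (snd s) (p - 1), nth_error (snd s) p with
      | Some a, Some b =>
          match swap_l a b with
          | Some (b', a') =>
              lift k (p - 1) (SwapL (p - 1) :: fst s, set2 (snd s) (p - 1) b' a')
          | None =>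
              match swap_r a b with
              | Some (b', a') =>
                  lift k (p - 1) (SwapR (p - 1) :: fst s, set2 (snd s) (p - 1) b' a')
              | None => None
              end
          end
      | _, _ => None
      end
  end.

(* The block [st, en) matches the beginning of the pattern at offset [n]; the
   rest [l] is looked for from position [p] on. *)
Fixpoint extend (fuel : nat) (o0 : nat) (l : diagram) (st en n p : nat) (s : state)
  : list (nat * nat * state) :=
  match fuel, l with
  | _, nil => [(st, n, s)]
  | O, _ => []
  | S fuel, (m, b) :: l' =>
      match nth_error (snd s) p with
      | None => []
      | Some (_, c) =>
          let skip :=
            match lift (p - st) p s with
            | Some s' =>
                match nth_error (snd s') (S st) with
                | Some (o, _) =>
                    if o0 <=? o then extend fuel o0 l (S st) (S en) (o - o0) (S p) s'
                    else []
                | None => []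
                end
            | None => extend fuel o0 l st en n (S p) s
            end in
          if box_eqb b c then
            match lift (p - en) p s with
            | Some s' =>
                match nth_error (snd s') en with
                | Some (o, _) =>
                    if Nat.eqb o (n + m)
                    then extend fuel o0 l' st (S en) n (S en) s' ++ skip
                    else skip
                | None => skip
                end
            | None => skip
            end
          else skip
      end
  end.

Definition matches (l : diagram) (s : state) : list (nat * nat * state) :=
  match l with
  | nil => []
  | (m, b) :: l' =>
      flat_map (fun i =>
        match nth_error (snd s) i with
        | Some (n, c) =>
            if box_eqb b c then
              if m <=? n then extend (2 * length (snd s)) m l' i (S i) (n - m) (S i) s
              else []
            else []
        | None => []
        end) (seq 0 (length (snd s)))
  end.

Variables (rules : list rule) (w : word).

Definition rewrites (r : rule_id) (s : state) : list state :=
  flat_map (fun '(i, n, s') =>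
    match run_move gens rules w (snd s') (Rewrite i n r) with
    | Some d => [(Rewrite i n r :: fst s', d)]
    | None => []
    end) (matches (rlhs (rule_of gens rules r)) s).

(* Simplification: opposite crossings cancel, and each box is moved above or
   below the crossings, according to the mode and to its arity.  No orientation of
   the naturality rules is complete, whence several modes; the modes 4 and 5 also
   reverse the orientation of the Yang-Baxter equation. *)
Definition kinds := [BrRight; BiRight; BrLeft; BiLeft].

Definition slides (mode atoms : nat) (b : box) : list rule_id :=
  let forward :=
    match bdom gens b, bcod gens b with
    | nil, _ => false
    | _, nil => true
    | u, v =>
        match mode with
        | 0 | 4 => true
        | 1 | 5 => false
        | 2 => length u <=? length v
        | _ => length v <=? length u
        end
    end in
  flat_map (fun z => map (fun k => Slide forward k b z) kinds) (seq 0 atoms).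

Definition braid_slides (mode atoms : nat) (b : box) : list rule_id :=
  let f := mode <=? 3 in
  flat_map (fun z => [Slide f BrRight b z; Slide f BiRight b z;
                      Slide (negb f) BrLeft b z; Slide (negb f) BiLeft b z]) (seq 0 atoms).

Definition pairs (atoms : nat) : list (nat * nat) :=
  flat_map (fun x => map (pair x) (seq 0 atoms)) (seq 0 atoms).

Definition structural (mode atoms : nat) : list rule_id :=
  flat_map (fun '(x, y) => [Cancel true x y; Cancel false x y]) (pairs atoms) ++
  flat_map (fun i => slides mode atoms (Bx i)) (seq 0 (length gens)) ++
  flat_map (fun '(x, y) =>
    braid_slides mode atoms (Br x y) ++ braid_slides mode atoms (Bi x y)) (pairs atoms).

Fixpoint first_rewrite (rs : list rule_id) (s : state) : option state :=
  match rs with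
  | nil => None
  | r :: rs => match rewrites r s with
               | s' :: _ => Some s' | nil => first_rewrite rs s end
  end.

Variable atoms : nat.

Fixpoint simplify (fuel : nat) (rs : list rule_id) (s : state) : state :=
  let s := planar 10 s in
  match fuel with
  | O => s
  | S fuel => match first_rewrite rs s with
              | Some s' => simplify fuel rs s' | None => s end
  end.

(* Diagrams are stored under the positive numbers that encode them. *)
Fixpoint ones (n : nat) (p : positive) : positive :=
  match n with O => xO p | S n => ones n (xI p) end.

Definition code_box (b : box) (p : positive) : positive :=
  match b with
  | Bx i => xO (ones i p)
  | Br x y => xI (xO (ones x (ones y p)))
  | Bi x y => xI (xI (ones x (ones y p)))
  end.

Definition code (d : diagram) : positive :=
  fold_right (fun s p => ones (fst s) (code_box (snd s) p)) xH d.

Definition table := PositiveMap.t (list move).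

Fixpoint expand (structs : list (list rule_id)) (struct user : list rule_id)
  (todo : list state) (seen : table) (new : list state) : table * list state :=
  match todo with
  | nil => (seen, new)
  | s :: todo =>
      let next := flat_map (fun st =>
        let s := simplify 200 st s in s :: flat_map (fun r => rewrites r s) user) structs in
      let next := map (simplify 200 struct) next in
      let '(seen, new) := fold_left (fun '(t, l) (s' : state) =>
        let c := code (snd s') in
        match PositiveMap.find c t with
        | Some _ => (t, l)
        | None => (PositiveMap.add c (fst s') t, s' :: l)
        end) next (seen, new) in
      expand structs struct user todo seen new
  end.

Fixpoint meet (l : list state) (t : table) : option (list move * list move) :=
  match l with
  | nil => None
  | s :: l => match PositiveMap.find (code (snd s)) t with
              | Some log => Some (rev (fst s), rev log)
              | None => meet l t
              end
  end.

(* [n] and [n'] count the diagrams expanded on either side *)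
Fixpoint search (depth : nat) (structs : list (list rule_id)) (struct user : list rule_id)
  (t t' : table) (f f' : list state) (n n' : nat) : option (list move * list move) :=
  match depth with
  | O => None
  | S depth =>
      let left :=
        match f, f' with
        | nil, _ => false | _, nil => true
        | _, _ => n + length f <=? n' + length f'
        end in
      if left then
        let n := n + length f in
        let '(t, f) := expand structs struct user f t [] in
        match meet f t' with
        | Some r => Some r
        | None => search depth structs struct user t t' f f' n n'
        end
      else
        let n' := n' + length f' in
        let '(t', f') := expand structs struct user f' t' [] in
        match meet f' t with
        | Some (a, b) => Some (b, a)
        | None => search depth structs struct user t t' f f' n n'
        end
  end.

Definition singleton (s : state) : table :=
  PositiveMap.add (code (snd s)) (fst s) (PositiveMap.empty _).

Definition start (structs : list (list rule_id)) (struct user : list rule_id) (depth : nat)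
  (d d' : diagram) :=
  let s := simplify 200 struct ([], d) in
  let s' := simplify 200 struct ([], d') in
  match meet [s] (singleton s') with
  | Some r => Some r
  | None => search depth structs struct user (singleton s) (singleton s') [s] [s'] 0 0
  end.

End Search.

Definition normal_moves C (gens : list (gen C)) mode atoms (m : mexp) : list move :=
  match flatten gens m with
  | Some (u, d, _) =>
      rev (fst (simplify gens [] u 200 (structural gens mode atoms) ([], d)))
  | None => []
  end.

Definition equation := (mexp * mexp * (list move * list move))%type.

Definition variants C (gens : list (gen C)) (modes : list nat) atoms (m m' : mexp)
  : list equation :=
  fold_left (fun acc mode =>
    let e := (m, m', (normal_moves gens mode atoms m, normal_moves gens mode atoms m')) in
    let key e := flat_map (fun r => [code (rlhs r)]) (rules_of gens e) in
    if existsb (fun e' => if list_eq_dec Pos.eq_dec (key e) (key e') then true else false)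
         acc
    then acc else acc ++ [e]) modes [].

Definition find_moves C (gens : list (gen C)) modes atoms depth
  (es : list equation) (e : mexp * mexp) (simps : nat) :=
  match flatten gens (fst e), flatten gens (snd e) with
  | Some (u, d, v), Some (_, d', _) =>
     let rules := flat_map (rules_of gens) es in
     let user := map User (seq 0 (length rules)) in
     let simp := map (fun i => User (2 * i)) (seq 0 simps) in
     let structs := map (fun m => simp ++ structural gens m atoms) modes in
     start gens rules u structs (hd [] structs) (skipn (2 * simps) user) depth d d'
  | _, _ => None
  end.

(** ** The tactic *)

(** The typings of the atomic arrows and objects are found by instance resolution,
    from the hypotheses of the context and from the laws of Hopf algebras and of
    Yetter-Drinfel'd modules. *)
Class is_hom (C : catData) (X Y : ob C) (f : mor C) : Prop := homP : hom C X Y f.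
Class is_obj (C : catData) (X : ob C) : Prop := objP : isob C X.
Global Hint Mode is_hom + - - + : typeclass_instances.
Global Hint Mode is_obj + + : typeclass_instances.

Existing Class is_braided_category.
Existing Class is_hopf.
Existing Class is_yd.
Global Hint Mode is_hopf + + : typeclass_instances.
Global Hint Mode is_yd + - + : typeclass_instances.

Global Hint Extern 0 (is_hom _ _ ?f) =>
  (match goal with H : hom _ _ _ f |- _ => exact H end) : typeclass_instances.
Global Hint Extern 1 (is_hom _ _ ?f) =>
  (match goal with H : is_yd_morphism _ _ _ f |- _ => exact (yd_morphism_hom H) end)
  : typeclass_instances.
Global Hint Extern 0 (is_obj ?X) =>
  (match goal with H : isob _ X |- _ => exact H end) : typeclass_instances.

Section Typing.
Variable C : catData.
Local Notation "X ⊗ Y" := (tens C X Y) : ob_scope.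
Global Instance hom_hmul (A : hopfData C) : is_hopf A ->
  is_hom (C := C) (hcar A ⊗ hcar A) (hcar A) (hmul A) | 5.
Proof. intros h; apply h. Qed.
Global Instance hom_hone (A : hopfData C) : is_hopf A ->
  is_hom (C := C) (unit1 C) (hcar A) (hone A) | 5.
Proof. intros h; apply h. Qed.
Global Instance hom_hcomul (A : hopfData C) : is_hopf A ->
  is_hom (C := C) (hcar A) (hcar A ⊗ hcar A) (hcomul A) | 5.
Proof. intros h; apply h. Qed.
Global Instance hom_hcounit (A : hopfData C) : is_hopf A ->
  is_hom (C := C) (hcar A) (unit1 C) (hcounit A) | 5.
Proof. intros h; apply h. Qed.
Global Instance hom_hanti (A : hopfData C) : is_hopf A ->
  is_hom (C := C) (hcar A) (hcar A) (hanti A) | 5.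
Proof. intros h; apply (inv_spec (hopf_anti_iso h)). Qed.
Global Instance hom_hanti_inv (A : hopfData C) :
  is_hopf A -> is_hom (C := C) (hcar A) (hcar A) (inv (hcar A) (hcar A) (hanti A)) | 5.
Proof. intros h; apply (inv_spec (hopf_anti_iso h)). Qed.
Global Instance obj_hcar (A : hopfData C) : is_hopf A -> is_obj (hcar A).
Proof. intros h; apply h. Qed.
Global Instance hom_yact A X : is_yd A X -> is_hom (C := C) (hcar A ⊗ ycar X) (ycar X) (yact X) | 5.
Proof. intros h; apply h. Qed.
Global Instance hom_ycoact A X : is_yd A X ->
  is_hom (C := C) (ycar X) (hcar A ⊗ ycar X) (ycoact X) | 5.
Proof. intros h; apply h. Qed.
Global Instance obj_ycar A X : is_yd A X -> is_obj (C := C) (ycar X).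
Proof. intros h; apply (yd_ob h). Qed.

Variable A : hopfData C.
Implicit Types K : hopfData (YD A).
Global Instance yd_hcar K : is_hopf (C := YD A) K -> is_yd A (hcar K).
Proof. intros h; apply (hopf_ob h). Qed.
Global Instance yd_hom_hmul K :
  is_hopf (C := YD A) K -> is_hom (C := C) (ycar (hcar K)
    ⊗ ycar (hcar K)) (ycar (hcar K)) (hmul K) | 6.
Proof. intros h; apply (hopf_mul_hom h). Qed.
Global Instance yd_hom_hone K :
  is_hopf (C := YD A) K -> is_hom (C := C) (unit1 C) (ycar (hcar K)) (hone K) | 6.
Proof. intros h; apply (hopf_one_hom h). Qed.
Global Instance yd_hom_hcomul K :
  is_hopf (C := YD A) K -> is_hom (C := C) (ycar (hcar K)) (ycar (hcar K)
    ⊗ ycar (hcar K)) (hcomul K) | 6.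
Proof. intros h; apply (hopf_comul_hom h). Qed.
Global Instance yd_hom_hcounit K :
  is_hopf (C := YD A) K -> is_hom (C := C) (ycar (hcar K)) (unit1 C) (hcounit K) | 6.
Proof. intros h; apply (hopf_counit_hom h). Qed.
Global Instance yd_hom_hanti K :
  is_hopf (C := YD A) K -> is_hom (C := C) (ycar (hcar K)) (ycar (hcar K)) (hanti K) | 6.
Proof. intros h; apply (inv_spec (hopf_anti_iso h)). Qed.
End Typing.

Ltac member x l :=
  lazymatch l with
  | nil => constr:(false)
  | cons ?y ?t =>
      match goal with
      | _ => let _ := match goal with _ => constr_eq x y end in constr:(true)
      | _ => member x t
      end
  end.

Ltac insert T x l :=
  let b := member x l in
  lazymatch b with true => l | false => constr:(@cons T x l) end.

Ltac index x l :=
  lazymatch l with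
  | cons ?y ?t =>
      match goal with
      | _ => let _ := match goal with _ => constr_eq x y end in constr:(O)
      | _ => let n := index x t in constr:(S n)
      end
  end.

Ltac objs_of C o l :=
  lazymatch o with
  | tens C ?a ?b => let l := objs_of C a l in objs_of C b l
  | unit1 C => l
  | _ => insert (ob C) o l
  end.

Ltac objs_of_arrow C t l :=
  lazymatch t with
  | comp C ?g ?f => let l := objs_of_arrow C f l in objs_of_arrow C g l
  | tensm C ?g ?f => let l := objs_of_arrow C f l in objs_of_arrow C g l
  | idm C ?a => objs_of C a l
  | braid C ?a ?b => let l := objs_of C a l in objs_of C b l
  | @inv C _ _ (braid C ?a ?b) => let l := objs_of C a l in objs_of C b l
  | _ => l
  end.

Ltac atoms_of C t l :=
  lazymatch t with
  | comp C ?g ?f => let l := atoms_of C f l in atoms_of C g l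
  | tensm C ?g ?f => let l := atoms_of C f l in atoms_of C g l
  | idm C _ => l
  | braid C _ _ => l
  | @inv C _ _ (braid C _ _) => l
  | _ => insert (mor C) t l
  end.

Ltac simpl_cat t :=
  eval cbn [YD comp tensm idm tens unit1 braid hom isob ob mor
            yd_tens yd_unit ycar yact ycoact] in t.

Ltac typings C fs :=
  lazymatch fs with
  | nil => constr:(tt)
  | cons ?f ?fs =>
      let h := constr:(homP (C := C) (f := f)) in
      let T := type of h in
      let T := simpl_cat T in
      let h := constr:(h : T) in
      let r := typings C fs in
      constr:((h, r))
  end.

Ltac objs_of_typings C ts l :=
  lazymatch ts with
  | tt => l
  | (?h, ?ts) =>
      lazymatch type of h with
      | hom _ ?X ?Y _ =>
          let l := objs_of C X l in let l := objs_of C Y l in objs_of_typings C ts l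
      end
  end.

Ltac reify_ob C objs o :=
  lazymatch o with
  | tens C ?a ?b =>
      let a := reify_ob C objs a in let b := reify_ob C objs b in constr:(OTens a b)
  | unit1 C => constr:(OUnit)
  | _ => let i := index o objs in constr:(OAtom i)
  end.

Ltac reify_arrow C objs fs t :=
  lazymatch t with
  | comp C ?g ?f =>
      let g := reify_arrow C objs fs g in
      let f := reify_arrow C objs fs f in constr:(MComp g f)
  | tensm C ?g ?f =>
      let g := reify_arrow C objs fs g in
      let f := reify_arrow C objs fs f in constr:(MTens g f)
  | idm C ?a => let a := reify_ob C objs a in constr:(MId a)
  | braid C ?a ?b =>
      let a := reify_ob C objs a in let b := reify_ob C objs b in constr:(MBraid a b)
  | @inv C _ _ (braid C ?a ?b) =>
      let a := reify_ob C objs a in let b := reify_ob C objs b in constr:(MCinv a b)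
  | _ => let i := index t fs in constr:(MGen i)
  end.

Ltac objs_proof C objs :=
  lazymatch objs with
  | nil => constr:(Forall_nil (isob C))
  | cons ?o ?l =>
      let p := objs_proof C l in
      let h := constr:(objP (C := C) (X := o)) in
      constr:(@Forall_cons _ (isob C) o l h p)
  end.

Ltac gens_proof C hC objs objs_ok P ts :=
  lazymatch ts with
  | tt => constr:(Forall_nil P)
  | (?h, ?ts) =>
      let p := gens_proof C hC objs objs_ok P ts in
      lazymatch type of h with
      | hom _ ?X ?Y ?f =>
          let a := reify_ob C objs X in
          let b := reify_ob C objs Y in
          lazymatch type of p with
          | Forall _ ?l =>
              constr:(@Forall_cons _ P (@Gen C (oflat a) (oflat b) f) l
                (gen_ok (C := C) hC objs_ok (a := a) (b := b) (f := f) h) p)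
          end
      end
  end.

Ltac cat_of t :=
  lazymatch t with
  | comp ?C _ _ => C | tensm ?C _ _ => C | idm ?C _ => C | braid ?C _ _ => C
  | @inv ?C _ _ _ => C
  end.

Ltac fold_rules tac es acc :=
  lazymatch es with
  | tt => acc
  | (?a, ?b) => let acc := fold_rules tac a acc in fold_rules tac b acc
  | ?e =>
      let T := type of e in
      let T := simpl_cat T in
      lazymatch T with
      | ?l = ?r => tac e l r acc
      | _ => fail 100 "not an equation:" T
      end
  end.

Ltac add_variants eqn vs e acc :=
  lazymatch vs with
  | nil => acc
  | cons ?v ?vs =>
      lazymatch type of acc with
      | Forall _ ?l =>
          let acc := constr:(@Forall_cons _ eqn v l e acc) in add_variants eqn vs e acc
      end
  end.

Ltac diag_core depth modes ss us :=
  lazymatch goal with |- ?G => let G' := simpl_cat G in change G' end;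
  lazymatch goal with
  | |- @eq _ ?l ?r =>
      let C := match goal with _ => cat_of l | _ => cat_of r end in
      let hC := constr:(_ : is_braided_category C) in
      let es := constr:((us, ss)) in
      let fs := atoms_of C l (@nil (mor C)) in
      let fs := atoms_of C r fs in
      let fs := fold_rules ltac:(fun e l r fs =>
                  let fs := atoms_of C l fs in atoms_of C r fs) es fs in
      let fs := eval cbv [rev app] in (rev fs) in
      let ts := typings C fs in
      let os := objs_of_typings C ts (@nil (ob C)) in
      let os := objs_of_arrow C l os in
      let os := objs_of_arrow C r os in
      let os := fold_rules ltac:(fun e l r os =>
                  let os := objs_of_arrow C l os in objs_of_arrow C r os) es os in
      let objs_ok := objs_proof C os in
      let P := constr:(fun g => hom C (ev os (gdom g)) (ev os (gcod g)) (garr g)) in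
      let gens_ok := gens_proof C hC os objs_ok P ts in
      let gens := lazymatch type of gens_ok with Forall _ ?l => l end in
      let l' := reify_arrow C os fs l in
      let r' := reify_arrow C os fs r in
      let n := eval compute in (length os) in
      let eqn := constr:(fun e : equation => equation_holds os gens (fst e)) in
      let add modes es acc :=
        fold_rules ltac:(fun e l r acc =>
          let l := reify_arrow C os fs l in
          let r := reify_arrow C os fs r in
          let vs := eval vm_compute in (variants gens modes n l r) in
          add_variants eqn vs e acc) es acc in
      (* the equations in [ss] come first, in the list that is built backwards *)
      let rules := add modes us constr:(Forall_nil eqn) in
      let n_us := lazymatch type of rules with Forall _ ?l => eval compute in (length l) end in
      let rules := add constr:(0 :: nil) ss rules in
      let k := lazymatch type of rules with
               Forall _ ?l => eval compute in (length l - n_us) end in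
      let es' := lazymatch type of rules with Forall _ ?l => l end in
      let res := eval vm_compute in (find_moves gens modes n depth es' (l', r') k) in
      lazymatch res with
      | Some (?a, ?b) =>
          refine (check_sound hC objs_ok gens_ok (es := es') (e := (l', r')) (s := a)
                    (s' := b) rules _);
          vm_cast_no_check (@eq_refl bool true)
      | None => fail "no derivation found"
      end
  end.

(** [diag] proves an equation between arrows that holds in every braided category,
    and [diag with (e1, .., en)] one that follows from the equations [ei] as well.
    With [all], two more strategies are tried; with [simp], the equations that come
    first are used as simplification rules, from left to right only. *)
Tactic Notation "diag" :=
  diag_core constr:(0) constr:(0 :: nil) constr:(tt) constr:(tt).
Tactic Notation "diag" "with" constr(us) :=
  diag_core constr:(20) constr:(0 :: 1 :: 2 :: 3 :: nil) constr:(tt) us.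
Tactic Notation "diag" "all" "with" constr(us) :=
  diag_core constr:(20) constr:(0 :: 1 :: 2 :: 3 :: 4 :: 5 :: nil) constr:(tt) us.
Tactic Notation "diag" "simp" constr(ss) "with" constr(us) :=
  diag_core constr:(20) constr:(0 :: 1 :: 2 :: 3 :: nil) ss us.

Global Hint Extern 2 (is_obj ?X) =>
  (match goal with
   | H : hom _ X _ _ |- _ => exact (proj1 (hom_ob _ H))
   | H : hom _ _ X _ |- _ => exact (proj2 (hom_ob _ H))
   end) : typeclass_instances.

Ltac typed :=
  lazymatch goal with
  | |- is_hom _ _ _ => unfold is_hom | |- is_obj _ => unfold is_obj | _ => idtac end;
  lazymatch goal with |- ?G => let G' := simpl_cat G in change G' end;
  lazymatch goal with
  | |- hom ?C ?X ?Y ?t =>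
      let hC := constr:(_ : is_braided_category C) in
      let fs := atoms_of C t (@nil (mor C)) in
      let ts := typings C fs in
      let os := objs_of_typings C ts (@nil (ob C)) in
      let os := objs_of_arrow C t os in
      let os := objs_of C X os in
      let os := objs_of C Y os in
      let objs_ok := objs_proof C os in
      let P := constr:(fun g => hom C (ev os (gdom g)) (ev os (gcod g)) (garr g)) in
      let gens_ok := gens_proof C hC os objs_ok P ts in
      let gens := lazymatch type of gens_ok with Forall _ ?l => l end in
      let m := reify_arrow C os fs t in
      let x := reify_ob C os X in
      let y := reify_ob C os Y in
      let r := eval vm_compute in (flatten gens m) in
      lazymatch r with
      | Some (?u, ?d, ?v) =>
          refine (arrow_hom hC objs_ok gens_ok (m := m) (a := x) (b := y)
                    (u := u) (d := d) (v := v) _ _ _);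
          [vm_cast_no_check (@eq_refl _ (Some (u, d, v))) | vm_cast_no_check (@eq_refl _ u)
          | vm_cast_no_check (@eq_refl _ v)]
      | None => fail "ill-typed"
      end
  | |- isob ?C ?X =>
      lazymatch X with
      | tens C ?a ?b =>
          let hC := constr:(_ : is_braided_category C) in
          apply (tens_ob hC); typed
      | unit1 C => let hC := constr:(_ : is_braided_category C) in exact (unit_ob hC)
      | _ => exact (objP (C := C) (X := X))
      end
  end.

(** ** Notations *)
Local Notation "X ⊗ Y" := (tens _ X Y) : ob_scope.
Local Notation "f ⊗ g" := (tensm _ f g) : mor_scope.
Local Notation "g ∘ f" := (comp _ g f) : mor_scope.
Local Notation "𝟏" := (unit1 _) : ob_scope.
Local Notation id := (idm _).
Local Notation c := (braid _).
Local Notation cinv X Y := (inv (tens _ X Y) (tens _ Y X) (braid _ X Y)).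
Local Open Scope mor_scope.

(** * Hopf algebras *)
Section Convolution.

Variable C : catData.
Hypothesis hC : is_braided_category C.

Lemma iso_mono X Y f Z g g' : is_iso (C := C) X Y f -> hom C Z X g -> hom C Z X g' ->
  f ∘ g = f ∘ g' -> g = g'.
Proof.
  intros [k (h1 & h2 & h3 & h4)] hg hg' e.
  rewrite <- (id_comp hC hg), <- (id_comp hC hg'), <- h3.
  rewrite <- (comp_assoc hC hg h1 h2), <- (comp_assoc hC hg' h1 h2), e; auto.
Qed.

Lemma iso_epi X Y f Z g g' : is_iso (C := C) X Y f -> hom C Y Z g -> hom C Y Z g' ->
  g ∘ f = g' ∘ f -> g = g'.
Proof.
  intros [k (h1 & h2 & h3 & h4)] hg hg' e.
  rewrite <- (comp_id hC hg), <- (comp_id hC hg'), <- h4.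
  rewrite (comp_assoc hC h2 h1 hg), (comp_assoc hC h2 h1 hg'), e; auto.
Qed.

Variables (X Y : ob C) (comul counit mul one : mor C).
Hypothesis comul_hom : hom C X (X ⊗ X) comul.
Hypothesis counit_hom : hom C X 𝟏 counit.
Hypothesis mul_hom : hom C (Y ⊗ Y) Y mul.
Hypothesis one_hom : hom C 𝟏 Y one.
Hypothesis comul_assoc : (comul ⊗ id X) ∘ comul = (id X ⊗ comul) ∘ comul.
Hypothesis counit_comul : (counit ⊗ id X) ∘ comul = id X.
Hypothesis comul_counit : (id X ⊗ counit) ∘ comul = id X.
Hypothesis mul_assoc : mul ∘ (mul ⊗ id Y) = mul ∘ (id Y ⊗ mul).
Hypothesis one_mul : mul ∘ (one ⊗ id Y) = id Y.
Hypothesis mul_one : mul ∘ (id Y ⊗ one) = id Y.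

(** Antipodes are handled through convolution inverses: [f * g * h] is [h] when
    [f * g] is the unit, and [f] when [g * h] is. *)
Lemma convolution_inverse_unique f g h :
  hom C X Y f -> hom C X Y g -> hom C X Y h ->
  mul ∘ (f ⊗ g) ∘ comul = one ∘ counit -> mul ∘ (g ⊗ h) ∘ comul = one ∘ counit ->
  f = h.
Proof.
  intros hf hg hh e1 e2.
  transitivity (mul ∘ (f ⊗ (mul ∘ (g ⊗ h) ∘ comul)) ∘ comul).
  - rewrite e2, <- (comp_id hC hf) at 1; rewrite <- comul_counit.
    diag with mul_one.
  - transitivity (mul ∘ ((mul ∘ (f ⊗ g) ∘ comul) ⊗ h) ∘ comul).
    + diag with (mul_assoc, comul_assoc).
    + rewrite e1; transitivity (h ∘ id X).
      * diag with (one_mul, counit_comul).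
      * apply (comp_id hC hh).
Qed.

Lemma convolution_inverse_product p p' q q' :
  hom C X Y p -> hom C X Y p' -> hom C X Y q -> hom C X Y q' ->
  mul ∘ (p' ⊗ p) ∘ comul = one ∘ counit -> mul ∘ (q' ⊗ q) ∘ comul = one ∘ counit ->
  mul ∘ ((mul ∘ (q' ⊗ p') ∘ comul) ⊗ (mul ∘ (p ⊗ q) ∘ comul)) ∘ comul = one ∘ counit.
Proof.
  intros hp hp' hq hq' e1 e2.
  transitivity (mul ∘ (mul ⊗ id Y) ∘
    (q' ⊗ (mul ∘ (p' ⊗ p) ∘ comul) ⊗ q) ∘ (comul ⊗ id X) ∘ comul).
  - diag with (mul_assoc, comul_assoc).
  - rewrite e1; diag with (mul_one, counit_comul, comul_counit, e2).
Qed.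

End Convolution.

Section Products.

Variable C : catData.
Hypothesis hC : is_braided_category C.

Lemma tens_mul_assoc X (mul : mor C) : hom C (X ⊗ X) X mul ->
  mul ∘ (mul ⊗ id X) = mul ∘ (id X ⊗ mul) ->
  let mul2 := (mul ⊗ mul) ∘ (id X ⊗ c X X ⊗ id X) in
  mul2 ∘ (mul2 ⊗ id (X ⊗ X)) = mul2 ∘ (id (X ⊗ X) ⊗ mul2).
Proof. intros h e; cbv zeta; diag with e. Qed.

End Products.

Section HopfAlgebra.

Variable C : catData.
Hypothesis hC : is_braided_category C.
Variable A : hopfData C.
Hypothesis hA : is_hopf A.
Local Notation a := (hcar A).
Local Notation mul := (hmul A).
Local Notation one := (hone A).
Local Notation comul := (hcomul A).
Local Notation counit := (hcounit A).
Local Notation S := (hanti A).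
Local Notation Si := (inv a a S).

Lemma anti_one : S ∘ one = one.
Proof.
  transitivity (mul ∘ (S ⊗ id a) ∘ comul ∘ one).
  - diag with (hopf_comul_one hA, hopf_mul_one hA).
  - diag with (hopf_anti_l hA, hopf_counit_one hA).
Qed.

Lemma counit_anti : counit ∘ S = counit.
Proof.
  transitivity (counit ∘ mul ∘ (S ⊗ id a) ∘ comul).
  - diag with (hopf_counit_mul hA, hopf_comul_counit hA).
  - diag with (hopf_anti_l hA, hopf_counit_one hA).
Qed.

Lemma tens_coalgebra :
  let D := (id a ⊗ c a a ⊗ id a) ∘ (comul ⊗ comul) in
  (D ⊗ id (a ⊗ a)) ∘ D = (id (a ⊗ a) ⊗ D) ∘ D /\
  ((counit ⊗ counit) ⊗ id (a ⊗ a)) ∘ D = id (a ⊗ a) /\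
  (id (a ⊗ a) ⊗ (counit ⊗ counit)) ∘ D = id (a ⊗ a).
Proof.
  cbv zeta; repeat split.
  - diag with (hopf_comul_assoc hA).
  - diag with (hopf_counit_comul hA).
  - diag with (hopf_comul_counit hA).
Qed.

(** Both sides are convolution inverses of the product, for the coalgebra [a ⊗ a]. *)
Lemma anti_mul : S ∘ mul = mul ∘ (S ⊗ S) ∘ c a a.
Proof.
  destruct tens_coalgebra as (h1 & h2 & h3).
  refine (convolution_inverse_unique hC (X := (a ⊗ a)%ob) (Y := a) (g := mul) (mul := mul)
    (one := one) (comul := (id a ⊗ c a a ⊗ id a) ∘ (comul ⊗ comul))
    (counit := counit ⊗ counit) _ _ _ _ h1 h2 h3 _ _ _ _ _ _ _ _).
  all: try apply hA.
  all: try typed.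
  - diag with (hopf_comul_mul hA, hopf_anti_l hA, hopf_counit_mul hA).
  - diag with (hopf_mul_assoc hA, hopf_anti_r hA, hopf_mul_one hA, hopf_one_mul hA).
Qed.

(** Both sides are convolution inverses of the coproduct, for the algebra [a ⊗ a]. *)
Lemma anti_comul : comul ∘ S = c a a ∘ (S ⊗ S) ∘ comul.
Proof.
  refine (convolution_inverse_unique hC (X := a) (Y := (a ⊗ a)%ob) (g := comul)
    (mul := (mul ⊗ mul) ∘ (id a ⊗ c a a ⊗ id a))
    (one := one ⊗ one) (comul := comul) (counit := counit) _ _ _ _ _ _ _ _ _ _ _ _ _ _ _).
  all: try apply hA.
  all: try typed.
  - diag with (hopf_mul_assoc hA).
  - diag with (hopf_one_mul hA).
  - diag with (hopf_mul_one hA).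
  - diag with (hopf_comul_mul hA, hopf_anti_l hA, hopf_comul_one hA).
  - diag with (hopf_comul_assoc hA, hopf_anti_r hA, hopf_comul_counit hA, hopf_counit_comul hA).
Qed.

(** The inverse of the antipode is an antipode for the coproduct composed with the
    inverse braiding; it enters the inverses of the braidings of Yetter-Drinfel'd
    modules. *)
Lemma skew_anti_l : mul ∘ (Si ⊗ id a) ∘ cinv a a ∘ comul = one ∘ counit.
Proof.
  destruct (inv_spec (hopf_anti_iso hA)) as (h1 & h2 & h3 & h4).
  apply (iso_mono hC (hopf_anti_iso hA) (Z := a)); try typed.
  diag with (anti_mul, anti_one, h4, hopf_anti_l hA).
Qed.

Lemma skew_anti_r : mul ∘ (id a ⊗ Si) ∘ cinv a a ∘ comul = one ∘ counit.
Proof.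
  destruct (inv_spec (hopf_anti_iso hA)) as (h1 & h2 & h3 & h4).
  apply (iso_mono hC (hopf_anti_iso hA) (Z := a)); try typed.
  diag with (anti_mul, anti_one, h4, hopf_anti_r hA).
Qed.

Lemma anti_inv_mul : Si ∘ mul = mul ∘ cinv a a ∘ (Si ⊗ Si).
Proof.
  destruct (inv_spec (hopf_anti_iso hA)) as (h1 & h2 & h3 & h4).
  apply (iso_mono hC (hopf_anti_iso hA) (Z := (a ⊗ a)%ob)); try typed.
  diag with (anti_mul, h4).
Qed.

Lemma comul_anti_inv : comul ∘ Si = cinv a a ∘ (Si ⊗ Si) ∘ comul.
Proof.
  destruct (inv_spec (hopf_anti_iso hA)) as (h1 & h2 & h3 & h4).
  apply (iso_epi hC (hopf_anti_iso hA) (Z := (a ⊗ a)%ob)); try typed.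
  diag with (anti_comul, h3).
Qed.

End HopfAlgebra.

Section HopfMorphism.

Variable C : catData.
Hypothesis hC : is_braided_category C.

Variables (A B : hopfData C) (f : mor C).
Hypothesis hA : is_hopf A.
Hypothesis hB : is_hopf B.
Hypothesis hf : is_hopf_morphism A B f.
Let f_hom : hom C (hcar A) (hcar B) f := hopf_morphism_hom hf.

Lemma hopf_morphism_anti : f ∘ hanti A = hanti B ∘ f.
Proof.
  apply (convolution_inverse_unique hC (hopf_comul_hom hA) (hopf_counit_hom hA)
    (hopf_mul_hom hB) (hopf_one_hom hB) (hopf_comul_assoc hA) (hopf_counit_comul hA)
    (hopf_comul_counit hA) (hopf_mul_assoc hB) (hopf_one_mul hB) (hopf_mul_one hB)
    (g := f)); try typed.
  - transitivity (f ∘ (hmul A ∘ (hanti A ⊗ id (hcar A)) ∘ hcomul A)).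
    + diag with (hopf_morphism_mul hf).
    + rewrite (hopf_anti_l hA); diag with (hopf_morphism_one hf).
  - transitivity ((hmul B ∘ (id (hcar B) ⊗ hanti B) ∘ hcomul B) ∘ f).
    + diag with (hopf_morphism_comul hf).
    + rewrite (hopf_anti_r hB); diag with (hopf_morphism_counit hf).
Qed.

Lemma hopf_morphism_anti_inv :
  f ∘ inv (hcar A) (hcar A) (hanti A) = inv (hcar B) (hcar B) (hanti B) ∘ f.
Proof.
  destruct (inv_spec (hopf_anti_iso hA)) as (h1 & h2 & h3 & h4).
  destruct (inv_spec (hopf_anti_iso hB)) as (k1 & k2 & k3 & k4).
  apply (iso_mono hC (hopf_anti_iso hB) (Z := hcar A)); try typed.
  diag with (hopf_morphism_anti, h4, k4).
Qed.

End HopfMorphism.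

(** * Yetter-Drinfel'd modules *)

Lemma ydData_eq (C : catData) (X Y : ydData C) :
  ycar X = ycar Y -> yact X = yact Y -> ycoact X = ycoact Y -> X = Y.
Proof. destruct X, Y; simpl; congruence. Qed.

Section Modules.

Variable C : catData.
Hypothesis hC : is_braided_category C.

Variable A : hopfData C.
Hypothesis hA : is_hopf A.
Local Notation a := (hcar A).
Local Notation mul := (hmul A).
Local Notation one := (hone A).
Local Notation comul := (hcomul A).
Local Notation counit := (hcounit A).
Local Notation S := (hanti A).
Local Notation Si := (inv a a S).
Local Notation YT := (yd_tens A).
Local Notation σ := (yd_braid A).

(** Modules and comodules are separated because many facts about braidings need
    only the action on one side and the coaction on the other, and because [Omega]
    exchanges the two notions. *)
Record is_module (X : ydData C) : Prop := {
  mod_ob : isob C (ycar X);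
  mod_hom : hom C (a ⊗ ycar X) (ycar X) (yact X);
  mod_mul : yact X ∘ (mul ⊗ id (ycar X)) = yact X ∘ (id a ⊗ yact X);
  mod_one : yact X ∘ (one ⊗ id (ycar X)) = id (ycar X)
}.

Record is_comodule (X : ydData C) : Prop := {
  comod_ob : isob C (ycar X);
  comod_hom : hom C (ycar X) (a ⊗ ycar X) (ycoact X);
  comod_comul : (comul ⊗ id (ycar X)) ∘ ycoact X = (id a ⊗ ycoact X) ∘ ycoact X;
  comod_counit : (counit ⊗ id (ycar X)) ∘ ycoact X = id (ycar X)
}.

Definition yd_condition (X : ydData C) : Prop :=
    (mul ⊗ yact X) ∘ (id a ⊗ c a a ⊗ id (ycar X)) ∘ (comul ⊗ ycoact X) =
    (mul ⊗ id (ycar X)) ∘ (id a ⊗ c (ycar X) a)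
      ∘ (ycoact X ⊗ id a) ∘ (yact X ⊗ id a)
      ∘ (id a ⊗ c a (ycar X)) ∘ (comul ⊗ id (ycar X)).

Definition linear (X Y : ydData C) (f : mor C) : Prop :=
  f ∘ yact X = yact Y ∘ (id a ⊗ f).
Definition colinear (X Y : ydData C) (f : mor C) : Prop :=
  ycoact Y ∘ f = (id a ⊗ f) ∘ ycoact X.

Lemma yd_module X : is_yd A X -> is_module X.
Proof. intros h; constructor; apply h. Qed.
Lemma yd_comodule X : is_yd A X -> is_comodule X.
Proof. intros h; constructor; apply h. Qed.
Lemma yd_intro X : is_module X -> is_comodule X -> yd_condition X -> is_yd A X.
Proof. intros h k e; constructor; first [apply h | apply k | apply e]. Qed.

Lemma hom_mod X : is_module X -> is_hom (C := C) (a ⊗ ycar X) (ycar X) (yact X).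
Proof. apply mod_hom. Qed.
Lemma hom_comod X : is_comodule X -> is_hom (C := C) (ycar X) (a ⊗ ycar X) (ycoact X).
Proof. apply comod_hom. Qed.
Lemma obj_mod X : is_module X -> is_obj (ycar X).
Proof. apply mod_ob. Qed.
Lemma obj_comod X : is_comodule X -> is_obj (ycar X).
Proof. apply comod_ob. Qed.

End Modules.

Existing Class is_module.
Existing Class is_comodule.
Global Hint Mode is_module + - + : typeclass_instances.
Global Hint Mode is_comodule + - + : typeclass_instances.
Global Existing Instances yd_module yd_comodule.
Global Existing Instances hom_mod hom_comod obj_mod obj_comod.

Section YetterDrinfeld.

Variable C : catData.
Hypothesis hC : is_braided_category C.

Variable A : hopfData C.
Hypothesis hA : is_hopf A.
Local Notation a := (hcar A).
Local Notation mul := (hmul A).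
Local Notation one := (hone A).
Local Notation comul := (hcomul A).
Local Notation counit := (hcounit A).
Local Notation S := (hanti A).
Local Notation Si := (inv a a S).
Local Notation YT := (yd_tens A).
Local Notation σ := (yd_braid A).

Lemma module_unit : is_module A (yd_unit A).
Proof.
  constructor; cbn [yd_unit ycar yact ycoact]; try typed.
  - diag with (hopf_counit_mul hA).
  - diag with (hopf_counit_one hA).
Qed.

Lemma comodule_unit : is_comodule A (yd_unit A).
Proof.
  constructor; cbn [yd_unit ycar yact ycoact]; try typed.
  - diag with (hopf_comul_one hA).
  - diag with (hopf_counit_one hA).
Qed.

Lemma yd_unit_yd : is_yd A (yd_unit A).
Proof.
  apply (yd_intro module_unit comodule_unit).
  unfold yd_condition; cbn [yd_unit ycar yact ycoact].
  diag with (hopf_counit_comul hA, hopf_comul_counit hA, hopf_one_mul hA, hopf_mul_one hA).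
Qed.

Lemma module_tens X Y : is_module A X -> is_module A Y -> is_module A (YT X Y).
Proof.
  intros hX hY; constructor; cbn [yd_tens ycar yact ycoact]; try typed.
  - diag with (hopf_comul_mul hA, mod_mul hX, mod_mul hY).
  - diag with (hopf_comul_one hA, mod_one hX, mod_one hY).
Qed.

Lemma comodule_tens X Y : is_comodule A X -> is_comodule A Y -> is_comodule A (YT X Y).
Proof.
  intros hX hY; constructor; cbn [yd_tens ycar yact ycoact]; try typed.
  - diag with (hopf_comul_mul hA, comod_comul hX, comod_comul hY).
  - diag with (hopf_counit_mul hA, comod_counit hX, comod_counit hY).
Qed.

Lemma yd_tens_yd X Y : is_yd A X -> is_yd A Y -> is_yd A (YT X Y).
Proof.
  intros hX hY; apply yd_intro;
    auto using module_tens, comodule_tens, yd_module, yd_comodule.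
  unfold yd_condition; cbn [yd_tens ycar yact ycoact].
  diag with (hopf_comul_assoc hA, hopf_mul_assoc hA, yd_compat hX, yd_compat hY).
Qed.

Definition regular : ydData C := YDData a mul comul.

Lemma module_regular : is_module A regular.
Proof. constructor; apply hA. Qed.

Lemma comodule_regular : is_comodule A regular.
Proof. constructor; apply hA. Qed.

Lemma yd_braid_hom X Y : is_comodule A X -> is_module A Y ->
  hom C (ycar X ⊗ ycar Y) (ycar Y ⊗ ycar X) (σ X Y).
Proof. intros hX hY; unfold yd_braid; typed. Qed.

Definition yd_braid_inv (X Y : ydData C) : mor C :=
  cinv (ycar X) (ycar Y) ∘ (yact Y ⊗ id (ycar X)) ∘ (Si ⊗ id (ycar Y) ⊗ id (ycar X))
   ∘ (cinv a (ycar Y) ⊗ id (ycar X)) ∘ (id (ycar Y) ⊗ ycoact X).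

Lemma yd_braid_inverse X Y : is_comodule A X -> is_module A Y ->
  is_inverse (C := C) (ycar X ⊗ ycar Y) (ycar Y ⊗ ycar X) (σ X Y) (yd_braid_inv X Y).
Proof.
  intros hX hY; unfold yd_braid, yd_braid_inv; repeat split; try typed.
  - diag with (skew_anti_l hC hA, mod_mul hY, comod_comul hX, comod_counit hX, mod_one hY).
  - diag with (skew_anti_r hC hA, mod_mul hY, comod_comul hX, comod_counit hX, mod_one hY).
Qed.

(** Linearity uses the compatibility condition of the left factor, colinearity that
    of the right one; the converses are [linear_yd_condition] and
    [colinear_yd_condition]. *)
Lemma yd_braid_linear X Y : is_yd A X -> is_module A Y ->
  linear A (YT X Y) (YT Y X) (σ X Y).
Proof.
  intros hX hY; unfold linear, yd_braid; cbn [yd_tens ycar yact ycoact].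
  diag with (hopf_comul_assoc hA, mod_mul hY, yd_compat hX).
Qed.

Lemma yd_braid_colinear X Y : is_comodule A X -> is_yd A Y ->
  colinear A (YT X Y) (YT Y X) (σ X Y).
Proof.
  intros hX hY; unfold colinear, yd_braid; cbn [yd_tens ycar yact ycoact].
  diag with (hopf_mul_assoc hA, comod_comul hX, yd_compat hY).
Qed.

Lemma yd_braid_natural X X' Y Y' f g :
  is_comodule A X -> is_comodule A X' -> is_module A Y -> is_module A Y' ->
  hom C (ycar X) (ycar X') f -> hom C (ycar Y) (ycar Y') g ->
  colinear A X X' f -> linear A Y Y' g -> σ X' Y' ∘ (f ⊗ g) = (g ⊗ f) ∘ σ X Y.
Proof.
  unfold colinear, linear, yd_braid; intros hX hX' hY hY' hf hg ef eg.
  diag with (ef, eg).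
Qed.

Lemma yd_braid_tens_r X Y Z : is_comodule A X -> is_module A Y -> is_module A Z ->
  σ X (YT Y Z) = (id (ycar Y) ⊗ σ X Z) ∘ (σ X Y ⊗ id (ycar Z)).
Proof.
  intros hX hY hZ; unfold yd_braid; cbn [yd_tens ycar yact ycoact].
  diag with (comod_comul hX).
Qed.

Lemma yd_braid_tens_l X Y Z : is_comodule A X -> is_comodule A Y -> is_module A Z ->
  σ (YT X Y) Z = (σ X Z ⊗ id (ycar Y)) ∘ (id (ycar X) ⊗ σ Y Z).
Proof.
  intros hX hY hZ; unfold yd_braid; cbn [yd_tens ycar yact ycoact].
  diag with (mod_mul hZ).
Qed.

Lemma yd_tens_assoc X Y Z : is_yd A X -> is_yd A Y -> is_yd A Z ->
  YT X (YT Y Z) = YT (YT X Y) Z.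
Proof.
  intros hX hY hZ; apply ydData_eq; cbn [yd_tens ycar yact ycoact].
  - apply (tens_assoc hC); typed.
  - diag with (hopf_comul_assoc hA).
  - diag with (hopf_mul_assoc hA).
Qed.

Lemma yd_unit_tens X : is_yd A X -> YT (yd_unit A) X = X.
Proof.
  intros hX; apply ydData_eq; cbn [yd_tens yd_unit ycar yact ycoact].
  - apply (unit_tens hC); typed.
  - diag with (hopf_counit_comul hA).
  - diag with (hopf_one_mul hA).
Qed.

Lemma yd_tens_unit X : is_yd A X -> YT X (yd_unit A) = X.
Proof.
  intros hX; apply ydData_eq; cbn [yd_tens yd_unit ycar yact ycoact].
  - apply (tens_unit hC); typed.
  - diag with (hopf_comul_counit hA).
  - diag with (hopf_mul_one hA).
Qed.

Lemma yd_tensm X X' Y Y' f g : is_yd_morphism A X X' f -> is_yd_morphism A Y Y' g ->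
  is_yd_morphism A (YT X Y) (YT X' Y') (f ⊗ g).
Proof.
  intros [hX hX' hf ef ef'] [hY hY' hg eg eg'].
  constructor; auto using yd_tens_yd; cbn [yd_tens yd_unit ycar yact ycoact].
  - typed.
  - diag with (ef, eg).
  - diag with (ef', eg').
Qed.

Lemma yd_braid_morphism X Y : is_yd A X -> is_yd A Y ->
  is_yd_morphism A (YT X Y) (YT Y X) (σ X Y).
Proof.
  intros hX hY; constructor; auto using yd_tens_yd.
  - apply yd_braid_hom; apply _.
  - apply yd_braid_linear; auto; apply _.
  - apply yd_braid_colinear; auto; apply _.
Qed.

(** An isomorphism of Yetter-Drinfel'd modules may be inverted in [C]. *)
Lemma yd_inverse X Y f g : is_yd_morphism A X Y f -> is_inverse (C := C) (ycar X) (ycar Y) f g ->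
  is_inverse (C := YD A) X Y f g.
Proof.
  intros hf (h1 & h2 & h3 & h4); split; [exact hf|].
  destruct hf as [hX hY _ e1 e2]; split; [constructor; auto | auto].
  - transitivity (g ∘ yact Y ∘ (id a ⊗ (f ∘ g))); [diag with h4 | diag with (e1, h3)].
  - transitivity ((id a ⊗ (g ∘ f)) ∘ ycoact X ∘ g); [diag with h3 | diag with (e2, h4)].
Qed.

Lemma yd_braided_category : is_braided_category (YD A).
Proof.
  constructor; cbn [YD isob hom ob mor idm comp tens tensm unit1 braid].
  - intros X Y f h; split; apply h.
  - intros X hX; constructor; auto; try typed; diag.
  - intros X Y Z f g [hX hY hf e1 e2] [_ hZ hg e3 e4]; constructor; auto; try typed.
    + diag with (e1, e3).
    + diag with (e2, e4).
  - intros X Y f h; apply (id_comp hC (yd_morphism_hom h)).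
  - intros X Y f h; apply (comp_id hC (yd_morphism_hom h)).
  - intros X Y Z W f g h hf hg hh.
    apply (comp_assoc hC (yd_morphism_hom hf) (yd_morphism_hom hg) (yd_morphism_hom hh)).
  - exact yd_unit_yd.
  - exact yd_tens_yd.
  - exact yd_tens_assoc.
  - exact yd_unit_tens.
  - exact yd_tens_unit.
  - exact yd_tensm.
  - intros X Y hX hY; apply (tensm_id hC); typed.
  - intros X X' X'' Y Y' Y'' f f' g g' hf hf' hg hg'.
    apply (tensm_comp hC (yd_morphism_hom hf) (yd_morphism_hom hf')
      (yd_morphism_hom hg) (yd_morphism_hom hg')).
  - intros X X' Y Y' Z Z' f g h hf hg hh.
    apply (tensm_assoc hC (yd_morphism_hom hf) (yd_morphism_hom hg) (yd_morphism_hom hh)).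
  - intros X Y f h; apply (unit_tensm hC (yd_morphism_hom h)).
  - intros X Y f h; apply (tensm_unit hC (yd_morphism_hom h)).
  - intros X Y hX hY; exists (yd_braid_inv X Y).
    apply yd_inverse; [apply yd_braid_morphism; auto|].
    apply yd_braid_inverse; apply _.
  - intros X X' Y Y' f g hf hg.
    apply yd_braid_natural; try apply hf; try apply hg; first
      [apply yd_comodule | apply yd_module]; first [apply hf | apply hg].
  - intros X Y Z hX hY hZ; apply yd_braid_tens_r; apply _.
  - intros X Y Z hX hY hZ; apply yd_braid_tens_l; apply _.
Qed.

End YetterDrinfeld.

(** * Radford biproducts *)

Section Factorization.

Variable C : catData.
Local Notation "X ⊗ Y" := (tens C X Y) : ob_scope.
Local Notation "f ⊗ g" := (tensm C f g) : mor_scope.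
Local Notation "g ∘ f" := (comp C g f) : mor_scope.
Local Notation "𝟏" := (unit1 C) : ob_scope.
Local Notation id := (idm C).
Local Notation c := (braid C).
Local Notation cinv X Y := (inv (C := C) (tens C X Y) (tens C Y X) (braid C X Y)).
Local Open Scope mor_scope.
Hypothesis hC : is_braided_category C.

(** The product of [k ⊗ a] is determined by those of the two factors and by the
    exchange [x] of [a] with [k], so that multiplicativity of [D] need only be tested
    on these three. *)
Lemma multiplicative_on_factors (k a h : ob C) (mk ma x m D p q : mor C) :
  hom C (k ⊗ k) k mk -> hom C (a ⊗ a) a ma -> hom C (a ⊗ k) (k ⊗ a) x ->
  hom C (h ⊗ h) h m -> hom C k h p -> hom C a h q ->
  m ∘ (m ⊗ id h) = m ∘ (id h ⊗ m) -> D = m ∘ (p ⊗ q) ->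
  p ∘ mk = m ∘ (p ⊗ p) -> q ∘ ma = m ∘ (q ⊗ q) -> D ∘ x = m ∘ (q ⊗ p) ->
  D ∘ ((mk ⊗ ma) ∘ (id k ⊗ x ⊗ id a)) = m ∘ (D ⊗ D).
Proof.
  intros hk ha hx hm hp hq assoc e ep eq ex; rewrite e in *.
  transitivity (m ∘ ((m ∘ (p ⊗ (m ∘ (p ⊗ q) ∘ x))) ⊗ q)).
  - diag with (assoc, ep, eq).
  - rewrite ex; diag with assoc.
Qed.

End Factorization.

Section Biproduct.

Variable C : catData.
Local Notation "X ⊗ Y" := (tens C X Y) : ob_scope.
Local Notation "f ⊗ g" := (tensm C f g) : mor_scope.
Local Notation "g ∘ f" := (comp C g f) : mor_scope.
Local Notation "𝟏" := (unit1 C) : ob_scope.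
Local Notation id := (idm C).
Local Notation c := (braid C).
Local Notation cinv X Y := (inv (C := C) (tens C X Y) (tens C Y X) (braid C X Y)).
Local Open Scope mor_scope.
Hypothesis hC : is_braided_category C.

Variable A : hopfData C.
Hypothesis hA : is_hopf A.
Variable K : hopfData (YD A).
Hypothesis hK : is_hopf (C := YD A) K.
Local Notation a := (hcar A).
Local Notation k := (ycar (hcar K)).
Local Notation ρ := (yact (hcar K)).
Local Notation δ := (ycoact (hcar K)).
Local Notation μ := (hmul K).
Local Notation Δ := (hcomul K).
Local Notation H := (biproduct K).

Let mul_linear := yd_morphism_act (hopf_mul_hom hK).
Let mul_colinear := yd_morphism_coact (hopf_mul_hom hK).
Let one_linear := yd_morphism_act (hopf_one_hom hK).
Let one_colinear := yd_morphism_coact (hopf_one_hom hK).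
Let comul_linear := yd_morphism_act (hopf_comul_hom hK).
Let comul_colinear := yd_morphism_coact (hopf_comul_hom hK).
Let counit_linear := yd_morphism_act (hopf_counit_hom hK).
Let counit_colinear := yd_morphism_coact (hopf_counit_hom hK).

(** The law of [K] with the braiding of Yetter-Drinfel'd modules written out. *)
Lemma comul_mul_K : Δ ∘ μ = (μ ⊗ μ) ∘ (id k ⊗ ((ρ ⊗ id k) ∘ (id a ⊗ c k k) ∘ (δ ⊗ id k)) ⊗ id k)
  ∘ (Δ ⊗ Δ).
Proof. exact (hopf_comul_mul hK). Qed.

Lemma biproduct_algebra : hmul H ∘ (hmul H ⊗ id (hcar H)) = hmul H ∘ (id (hcar H) ⊗ hmul H).
Proof.
  cbn [biproduct hmul hcar].
  diag with (hopf_mul_assoc hK, hopf_mul_assoc hA, hopf_comul_mul hA, yd_act_mul (hopf_ob hK),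
    mul_linear, hopf_comul_assoc hA).
Qed.
Lemma biproduct_coalgebra : (hcomul H ⊗ id (hcar H)) ∘ hcomul H = (id (hcar H) ⊗ hcomul H)
  ∘ hcomul H.
Proof.
  cbn [biproduct hcomul hcar].
  diag with (hopf_comul_assoc hK, hopf_comul_assoc hA, hopf_comul_mul hA,
    yd_coact_comul (hopf_ob hK), comul_colinear, hopf_mul_assoc hA).
Qed.

Let j := id k ⊗ hone A.
Let i := hone K ⊗ id a.
Let m2 := (hmul H ⊗ hmul H) ∘ (id (hcar H) ⊗ c (hcar H) (hcar H) ⊗ id (hcar H)).
Let D := hcomul H.

(** The two factors embed by [j] and [i], and every element is a product of an
    element of [K] and one of [A] ([biproduct_mul_ji]).  Hence the coproduct of the
    biproduct is multiplicative as soon as it is so on the products of the factors,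
    in the order [j j], [i i] and [i j]. *)
Lemma biproduct_comul_j : D ∘ j = (id k ⊗ δ ⊗ hone A) ∘ Δ.
Proof. unfold D, j; cbn [biproduct hcomul].
  diag with (hopf_mul_one hA, hopf_comul_one hA).
Qed.
Lemma biproduct_comul_i : D ∘ i = (i ⊗ i) ∘ hcomul A.
Proof. unfold D, i; cbn [biproduct hcomul].
  diag with (hopf_one_mul hA, one_colinear, hopf_comul_one hK).
Qed.
Lemma biproduct_mul_ij : hmul H ∘ (i ⊗ j) = (ρ ⊗ id a) ∘ (id a ⊗ c a k) ∘ (hcomul A ⊗ id k).
Proof. unfold i, j; cbn [biproduct hmul].
  diag with (hopf_one_mul hK, hopf_mul_one hA).
Qed.
Lemma biproduct_mul_ji : hmul H ∘ (j ⊗ i) = id (k ⊗ a).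
Proof. unfold i, j; cbn [biproduct hmul].
  diag with (hopf_mul_one hK, hopf_one_mul hA, one_linear, hopf_comul_one hA, hopf_counit_one hA).
Qed.
Lemma biproduct_comul_ji : D = m2 ∘ ((D ∘ j) ⊗ (D ∘ i)).
Proof. rewrite biproduct_comul_j, biproduct_comul_i. unfold D, m2, i;
  cbn [biproduct hmul hcomul hcar].
  diag simp (hopf_mul_one hK, hopf_one_mul hA, eq_sym one_linear, hopf_comul_one hA,
    hopf_counit_one hA, hopf_comul_counit hA, hopf_counit_comul hA,
    yd_act_one (hopf_ob hK)) with tt.
Qed.

Lemma biproduct_comul_jj : D ∘ j ∘ μ = m2 ∘ ((D ∘ j) ⊗ (D ∘ j)).
Proof. rewrite biproduct_comul_j. unfold D, m2, i; cbn [biproduct hmul hcomul hcar].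
  diag simp (hopf_mul_one hK, hopf_mul_one hA, hopf_comul_one hA, yd_act_one (hopf_ob hK))
   with (comul_mul_K, mul_colinear, yd_act_mul (hopf_ob hK), yd_coact_comul (hopf_ob hK)).
Qed.
Lemma biproduct_comul_ii : D ∘ i ∘ hmul A = m2 ∘ ((D ∘ i) ⊗ (D ∘ i)).
Proof. rewrite biproduct_comul_i. unfold D, m2, i; cbn [biproduct hmul hcomul hcar].
  diag simp (hopf_mul_one hK, hopf_one_mul hK, eq_sym one_linear, hopf_mul_one hA,
    hopf_comul_one hA, yd_act_one (hopf_ob hK), hopf_counit_comul hA)
   with (hopf_comul_mul hA).
Qed.
Lemma biproduct_comul_ij : D ∘ (ρ ⊗ id a) ∘ (id a ⊗ c a k) ∘ (hcomul A ⊗ id k) = m2 ∘ ((D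
  ∘ i) ⊗ (D ∘ j)).
Proof. rewrite biproduct_comul_i, biproduct_comul_j. unfold D, m2, i;
  cbn [biproduct hmul hcomul hcar].
  diag simp (hopf_mul_one hK, hopf_one_mul hK, eq_sym one_linear, hopf_mul_one hA,
    hopf_comul_one hA, yd_act_one (hopf_ob hK), hopf_counit_comul hA)
   with (comul_linear, yd_compat (hopf_ob hK), hopf_comul_assoc hA, hopf_mul_assoc hA).
Qed.

Lemma biproduct_comul_mul : hcomul H ∘ hmul H =
  (hmul H ⊗ hmul H) ∘ (id (hcar H) ⊗ c (hcar H) (hcar H) ⊗ id (hcar H)) ∘ (hcomul H ⊗ hcomul H).
Proof.
  assert (hm : hom C ((k ⊗ a) ⊗ (k ⊗ a)) (k ⊗ a) (hmul H)) by (cbn [biproduct hmul]; typed).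
  assert (assoc := tens_mul_assoc hC hm biproduct_algebra).
  change (D ∘ hmul H = m2 ∘ (D ⊗ D)).
  transitivity (D ∘ ((μ ⊗ hmul A) ∘
    (id k ⊗ ((ρ ⊗ id a) ∘ (id a ⊗ c a k) ∘ (hcomul A ⊗ id k)) ⊗ id a))).
  { f_equal; cbn [biproduct hmul]; diag. }
  assert (D_hom : hom C (k ⊗ a) ((k ⊗ a) ⊗ (k ⊗ a)) D)
    by (unfold D; cbn [biproduct hcomul]; typed).
  apply (multiplicative_on_factors hC (h := (k ⊗ a ⊗ (k ⊗ a))%ob) (p := D ∘ j) (q := D ∘ i));
    try typed.
  - unfold m2; cbn [biproduct hcar]; typed.
  - unfold j; typed.
  - unfold i; typed.
  - exact assoc.
  - exact biproduct_comul_ji.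
  - exact biproduct_comul_jj.
  - exact biproduct_comul_ii.
  - rewrite <- biproduct_comul_ij; diag.
Qed.

(* The identity is the convolution product of the projections [P] and [Q] onto the
   factors.  These have convolution inverses, namely the antipodes of the factors,
   whose product in the opposite order is the antipode of the biproduct. *)
Let P := j ∘ (id k ⊗ hcounit A).
Let Q := i ∘ (hcounit K ⊗ id a).
Let P' := j ∘ (hanti K ⊗ hcounit A).
Let Q' := i ∘ (hcounit K ⊗ hanti A).

Lemma biproduct_mul_jj : hmul H ∘ (j ⊗ j) = j ∘ μ.
Proof. unfold j; cbn [biproduct hmul].
  diag simp (hopf_comul_one hA, yd_act_one (hopf_ob hK), hopf_mul_one hA) with tt. Qed.
Lemma biproduct_mul_ii : hmul H ∘ (i ⊗ i) = i ∘ hmul A.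
Proof. unfold i; cbn [biproduct hmul].
  diag simp (eq_sym one_linear, hopf_mul_one hK, hopf_counit_comul hA) with tt. Qed.

Let convolution f g := hmul H ∘ (f ⊗ g) ∘ hcomul H.

Lemma identity_factors : convolution P Q = id (k ⊗ a).
Proof.
  unfold convolution, P, Q.
  transitivity (hmul H ∘ (j ⊗ i) ∘ (((id k ⊗ hcounit A) ⊗ (hcounit K ⊗ id a)) ∘ hcomul H)).
  - cbn [biproduct hmul hcomul]; unfold i, j; diag.
  - rewrite biproduct_mul_ji; cbn [biproduct hcomul].
    diag with (hopf_counit_mul hA, counit_colinear, hopf_counit_comul hA, hopf_comul_counit hK,
      yd_coact_counit (hopf_ob hK)).
Qed.

Lemma antipode_factors : convolution Q' P' = hanti H.
Proof.
  unfold convolution, P', Q'.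
  transitivity (hmul H ∘ (i ⊗ j) ∘ ((hcounit K ⊗ hanti A) ⊗ (hanti K ⊗ hcounit A)) ∘ hcomul H).
  - cbn [biproduct hmul hcomul]; unfold i, j; diag.
  - rewrite biproduct_mul_ij; cbn [biproduct hcomul hanti].
    diag with (hopf_comul_counit hA, hopf_counit_comul hK).
Qed.

Lemma inverse_P_l : convolution P' P = hone H ∘ hcounit H.
Proof.
  unfold convolution, P', P.
  transitivity (hmul H ∘ (j ⊗ j) ∘ ((hanti K ⊗ hcounit A) ⊗ (id k ⊗ hcounit A)) ∘ hcomul H).
  - cbn [biproduct hmul hcomul]; unfold j; diag.
  - rewrite biproduct_mul_jj; unfold j; cbn [biproduct hcomul hone hcounit].
    diag with (hopf_comul_counit hA, hopf_counit_mul hA, hopf_anti_l hK,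
      yd_coact_counit (hopf_ob hK)).
Qed.

Lemma inverse_P_r : convolution P P' = hone H ∘ hcounit H.
Proof.
  unfold convolution, P', P.
  transitivity (hmul H ∘ (j ⊗ j) ∘ ((id k ⊗ hcounit A) ⊗ (hanti K ⊗ hcounit A)) ∘ hcomul H).
  - cbn [biproduct hmul hcomul]; unfold j; diag.
  - rewrite biproduct_mul_jj; unfold j; cbn [biproduct hcomul hone hcounit].
    diag with (hopf_comul_counit hA, hopf_counit_mul hA, hopf_anti_r hK,
      yd_coact_counit (hopf_ob hK)).
Qed.

Lemma inverse_Q_l : convolution Q' Q = hone H ∘ hcounit H.
Proof.
  unfold convolution, Q', Q.
  transitivity (hmul H ∘ (i ⊗ i) ∘ ((hcounit K ⊗ hanti A) ⊗ (hcounit K ⊗ id a)) ∘ hcomul H).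
  - cbn [biproduct hmul hcomul]; unfold i; diag.
  - rewrite biproduct_mul_ii; unfold i; cbn [biproduct hcomul hone hcounit].
    diag with (hopf_counit_comul hK, hopf_one_mul hA, counit_colinear, hopf_anti_l hA).
Qed.

Lemma inverse_Q_r : convolution Q Q' = hone H ∘ hcounit H.
Proof.
  unfold convolution, Q', Q.
  transitivity (hmul H ∘ (i ⊗ i) ∘ ((hcounit K ⊗ id a) ⊗ (hcounit K ⊗ hanti A)) ∘ hcomul H).
  - cbn [biproduct hmul hcomul]; unfold i; diag.
  - rewrite biproduct_mul_ii; unfold i; cbn [biproduct hcomul hone hcounit].
    diag with (hopf_counit_comul hK, hopf_one_mul hA, counit_colinear, hopf_anti_r hA).
Qed.
Lemma biproduct_one_mul : hmul H ∘ (hone H ⊗ id (hcar H)) = id (hcar H).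
Proof. cbn [biproduct hone hmul hcar].
 diag simp (hopf_comul_one hA, yd_act_one (hopf_ob hK), hopf_one_mul hK,
   hopf_one_mul hA) with tt. Qed.
Lemma biproduct_mul_one : hmul H ∘ (id (hcar H) ⊗ hone H) = id (hcar H).
Proof. cbn [biproduct hone hmul hcar].
 diag simp (eq_sym one_linear, hopf_counit_comul hA, hopf_mul_one hK, hopf_mul_one hA) with tt. Qed.
Lemma biproduct_counit_comul : (hcounit H ⊗ id (hcar H)) ∘ hcomul H = id (hcar H).
Proof. cbn [biproduct hcounit hcomul hcar].
 diag simp (hopf_counit_mul hA, yd_coact_counit (hopf_ob hK), hopf_counit_comul hK,
   hopf_counit_comul hA) with tt. Qed.
Lemma biproduct_comul_counit : (id (hcar H) ⊗ hcounit H) ∘ hcomul H = id (hcar H).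
Proof. cbn [biproduct hcounit hcomul hcar].
 diag simp (eq_sym counit_colinear, hopf_comul_counit hK, hopf_comul_counit hA,
   hopf_one_mul hA) with tt. Qed.
Lemma biproduct_counit_mul : hcounit H ∘ hmul H = hcounit H ⊗ hcounit H.
Proof. cbn [biproduct hcounit hmul hcar].
 diag simp (hopf_counit_mul hA, hopf_counit_mul hK, counit_linear,
   hopf_counit_comul hA) with tt. Qed.
Lemma biproduct_comul_one : hcomul H ∘ hone H = hone H ⊗ hone H.
Proof. cbn [biproduct hcomul hone hcar].
 diag simp (hopf_comul_one hA, hopf_comul_one hK, one_colinear, hopf_one_mul hA) with tt. Qed.
Lemma biproduct_counit_one : hcounit H ∘ hone H = id 𝟏.
Proof. cbn [biproduct hcounit hone hcar].
 diag simp (hopf_counit_one hA, hopf_counit_one hK) with tt. Qed.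

(** The antipode is [hanti A ⊗ hanti K] between two braidings of the Yetter-Drinfel'd
    module [K] with the regular module and comodule [A], which are invertible. *)
Lemma biproduct_anti_iso : is_iso (C := C) (hcar H) (hcar H) (hanti H).
Proof.
  exists (yd_braid_inv A (hcar K) (regular A) ∘
   (inv a a (hanti A) ⊗ inv (C := YD A) (hcar K) (hcar K) (hanti K))
     ∘ yd_braid_inv A (regular A) (hcar K)).
  assert (hr := module_regular hA); assert (hr' := comodule_regular hA).
  assert (i1 := yd_braid_inverse hC hA (X := hcar K) (Y := regular A) _ _).
  assert (i2 := yd_braid_inverse hC hA (X := regular A) (Y := hcar K) _ _).
  assert (i3 := inv_spec (hopf_anti_iso hA)).
  assert (i4 := inv_spec (hopf_anti_iso hK)); destruct i4 as (k1 & k2 & k3 & k4).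
  assert (i4 : is_inverse (C := C) k k (hanti K) (inv (C := YD A) (hcar K) (hcar K) (hanti K))).
  { split; [exact (yd_morphism_hom k1) | split; [exact (yd_morphism_hom k2) | split;
      [exact k3 | exact k4]]]. }
  assert (e : hanti H = yd_braid A (regular A) (hcar K) ∘ ((hanti A ⊗ hanti K)
    ∘ yd_braid A (hcar K) (regular A))).
  { unfold yd_braid; cbn [biproduct hanti regular ycar yact ycoact]; diag. }
  rewrite e; cbn [biproduct hcar].
  exact (inverse_comp hC (inverse_comp hC i1 (inverse_tens hC i3 i4)) i2).
Qed.

Lemma biproduct_hopf : is_hopf H.
Proof.
  assert (hm : hom C (hcar H ⊗ hcar H) (hcar H) (hmul H)) by (cbn [biproduct hmul hcar]; typed).
  assert (hD : hom C (hcar H) (hcar H ⊗ hcar H) (hcomul H)) by (cbn [biproduct hcomul hcar]; typed).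
  assert (h1 : hom C 𝟏 (hcar H) (hone H)) by (cbn [biproduct hone hcar]; typed).
  assert (he : hom C (hcar H) 𝟏 (hcounit H)) by (cbn [biproduct hcounit hcar]; typed).
  assert (hP : hom C (hcar H) (hcar H) P) by (unfold P, j; cbn [biproduct hcar]; typed).
  assert (hQ : hom C (hcar H) (hcar H) Q) by (unfold Q, i; cbn [biproduct hcar]; typed).
  assert (hP' : hom C (hcar H) (hcar H) P') by (unfold P', j; cbn [biproduct hcar]; typed).
  assert (hQ' : hom C (hcar H) (hcar H) Q') by (unfold Q', i; cbn [biproduct hcar]; typed).
  constructor; auto.
  - cbn [biproduct hcar]; typed.
  - exact biproduct_algebra.
  - exact biproduct_one_mul.
  - exact biproduct_mul_one.
  - exact biproduct_coalgebra.
  - exact biproduct_counit_comul.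
  - exact biproduct_comul_counit.
  - exact biproduct_comul_mul.
  - exact biproduct_counit_mul.
  - exact biproduct_comul_one.
  - exact biproduct_counit_one.
  - exact biproduct_anti_iso.
  - change (id (hcar H)) with (id (k ⊗ a)%ob).
    rewrite <- antipode_factors; rewrite <- identity_factors.
    apply (convolution_inverse_product hC hD he hm h1 biproduct_coalgebra biproduct_counit_comul
      biproduct_comul_counit biproduct_algebra biproduct_mul_one hP hP' hQ hQ' inverse_P_l
        inverse_Q_l).
  - change (id (hcar H)) with (id (k ⊗ a)%ob).
    rewrite <- antipode_factors; rewrite <- identity_factors.
    apply (convolution_inverse_product hC hD he hm h1 biproduct_coalgebra biproduct_counit_comul
      biproduct_comul_counit biproduct_algebra biproduct_mul_one hQ' hQ hP' hP inverse_Q_r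
        inverse_P_r).
Qed.
End Biproduct.

(** * Yetter-Drinfel'd modules over a biproduct *)

Section RestrictBase.

Variable C : catData.
Local Notation "X ⊗ Y" := (tens C X Y) : ob_scope.
Local Notation "f ⊗ g" := (tensm C f g) : mor_scope.
Local Notation "g ∘ f" := (comp C g f) : mor_scope.
Local Notation "𝟏" := (unit1 C) : ob_scope.
Local Notation id := (idm C).
Local Notation c := (braid C).
Local Notation cinv X Y := (inv (C := C) (tens C X Y) (tens C Y X) (braid C X Y)).
Local Open Scope mor_scope.
Hypothesis hC : is_braided_category C.

Variables (H A : hopfData C).
Hypothesis hH : is_hopf H.
Hypothesis hA : is_hopf A.
Variables i π : mor C.
Hypothesis hi : is_hopf_morphism A H i.
Hypothesis hπ : is_hopf_morphism H A π.
Hypothesis πi : π ∘ i = id (hcar A).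
Local Notation h := (hcar H).
Local Notation a := (hcar A).

Let i_hom : hom C a h i := hopf_morphism_hom hi.
Let π_hom : hom C h a π := hopf_morphism_hom hπ.
Let i_mul := hopf_morphism_mul hi.
Let i_one := hopf_morphism_one hi.
Let i_comul := hopf_morphism_comul hi.
Let i_counit := hopf_morphism_counit hi.
Let π_mul := hopf_morphism_mul hπ.
Let π_one := hopf_morphism_one hπ.
Let π_comul := hopf_morphism_comul hπ.
Let π_counit := hopf_morphism_counit hπ.

(** Restriction along [i] and corestriction along [π].  Compatibility survives since
    [π ∘ i] is the identity.  This serves both for the inclusion of [A] in a biproduct
    and for isomorphisms of Hopf algebras. *)
Definition restrict_base (X : ydData C) : ydData C :=
  YDData (ycar X) (yact X ∘ (i ⊗ id (ycar X))) ((π ⊗ id (ycar X)) ∘ ycoact X).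

Lemma restrict_base_yd X : is_yd H X -> is_yd A (restrict_base X).
Proof.
  intros hX; constructor; cbn [restrict_base ycar yact ycoact]; try typed.
  - diag with (i_mul, yd_act_mul hX).
  - diag with (i_one, yd_act_one hX).
  - diag with (π_comul, yd_coact_comul hX).
  - diag with (π_counit, yd_coact_counit hX).
  - transitivity ((π ⊗ id (ycar X)) ∘
      ((hmul H ⊗ yact X) ∘ (id h ⊗ c h h ⊗ id (ycar X)) ∘ (hcomul H ⊗ ycoact X))
      ∘ (i ⊗ id (ycar X))).
    + diag with (i_comul, π_mul, πi).
    + rewrite (yd_compat hX); diag with (i_comul, π_mul, πi).
Qed.

Lemma restrict_base_morphism X Y f : is_yd_morphism H X Y f ->
  is_yd_morphism A (restrict_base X) (restrict_base Y) f.
Proof.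
  intros [hX hY hf e1 e2]; constructor; auto using restrict_base_yd;
    cbn [restrict_base ycar yact ycoact].
  - diag with e1.
  - diag with e2.
Qed.

Lemma restrict_base_tens X Y : is_yd H X -> is_yd H Y ->
  restrict_base (yd_tens H X Y) = yd_tens A (restrict_base X) (restrict_base Y).
Proof.
  intros hX hY; apply ydData_eq; cbn [restrict_base yd_tens ycar yact ycoact]; auto.
  - diag with i_comul.
  - diag with π_mul.
Qed.

Lemma restrict_base_unit : restrict_base (yd_unit H) = yd_unit A.
Proof.
  apply ydData_eq; cbn [restrict_base yd_unit ycar yact ycoact]; auto.
  - diag with i_counit.
  - diag with π_one.
Qed.

End RestrictBase.

Section Splitting.

Variable C : catData.
Local Notation "X ⊗ Y" := (tens C X Y) : ob_scope.
Local Notation "f ⊗ g" := (tensm C f g) : mor_scope.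
Local Notation "g ∘ f" := (comp C g f) : mor_scope.
Local Notation "𝟏" := (unit1 C) : ob_scope.
Local Notation id := (idm C).
Local Notation c := (braid C).
Local Notation cinv X Y := (inv (C := C) (tens C X Y) (tens C Y X) (braid C X Y)).
Local Open Scope mor_scope.
Hypothesis hC : is_braided_category C.

Variables (H A : hopfData C) (K : hopfData (YD A)) (i π j r : mor C).
Local Notation h := (hcar H).
Local Notation a := (hcar A).
Local Notation k := (ycar (hcar K)).
Local Notation ρ := (yact (hcar K)).
Local Notation δ := (ycoact (hcar K)).
Local Notation μ := (hmul H).
Local Notation Δ := (hcomul H).

(** The relations between the maps [i], [π] of a projection onto [A] and the maps
    [j], [r] that embed [K] and retract onto it.  Modules over [H] are restricted
    in terms of these relations rather than of the structure maps of the biproduct,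
    which keeps the diagrams small. *)
Record is_splitting : Prop := {
  split_i : is_hopf_morphism A H i;
  split_π : is_hopf_morphism H A π;
  split_j_hom : hom C k h j;
  split_r_hom : hom C h k r;
  split_πi : π ∘ i = id a;
  split_πj : π ∘ j = hone A ∘ hcounit K;
  split_ri : r ∘ i = hone K ∘ hcounit A;
  split_rj : r ∘ j = id k;
  split_j_mul : μ ∘ (j ⊗ j) = j ∘ hmul K;
  split_j_one : j ∘ hone K = hone H;
  split_r_comul : (r ⊗ r) ∘ Δ = hcomul K ∘ r;
  split_r_counit : hcounit K ∘ r = hcounit H;
  split_factor : μ ∘ ((j ∘ r) ⊗ (i ∘ π)) ∘ Δ = id h;
  split_mul_ij : μ ∘ (i ⊗ j) = μ ∘ ((j ∘ ρ) ⊗ i) ∘ (id a ⊗ c a k) ∘ (hcomul A ⊗ id k);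
  split_comul_πr : (π ⊗ r) ∘ Δ = (hmul A ⊗ id k) ∘ (id a ⊗ c k a) ∘ ((δ ∘ r) ⊗ π) ∘ Δ;
  split_comul_j : Δ ∘ j = ((μ ∘ (j ⊗ i)) ⊗ j) ∘ (id k ⊗ δ) ∘ hcomul K;
  split_r_mul : r ∘ μ = hmul K ∘ (r ⊗ (ρ ∘ (π ⊗ r))) ∘ (Δ ⊗ id h)
}.
End Splitting.

Section Restriction.

Variable C : catData.
Local Notation "X ⊗ Y" := (tens C X Y) : ob_scope.
Local Notation "f ⊗ g" := (tensm C f g) : mor_scope.
Local Notation "g ∘ f" := (comp C g f) : mor_scope.
Local Notation "𝟏" := (unit1 C) : ob_scope.
Local Notation id := (idm C).
Local Notation c := (braid C).
Local Notation cinv X Y := (inv (C := C) (tens C X Y) (tens C Y X) (braid C X Y)).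
Local Open Scope mor_scope.
Hypothesis hC : is_braided_category C.

Variables (H A : hopfData C) (K : hopfData (YD A)) (i π j r : mor C).
Hypothesis hH : is_hopf H.
Hypothesis hA : is_hopf A.
Hypothesis hK : is_hopf (C := YD A) K.
Hypothesis split : is_splitting H K i π j r.
Local Notation h := (hcar H).
Local Notation a := (hcar A).
Local Notation k := (ycar (hcar K)).
Local Notation ρ := (yact (hcar K)).
Local Notation δ := (ycoact (hcar K)).
Local Notation μ := (hmul H).
Local Notation Δ := (hcomul H).

Let i_hom : hom C a h i := hopf_morphism_hom (split_i split).
Let π_hom : hom C h a π := hopf_morphism_hom (split_π split).
Let j_hom : hom C k h j := split_j_hom split.
Let r_hom : hom C h k r := split_r_hom split.
Let i_mul := hopf_morphism_mul (split_i split).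
Let i_one := hopf_morphism_one (split_i split).
Let i_comul := hopf_morphism_comul (split_i split).
Let i_counit := hopf_morphism_counit (split_i split).
Let π_mul := hopf_morphism_mul (split_π split).
Let π_one := hopf_morphism_one (split_π split).
Let π_comul := hopf_morphism_comul (split_π split).
Let π_counit := hopf_morphism_counit (split_π split).
Let πi := split_πi split.
Let πj := split_πj split.
Let ri := split_ri split.
Let rj := split_rj split.
Let j_mul := split_j_mul split.
Let j_one := split_j_one split.
Let r_comul := split_r_comul split.
Let r_counit := split_r_counit split.
Let mul_ij := split_mul_ij split.
Let comul_πr := split_comul_πr split.
Let comul_j := split_comul_j split.
Let r_mul := split_r_mul split.

Let one_linear := yd_morphism_act (hopf_one_hom hK).
Let counit_colinear := yd_morphism_coact (hopf_counit_hom hK).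

Lemma split_r_mul_i : r ∘ μ ∘ (id h ⊗ i) = r ⊗ hcounit A.
Proof.
  diag with (r_mul, ri, one_linear, π_counit, hopf_comul_counit hH, hopf_mul_one hK).
Qed.

Lemma split_r_mul_j : r ∘ μ ∘ (j ⊗ id h) = hmul K ∘ (id k ⊗ r).
Proof.
  transitivity (hmul K ∘ ((r ∘ μ ∘ (j ⊗ i)) ⊗ (ρ ∘ ((π ∘ j) ⊗ r)))
    ∘ (((id k ⊗ δ) ∘ hcomul K) ⊗ id h)).
  - diag with (r_mul, comul_j).
  - rewrite πj.
    diag with (split_r_mul_i, rj, yd_act_one (hopf_ob hK), yd_coact_counit (hopf_ob hK),
      hopf_comul_counit hK).
Qed.

Lemma split_r_i_mul : r ∘ μ ∘ (i ⊗ id h) = ρ ∘ (id a ⊗ r).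
Proof.
  diag with (r_mul, ri, πi, i_comul, hopf_counit_comul hA, hopf_one_mul hK).
Qed.

Local Notation restrict_base := (restrict_base i π).
Let restrict_base_yd X := @restrict_base_yd C hC H A hH hA i π (split_i split) (split_π split)
  (split_πi split) X.

Definition restrict (X : ydData C) : ydData (YD A) :=
  YDData (C := YD A) (restrict_base X)
    (yact X ∘ (j ⊗ id (ycar X))) ((r ⊗ id (ycar X)) ∘ ycoact X).

(** Linearity is the exchange rule of [i] and [j]; colinearity is the compatibility
    condition over [H] evaluated on [j] and followed by [π]. *)
Lemma restrict_act_morphism X : is_yd H X ->
  is_yd_morphism A (yd_tens A (hcar K) (restrict_base X)) (restrict_base X) (yact X
    ∘ (j ⊗ id (ycar X))).
Proof.
  intros hX; assert (hX' := restrict_base_yd hX).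
  assert (e := yd_compat hX).
  constructor; auto; [apply yd_tens_yd; auto; apply _ | | |];
    cbn [Restriction.restrict_base yd_tens ycar yact ycoact]; try typed.
  - diag with (mul_ij, yd_act_mul hX).
  - transitivity ((π ⊗ id (ycar X)) ∘
      ((μ ⊗ yact X) ∘ (id h ⊗ c h h ⊗ id (ycar X)) ∘ (Δ ⊗ ycoact X)) ∘ (j ⊗ id (ycar X))).
    + rewrite e. diag with (comul_j, π_mul, πj, counit_colinear, hopf_comul_counit hK, i_one,
        hopf_mul_one hH, hopf_mul_one hA).
    + diag with (comul_j, π_mul, πj, πi, hopf_one_mul hA, hopf_counit_comul hK).
Qed.

(** Dually, by the compatibility condition evaluated on [i] and followed by [r]. *)
Lemma restrict_coact_morphism X : is_yd H X ->
  is_yd_morphism A (restrict_base X) (yd_tens A (hcar K) (restrict_base X)) ((r ⊗ id (ycar X))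
    ∘ ycoact X).
Proof.
  intros hX; assert (hX' := restrict_base_yd hX).
  assert (e := yd_compat hX).
  constructor; auto; [apply yd_tens_yd; auto; apply _ | | |];
    cbn [Restriction.restrict_base yd_tens ycar yact ycoact]; try typed.
  - transitivity ((r ⊗ id (ycar X)) ∘
      ((μ ⊗ yact X) ∘ (id h ⊗ c h h ⊗ id (ycar X)) ∘ (Δ ⊗ ycoact X)) ∘ (i ⊗ id (ycar X))).
    + rewrite e. diag with (i_comul, r_mul, ri, one_linear, π_counit, hopf_comul_counit hH,
        hopf_mul_one hK, hopf_comul_counit hA).
    + diag with (i_comul, r_mul, ri, πi, hopf_counit_comul hA, hopf_one_mul hK).
  - diag with (comul_πr, yd_coact_comul hX).
Qed.

Ltac unfold_restrict :=
  cbn [restrict Restriction.restrict_base YD comp tensm idm tens unit1 yd_tens yd_unit ycar yact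
    ycoact].

(** Compatibility over [K], with respect to the braiding of the modules over [A], is
    compatibility over [H] evaluated on [j] and followed by [r]. *)
Lemma restrict_yd X : is_yd H X -> is_yd (C := YD A) K (restrict X).
Proof.
  intros hX; assert (e := yd_compat hX).
  constructor; cbn [restrict ycar yact ycoact].
  - exact (restrict_base_yd hX).
  - exact (restrict_act_morphism hX).
  - exact (restrict_coact_morphism hX).
  - unfold_restrict. diag with (j_mul, yd_act_mul hX).
  - unfold_restrict. diag with (j_one, yd_act_one hX).
  - unfold_restrict. diag with (r_comul, yd_coact_comul hX).
  - unfold_restrict. diag with (r_counit, yd_coact_counit hX).
  - change (braid (YD A)) with (yd_braid A); unfold yd_braid.
    unfold_restrict.
    transitivity ((r ⊗ id (ycar X)) ∘
      ((μ ⊗ yact X) ∘ (id h ⊗ c h h ⊗ id (ycar X)) ∘ (Δ ⊗ ycoact X)) ∘ (j ⊗ id (ycar X))).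
    + diag with (comul_j, split_r_mul_j, split_r_i_mul, hopf_mul_assoc hH).
    + rewrite e. diag with (comul_j, r_mul, rj, yd_act_mul hX, yd_coact_comul hX).
Qed.

(** With [restrict_coact], this shows that the structures over [H] are recovered from
    those over [A] and [K]. *)
Lemma restrict_act X : is_yd H X ->
  yact X ∘ (j ⊗ id (ycar X)) ∘ (id k ⊗ (yact X ∘ (i ⊗ id (ycar X)))) =
  yact X ∘ ((μ ∘ (j ⊗ i)) ⊗ id (ycar X)).
Proof. intros hX; diag with (yd_act_mul hX). Qed.

Lemma restrict_coact X : is_yd H X ->
  (id k ⊗ ((π ⊗ id (ycar X)) ∘ ycoact X)) ∘ ((r ⊗ id (ycar X)) ∘ ycoact X) =
  (((r ⊗ π) ∘ Δ) ⊗ id (ycar X)) ∘ ycoact X.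
Proof. intros hX; diag with (yd_coact_comul hX). Qed.

Lemma restrict_tens X Y : is_yd H X -> is_yd H Y ->
  restrict (yd_tens H X Y) = yd_tens (C := YD A) K (restrict X) (restrict Y).
Proof.
  intros hX hY.
  apply (ydData_eq (C := YD A));
    [exact (restrict_base_tens hC hH hA (split_i split) (split_π split) hX hY) | |];
    unfold_restrict.
  - change (braid (YD A)) with (yd_braid A); unfold yd_braid; unfold_restrict.
    diag with (comul_j, yd_act_mul hX).
  - change (braid (YD A)) with (yd_braid A); unfold yd_braid; unfold_restrict.
    diag with (r_mul, yd_coact_comul hX).
Qed.

Lemma restrict_unit : restrict (yd_unit H) = yd_unit (C := YD A) K.
Proof.
  apply (ydData_eq (C := YD A));
    [exact (restrict_base_unit hC hH hA (split_i split) (split_π split)) | |];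
    unfold_restrict.
  - transitivity (hcounit K ∘ (r ∘ j)); [diag with r_counit | rewrite rj; diag].
  - transitivity (r ∘ j ∘ hone K); [diag with j_one | rewrite rj; diag].
Qed.

Lemma restrict_morphism X Y f : is_yd_morphism H X Y f ->
  is_yd_morphism (C := YD A) K (restrict X) (restrict Y) f.
Proof.
  intros [hX hY hf e1 e2].
  constructor; auto using restrict_yd;
    [apply (restrict_base_morphism hC hH hA (split_i split) (split_π split) πi); constructor;
      auto | |];
    unfold_restrict.
  - diag with e1.
  - diag with e2.
Qed.

(** The identity of [H] factors through [K ⊗ A], and inserting this factorization
    splits the braiding over [H] into the braidings over [K] and over [A]. *)
Lemma restrict_braid X Y : is_yd H X -> is_yd H Y ->
  yd_braid H X Y = yd_braid (C := YD A) K (restrict X) (restrict Y).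
Proof.
  intros hX hY; unfold yd_braid.
  change (braid (YD A)) with (yd_braid A); unfold yd_braid; unfold_restrict.
  transitivity (((yact Y ∘ ((μ ∘ ((j ∘ r) ⊗ (i ∘ π)) ∘ Δ) ⊗ id (ycar Y))) ⊗ id (ycar X)) ∘
    (id h ⊗ c (ycar X) (ycar Y)) ∘ (ycoact X ⊗ id (ycar Y))).
  - rewrite (split_factor split); diag.
  - diag with (yd_act_mul hY, yd_coact_comul hX).
Qed.

End Restriction.

Section Extension.

Variable C : catData.
Local Notation "X ⊗ Y" := (tens C X Y) : ob_scope.
Local Notation "f ⊗ g" := (tensm C f g) : mor_scope.
Local Notation "g ∘ f" := (comp C g f) : mor_scope.
Local Notation "𝟏" := (unit1 C) : ob_scope.
Local Notation id := (idm C).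
Local Notation c := (braid C).
Local Notation cinv X Y := (inv (C := C) (tens C X Y) (tens C Y X) (braid C X Y)).
Local Open Scope mor_scope.
Hypothesis hC : is_braided_category C.

Variable A : hopfData C.
Hypothesis hA : is_hopf A.
Variable K : hopfData (YD A).
Hypothesis hK : is_hopf (C := YD A) K.
Local Notation a := (hcar A).
Local Notation k := (ycar (hcar K)).
Local Notation ρ := (yact (hcar K)).
Local Notation δ := (ycoact (hcar K)).
Local Notation H := (biproduct K).
Let hH : is_hopf H := biproduct_hopf hC hA hK.

Let mul_linear := yd_morphism_act (hopf_mul_hom hK).
Let mul_colinear := yd_morphism_coact (hopf_mul_hom hK).
Let one_linear := yd_morphism_act (hopf_one_hom hK).
Let one_colinear := yd_morphism_coact (hopf_one_hom hK).
Let comul_linear := yd_morphism_act (hopf_comul_hom hK).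
Let comul_colinear := yd_morphism_coact (hopf_comul_hom hK).
Let counit_linear := yd_morphism_act (hopf_counit_hom hK).
Let counit_colinear := yd_morphism_coact (hopf_counit_hom hK).

Local Notation i := (hone K ⊗ id a).
Local Notation j := (id k ⊗ hone A).
Local Notation π := (hcounit K ⊗ id a).
Local Notation r := (id k ⊗ hcounit A).

Ltac unfold_biproduct := cbn [biproduct hmul hone hcomul hcounit hcar].

Lemma biproduct_splitting : is_splitting H K i π j r.
Proof.
  constructor.
  - constructor; unfold_biproduct; try typed.
    + exact (eq_sym (biproduct_mul_ii hC hA hK)).
    + diag.
    + exact (biproduct_comul_i hC hA hK).
    + diag with (hopf_counit_one hK).
  - constructor; unfold_biproduct; try typed.
    + diag with (hopf_counit_mul hK, counit_linear, hopf_counit_comul hA).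
    + diag with (hopf_counit_one hK).
    + diag with (counit_colinear, hopf_counit_comul hK, hopf_one_mul hA).
    + diag.
  - unfold_biproduct; typed.
  - unfold_biproduct; typed.
  - diag with (hopf_counit_one hK).
  - diag.
  - diag.
  - diag with (hopf_counit_one hA).
  - exact (biproduct_mul_jj hC hA hK).
  - unfold_biproduct; diag.
  - unfold_biproduct; diag with (hopf_counit_mul hA, hopf_counit_comul hA, hopf_comul_counit hA,
      yd_coact_counit (hopf_ob hK)).
  - unfold_biproduct; diag.
  - rewrite <- (identity_factors hC hA hK) at 1; unfold_biproduct; diag.
  - rewrite (biproduct_mul_ij hC hA hK).
    transitivity (hmul H ∘ (j ⊗ i) ∘ (ρ ⊗ id a) ∘ (id a ⊗ c a k) ∘ (hcomul A ⊗ id k)).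
    + rewrite (biproduct_mul_ji hC hA hK); diag.
    + unfold_biproduct; diag.
  - unfold_biproduct. diag with (hopf_counit_comul hK, hopf_comul_counit hK, hopf_counit_comul hA,
      yd_coact_counit (hopf_ob hK), hopf_counit_mul hA, hopf_comul_counit hA).
  - rewrite (biproduct_comul_j hC hA hK), (biproduct_mul_ji hC hA hK); diag.
  - unfold_biproduct. diag simp (hopf_counit_mul hA, hopf_comul_counit hA,
      hopf_comul_counit hK) with (yd_coact_counit (hopf_ob hK), hopf_comul_counit hK,
      hopf_counit_comul hA).
Qed.

(** The compatibility condition is multiplicative in the acting element. *)
Lemma compat_product (G : hopfData C) (hG : is_hopf G) X (hX : is_module G X)
  (hX' : is_comodule G X) U V f g :
  hom C U (hcar G) f -> hom C V (hcar G) g ->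
  let lhs := (hmul G ⊗ yact X) ∘ (id (hcar G) ⊗ c (hcar G) (hcar G) ⊗ id (ycar X))
    ∘ (hcomul G ⊗ ycoact X) in
  let rhs := (hmul G ⊗ id (ycar X)) ∘ (id (hcar G) ⊗ c (ycar X) (hcar G))
      ∘ (ycoact X ⊗ id (hcar G)) ∘ (yact X ⊗ id (hcar G))
      ∘ (id (hcar G) ⊗ c (hcar G) (ycar X)) ∘ (hcomul G ⊗ id (ycar X)) in
  lhs ∘ (f ⊗ id (ycar X)) = rhs ∘ (f ⊗ id (ycar X)) ->
  lhs ∘ (g ⊗ id (ycar X)) = rhs ∘ (g ⊗ id (ycar X)) ->
  lhs ∘ ((hmul G ∘ (f ⊗ g)) ⊗ id (ycar X)) = rhs ∘ ((hmul G ∘ (f ⊗ g)) ⊗ id (ycar X)).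
Proof.
  cbv zeta; intros hf hg ef eg.
  diag with (hopf_comul_mul hG, hopf_mul_assoc hG, mod_mul hX, ef, eg).
Qed.

Definition extension_ob (Z : ydData (YD A)) : ydData C :=
  YDData (ycar (ycar Z)) (yact Z ∘ (id k ⊗ yact (ycar Z)))
    ((id k ⊗ ycoact (ycar Z)) ∘ ycoact Z).

(** Since [K] and [A] generate the biproduct, [compat_product] reduces compatibility
    to these two: on [K] it is compatibility over [K] together with colinearity of the
    action, on [A] it is linearity of the coaction together with compatibility over
    [A]. *)
Lemma extension_yd Z : is_yd (C := YD A) K Z -> is_yd H (extension_ob Z).
Proof.
  intros hZ.
  assert (hZ0 : is_yd A (ycar Z)) by exact (yd_ob hZ).
  assert (hκ : hom C (k ⊗ ycar (ycar Z)) (ycar (ycar Z)) (yact Z)) by exact (yd_morphism_hom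
    (yd_act_hom hZ)).
  assert (hχ : hom C (ycar (ycar Z)) (k ⊗ ycar (ycar Z)) (ycoact Z)) by exact (yd_morphism_hom
    (yd_coact_hom hZ)).
  assert (κ_linear := yd_morphism_act (yd_act_hom hZ)).
  assert (κ_colinear := yd_morphism_coact (yd_act_hom hZ)).
  assert (χ_linear := yd_morphism_act (yd_coact_hom hZ)).
  assert (χ_colinear := yd_morphism_coact (yd_coact_hom hZ)).
  assert (compat := yd_compat hZ).
  change (braid (YD A)) with (yd_braid A) in compat; unfold yd_braid in compat.
  assert (hm : is_module H (extension_ob Z)).
  { constructor; cbn [extension_ob biproduct hcar hmul hone ycar yact ycoact]; try typed.
    - diag with (yd_act_mul hZ, κ_linear, yd_act_mul hZ0).
    - diag with (yd_act_one hZ, yd_act_one hZ0). }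
  assert (hc : is_comodule H (extension_ob Z)).
  { constructor; cbn [extension_ob biproduct hcar hcomul hcounit ycar yact ycoact]; try typed.
    - diag with (yd_coact_comul hZ, χ_colinear, yd_coact_comul hZ0).
    - diag with (yd_coact_counit hZ, yd_coact_counit hZ0). }
  apply yd_intro; auto.
  assert (hi : hom C a (k ⊗ a) i) by typed.
  assert (hj : hom C k (k ⊗ a) j) by typed.
  assert (h := compat_product hH hm hc hj hi).
  cbv zeta in h; rewrite (biproduct_mul_ji hC hA hK) in h.
  change (id (k ⊗ a)%ob) with (id (hcar H)) in h.
  unfold yd_condition; assert (hH' := hH).
  transitivity ((hmul H ⊗ yact (extension_ob Z))
    ∘ (id (hcar H) ⊗ c (hcar H) (hcar H) ⊗ id (ycar (extension_ob Z))) ∘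
    (hcomul H ⊗ ycoact (extension_ob Z)) ∘ (id (hcar H) ⊗ id (ycar (extension_ob Z)))); [diag|].
  rewrite h; [diag | |]; clear h; unfold extension_ob; unfold_biproduct; cbn [ycar yact ycoact].
  - transitivity ((id k ⊗ ycoact (ycar Z)) ∘ ((hmul K ⊗ yact Z) ∘ (id k ⊗ ((yact (hcar K) ⊗ id k) ∘
      (id a ⊗ c k k) ∘ (ycoact (hcar K) ⊗ id k)) ⊗ id (ycar (ycar Z))) ∘ (hcomul K ⊗ ycoact Z))).
    + diag simp (hopf_mul_one hA, hopf_comul_one hA, yd_act_one hZ0) with (κ_colinear,
        yd_coact_comul (hopf_ob hK)).
    + etransitivity; [apply f_equal; exact compat|].
    diag simp (hopf_mul_one hA, hopf_comul_one hA, yd_act_one hZ0,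
      yd_act_one (hopf_ob hK)) with (yd_coact_comul hZ0).
  - diag simp (hopf_one_mul hA, hopf_one_mul hK, hopf_mul_one hK, eq_sym one_linear,
      hopf_comul_one hK, one_colinear, hopf_counit_comul hA, hopf_comul_counit hA,
      yd_act_one hZ) with
     (χ_linear, yd_compat hZ0, hopf_comul_assoc hA).
Qed.

End Extension.

(** * Braided functors *)

Section Functors.

Variables C D E : catData.

(** Restriction functors change neither the underlying objects nor the underlying
    arrows, so that they preserve tensor products and braidings on the nose. *)
Record is_strict_functor (F : functorData C D) : Prop := {
  strict_functor : is_functor F;
  strict_tens : forall X Y, isob C X -> isob C Y ->
    fob F (tens C X Y) = tens D (fob F X) (fob F Y);
  strict_unit : fob F (unit1 C) = unit1 D;
  strict_mu : forall X Y, isob C X -> isob C Y ->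
    fmu F X Y = idm D (tens D (fob F X) (fob F Y));
  strict_eta : feta F = idm D (unit1 D);
  strict_tensm : forall X X' Y Y' f g, hom C X X' f -> hom C Y Y' g ->
    fmap F (tens C X Y) (tens C X' Y') (tensm C f g) =
    tensm D (fmap F X X' f) (fmap F Y Y' g);
  strict_braid : forall X Y, isob C X -> isob C Y ->
    fmap F (tens C X Y) (tens C Y X) (braid C X Y) = braid D (fob F X) (fob F Y)
}.

Lemma strict_braided (F : functorData C D) :
  is_braided_category C -> is_braided_category D -> is_strict_functor F ->
  is_braided_functor F.
Proof.
  intros hC hD [hF ht h1 hm he hf hb].
  assert (ob := functor_ob hF).
  assert (iso_id : forall X, isob D X -> is_iso (C := D) X X (idm D X)).
  { intros X hX; exists (idm D X); apply (inverse_id hD hX). }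
  constructor; auto.
  - intros X Y hX hY; rewrite ht, hm by auto; apply iso_id, (tens_ob hD); auto.
  - rewrite h1, he; apply iso_id, (unit_ob hD).
  - intros X X' Y Y' f g hX hY.
    destruct (hom_ob hC hX), (hom_ob hC hY).
    rewrite hf by auto; rewrite !hm by auto.
    assert (h := tensm_hom hD (functor_hom hF hX) (functor_hom hF hY)).
    rewrite (id_comp hD h), (comp_id hD h); reflexivity.
  - intros X Y Z hX hY hZ.
    rewrite !hm by (auto; apply (tens_ob hC); auto).
    rewrite !ht by auto.
    rewrite !(tensm_id hD) by (auto; apply (tens_ob hD); auto).
    rewrite (tens_assoc hD) by auto; reflexivity.
  - intros X hX; rewrite hm, he, h1 by (auto; apply (unit_ob hC)).
    rewrite (tensm_id hD) by (auto; apply (unit_ob hD)).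
    rewrite (unit_tens hD) by auto; apply (id_comp hD (id_hom hD (ob _ hX))).
  - intros X hX; rewrite hm, he, h1 by (auto; apply (unit_ob hC)).
    rewrite (tensm_id hD) by (auto; apply (unit_ob hD)).
    rewrite (tens_unit hD) by auto; apply (id_comp hD (id_hom hD (ob _ hX))).
  - intros X Y hX hY; rewrite !hm, hb by auto.
    assert (h := braid_hom hD (ob _ hX) (ob _ hY)).
    rewrite (id_comp hD h), (comp_id hD h); reflexivity.
Qed.

(** All the equivalences below are bijective on objects, so that natural isomorphisms
    can be taken to be identities. *)
Record are_inverse (F : functorData C D) (G : functorData D C) : Prop := {
  inverse_functor_l : is_functor F;
  inverse_functor_r : is_functor G;
  inverse_ob_l : forall X, isob C X -> fob G (fob F X) = X;
  inverse_ob_r : forall X, isob D X -> fob F (fob G X) = X;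
  inverse_map_l : forall X Y f, hom C X Y f ->
    fmap G (fob F X) (fob F Y) (fmap F X Y f) = f;
  inverse_map_r : forall X Y f, hom D X Y f ->
    fmap F (fob G X) (fob G Y) (fmap G X Y f) = f
}.

Lemma functor_comp_functor (F : functorData C D) (G : functorData D E) :
  is_functor F -> is_functor G -> is_functor (functor_comp G F).
Proof.
  intros [f1 f2 f3 f4] [g1 g2 g3 g4]; constructor; simpl; auto.
  - intros X hX; rewrite f3, g3 by auto; reflexivity.
  - intros X Y Z f g hf hg; rewrite (f4 _ _ _ _ _ hf hg); eauto.
Qed.

End Functors.

Lemma inverse_equivalence (C D : catData) (F : functorData C D) (G : functorData D C) :
  is_braided_category C -> is_braided_category D -> are_inverse F G -> is_equivalence F.
Proof.
  intros hC hD [hF hG o1 o2 m1 m2]; split; [exact hF|].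
  exists G; split; [exact hG|]; split.
  - exists (idm C); split; simpl.
    + intros X hX; rewrite o1 by auto; exists (idm C X); apply (inverse_id hC hX).
    + intros X Y f hf; rewrite m1 by auto.
      rewrite (id_comp hC hf), (comp_id hC hf); reflexivity.
  - exists (idm D); split; simpl.
    + intros X hX; rewrite o2 by auto; exists (idm D X); apply (inverse_id hD hX).
    + intros X Y f hf; rewrite m2 by auto.
      rewrite (id_comp hD hf), (comp_id hD hf); reflexivity.
Qed.

Lemma are_inverse_sym (C D : catData) (F : functorData C D) (G : functorData D C) :
  are_inverse F G -> are_inverse G F.
Proof. intros []; constructor; auto. Qed.

Lemma inverse_functor_comp (C D E : catData) (F : functorData C D) (F' : functorData D C)
  (G : functorData D E) (G' : functorData E D) :
  is_braided_category D ->
  are_inverse F F' -> are_inverse G G' ->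
  are_inverse (functor_comp G F) (functor_comp F' G').
Proof.
  intros hD [f1 f2 f3 f4 f5 f6] [g1 g2 g3 g4 g5 g6].
  constructor; try apply functor_comp_functor; auto; simpl.
  - intros X hX; rewrite g3 by (apply f1; auto); auto.
  - intros X hX; rewrite f4 by (apply g2; auto); auto.
  - intros X Y f h; assert (hf := functor_hom f1 h).
    rewrite !g3, g5 by (auto; apply (hom_ob hD hf)); auto.
  - intros X Y f h; assert (hf := functor_hom g2 h).
    rewrite !f4, f6 by (auto; apply (hom_ob hD hf)); auto.
Qed.

Lemma strict_functor_comp (C D E : catData) (F : functorData C D) (G : functorData D E) :
  is_braided_category C -> is_braided_category D -> is_braided_category E ->
  is_strict_functor F -> is_strict_functor G -> is_strict_functor (functor_comp G F).
Proof.
  intros hC hD hE [f1 f2 f3 f4 f5 f6 f7] [g1 g2 g3 g4 g5 g6 g7].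
  assert (ob := functor_ob f1); assert (ob' := functor_ob g1).
  constructor; [apply functor_comp_functor; auto | | | | | |]; simpl.
  - intros X Y hX hY; rewrite f2, g2 by auto; reflexivity.
  - rewrite f3; exact g3.
  - intros X Y hX hY; rewrite f4, f2, g4 by auto.
    rewrite (functor_map_id g1), g2 by (auto; apply (tens_ob hD); auto).
    apply (id_comp hE (id_hom hE (tens_ob hE (ob' _ (ob _ hX)) (ob' _ (ob _ hY))))).
  - rewrite f5, f3, g5, (functor_map_id g1) by apply (unit_ob hD).
    rewrite g3; apply (id_comp hE (id_hom hE (unit_ob hE))).
  - intros X X' Y Y' f g hf hg.
    destruct (hom_ob hC hf), (hom_ob hC hg).
    rewrite (f6 _ _ _ _ _ _ hf hg), !f2 by auto.
    apply (g6 _ _ _ _ _ _ (functor_hom f1 hf) (functor_hom f1 hg)).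
  - intros X Y hX hY; rewrite f7, !f2, g7 by auto; reflexivity.
Qed.

Lemma strict_inverse (C D : catData) (F : functorData C D) (G : functorData D C) :
  is_braided_category C -> is_braided_category D -> is_strict_functor F ->
  is_strict_functor G -> are_inverse F G -> is_inverse_braided_iso F G.
Proof.
  intros hC hD hF hG [f1 f2 o1 o2 m1 m2].
  split; [|split; [|split]]; try (apply strict_braided; auto).
  - assert (h := strict_functor_comp hC hD hC hF hG).
    constructor; simpl; auto.
    + intros X Y hX hY; etransitivity; [apply (strict_mu h hX hY)|]; simpl.
      rewrite !o1; auto.
    + apply (strict_eta h).
  - assert (h := strict_functor_comp hD hC hD hG hF).
    constructor; simpl; auto.
    + intros X Y hX hY; etransitivity; [apply (strict_mu h hX hY)|]; simpl.
      rewrite !o2; auto.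
    + apply (strict_eta h).
Qed.

Lemma functor_inverse (C D : catData) (F : functorData C D) X Y f g :
  is_functor F -> isob C X -> isob C Y -> is_inverse (C := C) X Y f g ->
  is_inverse (C := D) (fob F X) (fob F Y) (fmap F X Y f) (fmap F Y X g).
Proof.
  intros [f1 f2 f3 f4] hX hY (h1 & h2 & h3 & h4).
  split; [auto|split; [auto|]].
  rewrite <- (f4 _ _ _ _ _ h1 h2), <- (f4 _ _ _ _ _ h2 h1), h3, h4, !f3 by auto; auto.
Qed.

Lemma iso_comp (C : catData) X Y Z f g : is_braided_category C ->
  is_iso (C := C) X Y f -> is_iso (C := C) Y Z g -> is_iso (C := C) X Z (comp C g f).
Proof.
  intros hC [f' hf] [g' hg]; exists (comp C f' g'); exact (inverse_comp hC hf hg).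
Qed.

Lemma iso_hom (C : catData) X Y f : is_iso (C := C) X Y f -> hom C X Y f.
Proof. intros [g h]; apply h. Qed.

Lemma functor_iso (C D : catData) (F : functorData C D) X Y f :
  is_functor F -> isob C X -> isob C Y -> is_iso (C := C) X Y f ->
  is_iso (C := D) (fob F X) (fob F Y) (fmap F X Y f).
Proof.
  intros hF hX hY [g h]; exists (fmap F Y X g); apply functor_inverse; auto.
Qed.

(** Functoriality of the outer functor turns each law of the inner one into an
    equation of the last category, whose arrows [diag] then treats as boxes. *)
Lemma braided_functor_comp (C D E : catData) (F : functorData C D) (G : functorData D E) :
  is_braided_functor F -> is_braided_functor G -> is_braided_functor (functor_comp G F).
Proof.
  intros [hC hD f1 f2 f3 f4 f5 f6 f7 f8] [_ hE g1 g2 g3 g4 g5 g6 g7 g8].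
  assert (obF := functor_ob f1); assert (obG := functor_ob g1).
  assert (mF := functor_hom f1); assert (mG := functor_hom g1).
  assert (cG := functor_map_comp g1).
  assert (iF := fun X hX => id_hom hD (obF X hX)).
  assert (iG := fun X hX => id_hom hE (obG X hX)).
  assert (muF := fun X Y hX hY => iso_hom (f2 X Y hX hY)).
  assert (muG := fun X Y hX hY => iso_hom (g2 X Y hX hY)).
  assert (etaF := iso_hom f3); assert (etaG := iso_hom g3).
  assert (tC := tens_ob hC); assert (tD := tens_ob hD).
  assert (uC := unit_ob hC); assert (uD := unit_ob hD).
  constructor; auto; simpl.
  - apply functor_comp_functor; auto.
  - intros X Y hX hY; apply (iso_comp hE (g2 _ _ (obF _ hX) (obF _ hY))).
    apply functor_iso; auto.
  - apply (iso_comp hE g3); apply functor_iso; auto.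
  - intros X X' Y Y' f g hf hg.
    destruct (hom_ob hC hf) as [hX hX'], (hom_ob hC hg) as [hY hY'].
    assert (k1 := mF _ _ _ hf); assert (k2 := mF _ _ _ hg).
    assert (k3 := mF _ _ _ (tensm_hom hC hf hg)).
    assert (k4 := tensm_hom hD k1 k2).
    assert (e1 := g4 _ _ _ _ _ _ k1 k2).
    assert (e2 := cG _ _ _ _ _ k4 (muF _ _ hX' hY')).
    rewrite (f4 _ _ _ _ _ _ hf hg), (cG _ _ _ _ _ (muF _ _ hX hY) k3) in e2.
    assert (l1 := mG _ _ _ k1); assert (l2 := mG _ _ _ k2).
    assert (l3 := mG _ _ _ k3); assert (l4 := mG _ _ _ k4).
    assert (l5 := mG _ _ _ (muF _ _ hX' hY')); assert (l6 := mG _ _ _ (muF _ _ hX hY)).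
    assert (l7 := muG _ _ (obF _ hX) (obF _ hY)).
    assert (l8 := muG _ _ (obF _ hX') (obF _ hY')).
    assert (o1 := obG _ (obF _ hX)); assert (o2 := obG _ (obF _ hY)).
    assert (o3 := obG _ (obF _ hX')); assert (o4 := obG _ (obF _ hY')).
    diag with (e1, e2).
  - intros X Y Z hX hY hZ.
    assert (m1 := muF _ _ hX hY); assert (m2 := muF _ _ hY hZ).
    assert (m3 := muF _ _ (tC _ _ hX hY) hZ); assert (m4 := muF _ _ hX (tC _ _ hY hZ)).
    assert (e1 := g4 _ _ _ _ _ _ m1 (iF _ hZ)).
    assert (e2 := g4 _ _ _ _ _ _ (iF _ hX) m2).
    rewrite (functor_map_id g1) in e1, e2 by auto.
    assert (e3 := cG _ _ _ _ _ (tensm_hom hD m1 (iF _ hZ)) m3).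
    rewrite (f5 _ _ _ hX hY hZ) in e3.
    rewrite (tens_assoc hC hX hY hZ) in *.
    rewrite <- (tens_assoc hD (obF _ hX) (obF _ hY) (obF _ hZ)) in e3.
    rewrite (cG _ _ _ _ _ (tensm_hom hD (iF _ hX) m2) m4) in e3.
    assert (e4 := g5 _ _ _ (obF _ hX) (obF _ hY) (obF _ hZ)).
    assert (l1 := mG _ _ _ m1); assert (l2 := mG _ _ _ m2).
    assert (l3 := mG _ _ _ m3); assert (l4 := mG _ _ _ m4).
    assert (l5 := mG _ _ _ (tensm_hom hD m1 (iF _ hZ))).
    assert (l6 := mG _ _ _ (tensm_hom hD (iF _ hX) m2)).
    assert (n1 := muG _ _ (obF _ hX) (obF _ hY)); assert (n2 := muG _ _ (obF _ hY) (obF _ hZ)).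
    assert (n3 := muG _ _ (tD _ _ (obF _ hX) (obF _ hY)) (obF _ hZ)).
    assert (n4 := muG _ _ (obF _ hX) (tD _ _ (obF _ hY) (obF _ hZ))).
    assert (n5 := muG _ _ (obF _ (tC _ _ hX hY)) (obF _ hZ)).
    assert (n6 := muG _ _ (obF _ hX) (obF _ (tC _ _ hY hZ))).
    rewrite ?(tens_assoc hD (obF _ hX) (obF _ hY) (obF _ hZ)) in *.
    rewrite ?(tens_assoc hC hX hY hZ) in *.
    assert (o1 := obG _ (obF _ hX)); assert (o2 := obG _ (obF _ hY)).
    assert (o3 := obG _ (obF _ hZ)).
    diag with (e1, e2, e3, e4).
  - intros X hX.
    assert (m1 := muF _ _ uC hX).
    assert (e1 := g4 _ _ _ _ _ _ etaF (iF _ hX)).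
    rewrite (functor_map_id g1) in e1 by auto.
    assert (k := tensm_hom hD etaF (iF _ hX)).
    assert (e2 := cG _ _ _ _ _ k m1).
    rewrite (f6 _ hX) in e2.
    assert (e3 := g6 _ (obF _ hX)).
    assert (l1 := mG _ _ _ m1); assert (l2 := mG _ _ _ etaF); assert (l3 := mG _ _ _ k).
    assert (n1 := muG _ _ uD (obF _ hX)); assert (n2 := muG _ _ (obF _ uC) (obF _ hX)).
    rewrite (unit_tens hD) in * by auto; rewrite (unit_tens hC hX) in *.
    rewrite (functor_map_id g1) in e2 by auto.
    assert (o1 := obG _ (obF _ hX)).
    diag with (e1, e2, e3).
  - intros X hX.
    assert (m1 := muF _ _ hX uC).
    assert (e1 := g4 _ _ _ _ _ _ (iF _ hX) etaF).
    rewrite (functor_map_id g1) in e1 by auto.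
    assert (k := tensm_hom hD (iF _ hX) etaF).
    assert (e2 := cG _ _ _ _ _ k m1).
    rewrite (f7 _ hX) in e2.
    assert (e3 := g7 _ (obF _ hX)).
    assert (l1 := mG _ _ _ m1); assert (l2 := mG _ _ _ etaF); assert (l3 := mG _ _ _ k).
    assert (n1 := muG _ _ (obF _ hX) uD); assert (n2 := muG _ _ (obF _ hX) (obF _ uC)).
    rewrite (tens_unit hD) in * by auto; rewrite (tens_unit hC hX) in *.
    rewrite (functor_map_id g1) in e2 by auto.
    assert (o1 := obG _ (obF _ hX)).
    diag with (e1, e2, e3).
  - intros X Y hX hY.
    assert (m1 := muF _ _ hX hY); assert (m2 := muF _ _ hY hX).
    assert (k1 := mF _ _ _ (braid_hom hC hX hY)).
    assert (k2 := braid_hom hD (obF _ hX) (obF _ hY)).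
    assert (e1 := cG _ _ _ _ _ m1 k1).
    rewrite (f8 _ _ hX hY), (cG _ _ _ _ _ k2 m2) in e1.
    assert (e2 := g8 _ _ (obF _ hX) (obF _ hY)).
    assert (l1 := mG _ _ _ m1); assert (l2 := mG _ _ _ m2).
    assert (l3 := mG _ _ _ k1); assert (l4 := mG _ _ _ k2).
    assert (n1 := muG _ _ (obF _ hX) (obF _ hY)); assert (n2 := muG _ _ (obF _ hY) (obF _ hX)).
    assert (n3 := braid_hom hE (obG _ (obF _ hX)) (obG _ (obF _ hY))).
    assert (o1 := obG _ (obF _ hX)); assert (o2 := obG _ (obF _ hY)).
    diag with (e1, e2).
Qed.

(** * The isomorphism with modules over the factors *)

Section RestrictionIso.

Variable C : catData.
Local Notation "X ⊗ Y" := (tens C X Y) : ob_scope.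
Local Notation "f ⊗ g" := (tensm C f g) : mor_scope.
Local Notation "g ∘ f" := (comp C g f) : mor_scope.
Local Notation "𝟏" := (unit1 C) : ob_scope.
Local Notation id := (idm C).
Local Notation c := (braid C).
Local Notation cinv X Y := (inv (C := C) (tens C X Y) (tens C Y X) (braid C X Y)).
Local Open Scope mor_scope.
Hypothesis hC : is_braided_category C.
Variable A : hopfData C.
Hypothesis hA : is_hopf A.
Variable K : hopfData (YD A).
Hypothesis hK : is_hopf (C := YD A) K.
Local Notation a := (hcar A).
Local Notation k := (ycar (hcar K)).
Local Notation H := (biproduct K).
Let hH : is_hopf H := biproduct_hopf hC hA hK.
Let split := biproduct_splitting hC hA hK.

Lemma restriction_strict : is_strict_functor (biproduct_restriction K).
Proof.
  constructor; try (intros; reflexivity).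
  - constructor; try (intros; reflexivity).
    + intros X hX; exact (restrict_yd hC hH hA hK split hX).
    + intros X Y f hf; exact (restrict_morphism hC hH hA hK split hf).
  - intros X Y hX hY; exact (restrict_tens hC hH hA hK split hX hY).
  - exact (restrict_unit hC hH hA hK split).
  - intros X Y hX hY; exact (restrict_braid hC hH hA hK split hX hY).
Qed.

Definition biproduct_extension : functorData (YD K) (YD H) :=
  FunctorData (C := YD K) (D := YD H) (extension_ob K) (fun _ _ f => f)
    (fun X Y : ob (YD K) => id (ycar (ycar X) ⊗ ycar (ycar Y))) (id 𝟏).

Lemma extension_restriction X : is_yd H X -> extension_ob K (fob (biproduct_restriction K) X) = X.
Proof.
  intros hX; assert (hH' := hH); assert (e := identity_factors hC hA hK).
  assert (e1 := yd_act_mul hX); assert (e2 := yd_coact_comul hX).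
  assert (j_hom : hom C k (hcar H) (id k ⊗ hone A)) by (cbn [biproduct hcar]; typed).
  assert (i_hom : hom C a (hcar H) (hone K ⊗ id a)) by (cbn [biproduct hcar]; typed).
  assert (r_hom : hom C (hcar H) k (id k ⊗ hcounit A)) by (cbn [biproduct hcar]; typed).
  assert (p_hom : hom C (hcar H) a (hcounit K ⊗ id a)) by (cbn [biproduct hcar]; typed).
  apply ydData_eq; cbn [extension_ob biproduct_restriction fob ycar yact ycoact]; auto.
  - etransitivity; [exact (restrict_act hC hH hA hK split hX)|].
    rewrite (biproduct_mul_ji hC hA hK); change (id (k ⊗ a)%ob) with (id (hcar H)); diag.
  - etransitivity; [exact (restrict_coact hC hH hA hK split hX)|].
    assert (e3 : ((id k ⊗ hcounit A) ⊗ (hcounit K ⊗ id a)) ∘ hcomul H = id (hcar H)).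
    { transitivity (hmul H ∘ ((id k ⊗ hone A) ⊗ (hone K ⊗ id a)) ∘
          (((id k ⊗ hcounit A) ⊗ (hcounit K ⊗ id a)) ∘ hcomul H)).
        - rewrite (biproduct_mul_ji hC hA hK); cbn [biproduct hcar hcomul]; diag.
        - refine (eq_trans _ e); cbn [biproduct hcar hcomul hmul]; diag. }
    rewrite e3; diag.
Qed.

Lemma restriction_extension Z : is_yd (C := YD A) K Z ->
  fob (biproduct_restriction K) (extension_ob K Z) = Z.
Proof.
  intros hZ.
  assert (hZ0 : is_yd A (ycar Z)) by exact (yd_ob hZ).
  assert (hκ : hom C (k ⊗ ycar (ycar Z)) (ycar (ycar Z)) (yact Z))
    by exact (yd_morphism_hom (yd_act_hom hZ)).
  assert (hχ : hom C (ycar (ycar Z)) (k ⊗ ycar (ycar Z)) (ycoact Z))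
    by exact (yd_morphism_hom (yd_coact_hom hZ)).
  apply (ydData_eq (C := YD A)); [apply ydData_eq | |];
    cbn [extension_ob biproduct_restriction fob ycar yact ycoact]; auto.
  - diag with (yd_act_one hZ).
  - diag with (yd_coact_counit hZ).
  - diag with (yd_act_one hZ0).
  - diag with (yd_coact_counit hZ0).
Qed.

(** Strictness carries over from the restriction functor, to which extension is
    inverse on objects. *)
Lemma extension_strict : is_strict_functor biproduct_extension.
Proof.
  assert (hext := extension_yd hC hA hK).
  constructor; try (intros; reflexivity).
  - constructor; try (intros; reflexivity).
    + exact hext.
    + intros X Y f hf; assert (hX := yd_morphism_dom hf); assert (hY := yd_morphism_cod hf).
      assert (hX0 : is_yd A (ycar X)) by exact (yd_ob hX).
      assert (hY0 : is_yd A (ycar Y)) by exact (yd_ob hY).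
      assert (hκ : hom C (k ⊗ ycar (ycar X)) (ycar (ycar X)) (yact X))
        by exact (yd_morphism_hom (yd_act_hom hX)).
      assert (hχ : hom C (ycar (ycar X)) (k ⊗ ycar (ycar X)) (ycoact X))
        by exact (yd_morphism_hom (yd_coact_hom hX)).
      assert (hκ' : hom C (k ⊗ ycar (ycar Y)) (ycar (ycar Y)) (yact Y))
        by exact (yd_morphism_hom (yd_act_hom hY)).
      assert (hχ' : hom C (ycar (ycar Y)) (k ⊗ ycar (ycar Y)) (ycoact Y))
        by exact (yd_morphism_hom (yd_coact_hom hY)).
      assert (e1 := yd_morphism_act hf); assert (e2 := yd_morphism_coact hf).
      assert (hf0 : is_yd_morphism A (ycar X) (ycar Y) f) by exact (yd_morphism_hom hf).
      assert (e3 := yd_morphism_act hf0); assert (e4 := yd_morphism_coact hf0).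
      assert (hf1 : hom C (ycar (ycar X)) (ycar (ycar Y)) f) by exact (yd_morphism_hom hf0).
      cbn [biproduct_extension fmap fob].
      constructor; [exact (hext _ hX) | exact (hext _ hY) | exact hf1 | |];
        cbn [extension_ob ycar yact ycoact biproduct hcar].
      * diag with (e1, e3).
      * diag with (e2, e4).
  - intros X Y hX hY; cbn [biproduct_extension fob].
    assert (hXY := yd_tens_yd (yd_braided_category hC hA) hK hX hY).
    rewrite <- (restriction_extension hX), <- (restriction_extension hY) at 1.
    transitivity (extension_ob K (fob (biproduct_restriction K) (tens (YD H) (extension_ob K X)
      (extension_ob K Y)))).
    + f_equal; symmetry; apply (strict_tens restriction_strict); apply hext; auto.
    + apply extension_restriction; apply (yd_tens_yd hC hH); auto.
  - cbn [biproduct_extension fob].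
    transitivity (extension_ob K (fob (biproduct_restriction K) (yd_unit H))).
    + f_equal; symmetry; exact (strict_unit restriction_strict).
    + apply extension_restriction; apply (yd_unit_yd hC hH).
  - intros X Y hX hY; cbn [biproduct_extension fob fmap].
    rewrite <- (restriction_extension hX), <- (restriction_extension hY) at 1.
    symmetry; apply (strict_braid restriction_strict (hext _ hX) (hext _ hY)).
Qed.

Lemma restriction_inverse : are_inverse (biproduct_restriction K) biproduct_extension.
Proof.
  constructor; try (intros; reflexivity).
  - exact (strict_functor restriction_strict).
  - exact (strict_functor extension_strict).
  - exact extension_restriction.
  - exact restriction_extension.
Qed.

End RestrictionIso.

(** * Transport along isomorphisms of Hopf algebras *)

Section Transport.

Variable C : catData.
Hypothesis hC : is_braided_category C.
Lemma hopf_iso_inverse (H' H : hopfData C) phi psi : is_hopf H' -> is_hopf H ->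
  is_hopf_morphism H' H phi -> is_inverse (C := C) (hcar H') (hcar H) phi psi ->
  is_hopf_morphism H H' psi.
Proof.
  intros hH' hH [h1 h2 h3 h4 h5] (_ & i2 & i3 & i4).
  constructor; auto.
  - transitivity (psi ∘ hmul H ∘ ((phi ∘ psi) ⊗ (phi ∘ psi))); [diag with i4 | diag with (h2, i3)].
  - rewrite <- h3; diag with i3.
  - transitivity (((psi ∘ phi) ⊗ (psi ∘ phi)) ∘ hcomul H' ∘ psi); [diag with i3 | diag with (h4,
      i4)].
  - rewrite <- h5; diag with i4.
Qed.

Section Strict.

Variables (H' H : hopfData C) (phi : mor C).
Hypothesis hH' : is_hopf H'.
Hypothesis hH : is_hopf H.
Hypothesis hphi : is_hopf_iso H' H phi.

Let psi := inv (hcar H') (hcar H) phi.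
Let inverse : is_inverse (C := C) (hcar H') (hcar H) phi psi := inv_spec (proj2 hphi).
Let phi_morphism : is_hopf_morphism H' H phi := proj1 hphi.
Let psi_morphism : is_hopf_morphism H H' psi := hopf_iso_inverse hH' hH phi_morphism inverse.
Let psi_phi : psi ∘ phi = id (hcar H') := proj1 (proj2 (proj2 inverse)).

Lemma transport_strict : is_strict_functor (yd_transport H' H phi).
Proof.
  constructor; try (intros; reflexivity).
  - constructor; try (intros; reflexivity).
    + intros X hX; exact (restrict_base_yd hC hH hH' phi_morphism psi_morphism psi_phi hX).
    + intros X Y f hf; exact (restrict_base_morphism hC hH hH' phi_morphism psi_morphism psi_phi
        hf).
  - intros X Y hX hY; exact (restrict_base_tens hC hH hH' phi_morphism psi_morphism hX hY).
  - exact (restrict_base_unit hC hH hH' phi_morphism psi_morphism).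
  - intros X Y hX hY; cbn [yd_transport fmap fob YD braid] in *; unfold yd_braid;
      cbn [ycar yact ycoact].
    fold psi; assert (hX' : is_yd H X) by exact hX; assert (hY' : is_yd H Y) by exact hY.
    assert (h1 := hopf_morphism_hom phi_morphism); assert (h2 := hopf_morphism_hom psi_morphism).
    transitivity ((yact Y ⊗ id (ycar X)) ∘ ((phi ∘ psi) ⊗ c (ycar X) (ycar Y)) ∘
      (ycoact X ⊗ id (ycar Y))); [|diag].
    rewrite (proj2 (proj2 (proj2 inverse))); diag.
Qed.

End Strict.

Lemma transport_inverse (H' H : hopfData C) phi : is_hopf H' -> is_hopf H ->
  is_hopf_iso H' H phi ->
  is_strict_functor (yd_transport H H' (inv (hcar H') (hcar H) phi)) /\
  are_inverse (yd_transport H' H phi) (yd_transport H H' (inv (hcar H') (hcar H) phi)).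
Proof.
  intros hH' hH hphi; assert (h := inv_spec (proj2 hphi)).
  set (psi := inv (hcar H') (hcar H) phi) in *.
  assert (hpsi : is_hopf_iso H H' psi).
  { split; [exact (hopf_iso_inverse hH' hH (proj1 hphi) h)|].
    exists phi; apply inverse_sym; exact h. }
  assert (e : inv (hcar H) (hcar H') psi = phi) by (apply (inv_eq hC); apply inverse_sym; exact h).
  assert (s := transport_strict hH' hH hphi); assert (s' := transport_strict hH hH' hpsi).
  split; [exact s'|].
  destruct h as (h1 & h2 & h3 & h4).
  constructor; try (intros; reflexivity); try apply strict_functor; auto.
  - intros X hX; assert (hX' : is_yd H X) by exact hX.
    apply ydData_eq; cbn [yd_transport fob ycar yact ycoact]; auto; rewrite ?e; fold psi.
    + diag with h4.
    + diag with h4.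
  - intros X hX; assert (hX' : is_yd H' X) by exact hX.
    apply ydData_eq; cbn [yd_transport fob ycar yact ycoact]; auto; rewrite ?e; fold psi.
    + diag with h3.
    + diag with h3.
Qed.

End Transport.

(** * The projection theorem *)
Section Radford.

Variable C : catData.
Hypothesis hC : is_braided_category C.
Variables (H A : hopfData C) (i π : mor C).
Hypothesis hH : is_hopf H.
Hypothesis hA : is_hopf A.
Hypothesis hi : is_hopf_morphism A H i.
Hypothesis hπ : is_hopf_morphism H A π.
Hypothesis πi : π ∘ i = id (hcar A).
Local Notation h := (hcar H).
Local Notation a := (hcar A).
Local Notation μ := (hmul H).
Local Notation Δ := (hcomul H).
Local Notation η := (hone H).
Local Notation ε := (hcounit H).
Local Notation S := (hanti H).

Let i_hom : hom C a h i := hopf_morphism_hom hi.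
Let π_hom : hom C h a π := hopf_morphism_hom hπ.
Let i_mul := hopf_morphism_mul hi.
Let i_one := hopf_morphism_one hi.
Let i_comul := hopf_morphism_comul hi.
Let i_counit := hopf_morphism_counit hi.
Let π_mul := hopf_morphism_mul hπ.
Let π_one := hopf_morphism_one hπ.
Let π_comul := hopf_morphism_comul hπ.
Let π_counit := hopf_morphism_counit hπ.

(** In Sweedler notation [x ↦ x_(1) i(S(π(x_(2))))].  This is an idempotent whose image
    consists of the coinvariants of [π] ([projection_coinvariant],
    [projection_fixes]), so that the equalizer splits it. *)
Definition coinvariant_projection : mor C := μ ∘ (id h ⊗ (i ∘ hanti A ∘ π)) ∘ Δ.
Local Notation e := coinvariant_projection.

Lemma projection_hom : hom C h h e.
Proof. unfold coinvariant_projection; typed. Qed.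

(** Coinvariance: the coproducts of [i(S(π(x)))] and of [x] produce in [A] a product of an
    element and its antipode, which cancels. *)
Lemma projection_coinvariant : (id h ⊗ π) ∘ Δ ∘ e = (id h ⊗ hone A) ∘ e.
Proof.
  unfold coinvariant_projection.
  transitivity ((μ ⊗ hmul A) ∘ (id h ⊗ c a h ⊗ id a) ∘
    (((id h ⊗ π) ∘ Δ) ⊗ ((i ⊗ id a) ∘ c a a ∘ (hanti A ⊗ hanti A) ∘ hcomul A ∘ π)) ∘ Δ).
  - diag with (hopf_comul_mul hH, i_comul, anti_comul hC hA, π_mul, πi).
  - transitivity ((μ ⊗ id a) ∘ (id h ⊗ c a h) ∘ (id h ⊗ (hmul A ∘ (id a ⊗ hanti A) ∘ hcomul A) ⊗
      (i ∘ hanti A)) ∘ (id h ⊗ hcomul A) ∘ (id h ⊗ π) ∘ Δ).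
    + diag with (π_comul, hopf_comul_assoc hH, hopf_comul_assoc hA).
    + rewrite (hopf_anti_r hA). diag with (hopf_counit_comul hA).
Qed.
Lemma projection_fixes V f : hom C V h f -> (id h ⊗ π) ∘ Δ ∘ f = (id h ⊗ hone A) ∘ f -> e ∘ f = f.
Proof.
  intros hf ef; unfold coinvariant_projection.
  diag with (ef, anti_one hC hA, i_one, hopf_mul_one hH).
Qed.

Lemma projection_i : e ∘ μ ∘ (id h ⊗ i) = e ⊗ hcounit A.
Proof.
  unfold coinvariant_projection.
  transitivity (μ ∘ (μ ⊗ id h) ∘ (id h ⊗ i ⊗ (i ∘ hanti A ∘ hmul A)) ∘ (id h ⊗ id a ⊗ π ⊗ id a)
    ∘ (id h ⊗ c h a ⊗ id a) ∘ (Δ ⊗ hcomul A)).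
  - diag with (hopf_comul_mul hH, i_comul, π_mul, πi).
  - transitivity (μ ∘ (μ ⊗ id h) ∘ (id h ⊗ (i ∘ (hmul A ∘ (id a ⊗ hanti A) ∘ hcomul A)) ⊗
      (i ∘ hanti A ∘ π)) ∘ (id h ⊗ c h a) ∘ (Δ ⊗ id a)).
    + diag with (anti_mul hC hA, i_mul, hopf_mul_assoc hH).
    + rewrite (hopf_anti_r hA). diag with (i_one, hopf_mul_one hH).
Qed.
(** Every [x] is [e(x_(1)) i(π(x_(2)))]: hence [H] is a product of coinvariants and of
    [A]. *)
Lemma projection_factor : μ ∘ (e ⊗ (i ∘ π)) ∘ Δ = id h.
Proof.
  unfold coinvariant_projection.
  diag with (hopf_mul_assoc hH, hopf_comul_assoc hH, i_mul, π_comul, hopf_anti_l hA, i_one,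
    hopf_mul_one hH, π_counit, hopf_comul_counit hH).
Qed.

Section Coinvariants.

Let e_hom : hom C h h e := projection_hom.
Variables (k : ob C) (j r : mor C).
Hypothesis j_hom : hom C k h j.
Hypothesis r_hom : hom C h k r.
Hypothesis jr : j ∘ r = e.
Hypothesis rj : r ∘ j = id k.
Hypothesis j_coinvariant : (id h ⊗ π) ∘ Δ ∘ j = (id h ⊗ hone A) ∘ j.

Lemma j_mono V f g : hom C V k f -> hom C V k g -> j ∘ f = j ∘ g -> f = g.
Proof.
  intros hf hg E; rewrite <- (id_comp hC hf), <- (id_comp hC hg), <- rj.
  rewrite <- (comp_assoc hC hf j_hom r_hom), <- (comp_assoc hC hg j_hom r_hom), E; auto.
Qed.

Lemma r_epi V f g : hom C k V f -> hom C k V g -> f ∘ r = g ∘ r -> f = g.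
Proof.
  intros hf hg E; rewrite <- (comp_id hC hf), <- (comp_id hC hg), <- rj.
  rewrite (comp_assoc hC j_hom r_hom hf), (comp_assoc hC j_hom r_hom hg), E; auto.
Qed.

Lemma r_mul_i : r ∘ μ ∘ (id h ⊗ i) = r ⊗ hcounit A.
Proof.
  apply (j_mono (V := (h ⊗ a)%ob)); try typed.
  transitivity (e ∘ μ ∘ (id h ⊗ i)); [diag with jr | rewrite projection_i; diag with jr].
Qed.

Lemma retraction_factor : μ ∘ ((j ∘ r) ⊗ (i ∘ π)) ∘ Δ = id h.
Proof. rewrite jr; exact projection_factor. Qed.

(** Equations between maps into [k] are proved after composition with [j], and those
    between maps out of [k] after composition with [r]; this lemma tells which maps
    into [h] come from [k]. *)
Lemma retraction_fixes V f : hom C V h f -> (id h ⊗ π) ∘ Δ ∘ f = (id h ⊗ hone A) ∘ f -> j ∘ r ∘ f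
  = f.
Proof. intros hf E; rewrite jr; apply (projection_fixes hf E). Qed.

Lemma jr_mul : j ∘ r ∘ μ ∘ (j ⊗ id h) = μ ∘ (j ⊗ (j ∘ r)).
Proof.
  transitivity (j ∘ r ∘ μ ∘ (j ⊗ (μ ∘ ((j ∘ r) ⊗ (i ∘ π)) ∘ Δ))).
  - rewrite retraction_factor; diag.
  - transitivity (j ∘ r ∘ (μ ∘ (j ⊗ (j ∘ r)))).
    + diag with (r_mul_i, hopf_mul_assoc hH, π_counit, hopf_comul_counit hH).
    + apply (retraction_fixes (V := (k ⊗ h)%ob)); [typed|].
      diag with (hopf_comul_mul hH, π_mul, j_coinvariant, hopf_one_mul hA).
Qed.

(** [A] acts on the coinvariants by multiplication in [H] followed by the retraction,
    which amounts to the adjoint action, and it coacts by [π] on the first leg of the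
    coproduct. *)
Definition coinvariants : ydData C :=
  YDData k (r ∘ μ ∘ (i ⊗ j)) ((π ⊗ r) ∘ Δ ∘ j).
Local Notation ρ := (yact coinvariants).
Local Notation δ := (ycoact coinvariants).

Definition coinvariant_hopf : hopfData (YD A) := {|
  hcar := coinvariants : ob (YD A);
  hmul := r ∘ μ ∘ (j ⊗ j);
  hone := r ∘ η;
  hcomul := (r ⊗ r) ∘ Δ ∘ j;
  hcounit := ε ∘ j;
  hanti := r ∘ μ ∘ ((i ∘ π) ⊗ S) ∘ Δ ∘ j
|}.
Local Notation K := coinvariant_hopf.

Lemma j_mul : j ∘ (r ∘ μ ∘ (j ⊗ j)) = μ ∘ (j ⊗ j).
Proof.
  transitivity ((j ∘ r ∘ μ ∘ (j ⊗ id h)) ∘ (id k ⊗ j)); [diag | rewrite jr_mul; diag with rj].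
Qed.

Lemma j_one : j ∘ (r ∘ η) = η.
Proof.
  transitivity (j ∘ r ∘ η); [diag | apply (retraction_fixes (V := 𝟏)); [typed|]].
  diag with (hopf_comul_one hH, π_one).
Qed.

(** The retraction is a morphism of coalgebras, as [j] is one of algebras. *)
Lemma r_comul : ((r ⊗ r) ∘ Δ ∘ j) ∘ r = (r ⊗ r) ∘ Δ.
Proof.
  transitivity ((r ⊗ r) ∘ Δ ∘ e); [diag with jr|].
  unfold coinvariant_projection.
  transitivity (((r ∘ μ ∘ (id h ⊗ i)) ⊗ (r ∘ μ ∘ (id h ⊗ i))) ∘ (id h ⊗ c h a ⊗ id a) ∘
    (Δ ⊗ (c a a ∘ (hanti A ⊗ hanti A) ∘ hcomul A ∘ π)) ∘ Δ).
  - diag with (hopf_comul_mul hH, i_comul, anti_comul hC hA).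
  - rewrite r_mul_i.
    diag with (counit_anti hC hA, hopf_comul_counit hA, π_counit, hopf_comul_counit hH).
Qed.
Lemma r_counit : (ε ∘ j) ∘ r = ε.
Proof.
  transitivity (ε ∘ e); [diag with jr|].
  unfold coinvariant_projection.
  diag with (hopf_counit_mul hH, i_counit, counit_anti hC hA, π_counit, hopf_comul_counit hH).
Qed.

Lemma r_i_mul : r ∘ μ ∘ (i ⊗ id h) = ρ ∘ (id a ⊗ r).
Proof.
  transitivity (r ∘ μ ∘ (i ⊗ (μ ∘ ((j ∘ r) ⊗ (i ∘ π)) ∘ Δ))).
  - rewrite retraction_factor; diag.
  - cbn [coinvariants yact].
    diag with (r_mul_i, hopf_mul_assoc hH, π_counit, hopf_comul_counit hH).
Qed.

(** [(π ⊗ id) ∘ Δ] maps the coinvariants to themselves, so that the retraction in the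
    definition of the coaction is invisible. *)
Lemma coaction_j : (id a ⊗ j) ∘ δ = (π ⊗ id h) ∘ Δ ∘ j.
Proof.
  cbn [coinvariants ycoact].
  transitivity ((π ⊗ e) ∘ Δ ∘ j); [diag with jr|].
  unfold coinvariant_projection.
  diag with (hopf_comul_assoc hH, j_coinvariant, anti_one hC hA, i_one, hopf_mul_one hH).
Qed.

(** The exchange of [A] with the coinvariants in [H] is that of the biproduct. *)
Lemma coinvariant_mul_ij : μ ∘ (i ⊗ j) = μ ∘ ((j ∘ ρ) ⊗ i) ∘ (id a ⊗ c a k) ∘ (hcomul A ⊗ id k).
Proof.
  transitivity ((μ ∘ ((j ∘ r) ⊗ (i ∘ π)) ∘ Δ) ∘ μ ∘ (i ⊗ j)).
  - rewrite retraction_factor; diag.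
  - cbn [coinvariants yact].
    diag with (hopf_comul_mul hH, i_comul, π_mul, πi, j_coinvariant, hopf_mul_one hA).
Qed.

(** The relation dual to [coinvariant_mul_ij]. *)
Lemma comul_πr : (π ⊗ r) ∘ Δ = (hmul A ⊗ id k) ∘ (id a ⊗ c k a) ∘ ((δ ∘ r) ⊗ π) ∘ Δ.
Proof.
  transitivity ((π ⊗ r) ∘ Δ ∘ (μ ∘ ((j ∘ r) ⊗ (i ∘ π)) ∘ Δ)).
  - rewrite retraction_factor; diag.
  - cbn [coinvariants ycoact].
    diag with (hopf_comul_mul hH, i_comul, π_mul, πi, r_mul_i, π_comul, hopf_comul_counit hA).
Qed.

Lemma j_mono_l W V f g : isob C W -> hom C V (W ⊗ k) f -> hom C V (W ⊗ k) g ->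
  (id W ⊗ j) ∘ f = (id W ⊗ j) ∘ g -> f = g.
Proof.
  intros hW hf hg E; transitivity ((id W ⊗ r) ∘ ((id W ⊗ j) ∘ f)); [diag with rj|].
  rewrite E; diag with rj.
Qed.

Lemma r_epi_l W V f g : isob C W -> hom C (W ⊗ k) V f -> hom C (W ⊗ k) V g ->
  f ∘ (id W ⊗ r) = g ∘ (id W ⊗ r) -> f = g.
Proof.
  intros hW hf hg E; transitivity (f ∘ (id W ⊗ r) ∘ (id W ⊗ j)); [diag with rj|].
  rewrite E; diag with rj.
Qed.

Lemma r_j_mul : r ∘ μ ∘ (j ⊗ id h) = (r ∘ μ ∘ (j ⊗ j)) ∘ (id k ⊗ r).
Proof.
  apply (j_mono (V := (k ⊗ h)%ob)); try typed.
  transitivity (j ∘ r ∘ μ ∘ (j ⊗ id h)); [diag|].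
  rewrite jr_mul; diag with j_mul.
Qed.

Lemma comul_jr : (id h ⊗ (j ∘ r)) ∘ Δ ∘ j = Δ ∘ j.
Proof.
  transitivity ((id h ⊗ e) ∘ Δ ∘ j); [diag with jr|]; unfold coinvariant_projection.
  diag with (hopf_comul_assoc hH, j_coinvariant, anti_one hC hA, i_one, hopf_mul_one hH).
Qed.

Lemma comul_j : Δ ∘ j = ((μ ∘ (j ⊗ i)) ⊗ j) ∘ (id k ⊗ δ) ∘ ((r ⊗ r) ∘ Δ ∘ j).
Proof.
  transitivity ((μ ⊗ id h) ∘ (j ⊗ i ⊗ id h) ∘ (id k ⊗ ((id a ⊗ j) ∘ δ)) ∘ ((r ⊗ r) ∘ Δ ∘ j)).
  - rewrite coaction_j.
    transitivity (((μ ∘ ((j ∘ r) ⊗ (i ∘ π)) ∘ Δ) ⊗ id h) ∘ (id h ⊗ (j ∘ r)) ∘ Δ ∘ j).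
    + rewrite retraction_factor; diag with comul_jr.
    + diag with (hopf_comul_assoc hH, comul_jr).
  - cbn [coinvariants ycoact]; diag.
Qed.

Lemma action_hom : hom C (a ⊗ k) k ρ.
Proof. cbn [coinvariants yact]; typed. Qed.
Lemma coaction_hom : hom C k (a ⊗ k) δ.
Proof. cbn [coinvariants ycoact]; typed. Qed.

(** The associativity of the action comes from that of [H] through [r_i_mul], that of
    the coaction through [coaction_j], and compatibility from [comul_πr]. *)
Lemma coinvariants_yd : is_yd A coinvariants.
Proof.
  assert (h1 := action_hom); assert (h2 := coaction_hom).
  assert (e1 := r_i_mul); assert (e2 := coaction_j).
  assert (e3 : ρ = r ∘ μ ∘ (i ⊗ j)) by reflexivity.
  assert (e4 : δ = (π ⊗ r) ∘ Δ ∘ j) by reflexivity.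
  assert (e5 := comul_πr).
  constructor; auto.
  - exact (proj1 (hom_ob hC j_hom)).
  - change (ycar coinvariants) with k.
    transitivity (ρ ∘ (id a ⊗ r) ∘ (hmul A ⊗ j)); [diag with rj|].
    rewrite <- e1; diag with (e1, i_mul, hopf_mul_assoc hH, rj).
  - change (ycar coinvariants) with k.
    rewrite e3; diag with (i_one, hopf_one_mul hH, rj).
  - change (ycar coinvariants) with k.
    apply (j_mono_l (W := (a ⊗ a)%ob) (V := k)); try typed.
    diag with (e2, π_comul, hopf_comul_assoc hH).
  - change (ycar coinvariants) with k.
    rewrite e4; diag with (π_counit, hopf_counit_comul hH, rj).
  - change (ycar coinvariants) with k.
    transitivity ((π ⊗ r) ∘ Δ ∘ μ ∘ (i ⊗ j)).
    + transitivity ((hmul A ⊗ (r ∘ μ ∘ (i ⊗ id h))) ∘ (id a ⊗ c a a ⊗ id h)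
       ∘ (hcomul A ⊗ ((π ⊗ id h) ∘ Δ ∘ j))); [rewrite e1, e4; diag|].
      diag with (hopf_comul_mul hH, i_comul, π_mul, πi).
    + rewrite e5.
      diag with (hopf_comul_mul hH, i_comul, π_mul, πi, j_coinvariant, hopf_mul_one hA, e3).
Qed.

Let k_yd : is_yd A coinvariants := coinvariants_yd.
Let act_hom : hom C (a ⊗ k) k ρ := action_hom.
Let coact_hom : hom C k (a ⊗ k) δ := coaction_hom.
Local Notation mk := (r ∘ μ ∘ (j ⊗ j)).
Local Notation Dk := ((r ⊗ r) ∘ Δ ∘ j).

Lemma r_one_counit : (ε ∘ j) ∘ (r ∘ η) = id 𝟏.
Proof. diag with (j_one, hopf_counit_one hH). Qed.

Lemma coinvariant_mul_morphism :
  is_yd_morphism A (yd_tens A coinvariants coinvariants) coinvariants mk.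
Proof.
  constructor; auto; [apply yd_tens_yd; auto | | |]; cbn [yd_tens ycar yact ycoact];
    change (ycar coinvariants) with k; try typed.
  - symmetry; transitivity (ρ ∘ (id a ⊗ r) ∘ (id a ⊗ (μ ∘ (j ⊗ j)))); [diag|].
    rewrite <- r_i_mul.
    transitivity ((r ∘ μ ∘ (id h ⊗ i)) ∘ (μ ⊗ id a) ∘
      ((j ∘ ρ) ⊗ (j ∘ ρ) ⊗ id a) ∘ (id a ⊗ c a k ⊗ c a k) ∘ (id (a ⊗ a) ⊗ c a k ⊗ id k) ∘
       (((hcomul A ⊗ id a) ∘ hcomul A) ⊗ id (k ⊗ k))).
    + diag with (coinvariant_mul_ij, hopf_mul_assoc hH, hopf_comul_assoc hA).
    + rewrite r_mul_i; diag with (hopf_comul_counit hA).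
  - apply (j_mono_l (W := a) (V := (k ⊗ k)%ob)); try typed.
    diag with (coaction_j, j_mul, hopf_comul_mul hH, π_mul).
Qed.

Lemma coinvariant_one_morphism :
  is_yd_morphism A (yd_unit A) coinvariants (r ∘ η).
Proof.
  constructor; auto; [apply yd_unit_yd; auto | | |]; cbn [yd_unit ycar yact ycoact];
    change (ycar coinvariants) with k; try typed.
  - cbn [coinvariants yact]. diag with (j_one, hopf_mul_one hH, i_counit, r_mul_i, hopf_one_mul hH).
  - cbn [coinvariants ycoact]. diag with (j_one, hopf_comul_one hH, π_one).
Qed.

Lemma coinvariant_comul_morphism :
  is_yd_morphism A coinvariants (yd_tens A coinvariants coinvariants) Dk.
Proof.
  constructor; auto; [apply yd_tens_yd; auto | | |]; cbn [yd_tens ycar yact ycoact];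
    change (ycar coinvariants) with k; try typed.
  - apply (r_epi_l (W := a) (V := (k ⊗ k)%ob)); try typed.
    diag with (r_i_mul, r_comul, hopf_comul_mul hH, i_comul).
  - transitivity ((hmul A ⊗ id (k ⊗ k)) ∘ (id a ⊗ c k a ⊗ id k) ∘ ((δ ∘ r) ⊗ ((π ⊗ r) ∘ Δ)) ∘ Δ
      ∘ j).
    + rewrite comul_πr.
      diag with (hopf_comul_assoc hH, j_coinvariant, hopf_mul_one hA).
    + transitivity ((((hmul A ⊗ id k) ∘ (id a ⊗ c k a) ∘ ((δ ∘ r) ⊗ π) ∘ Δ) ⊗ r) ∘ Δ ∘ j).
      * diag with (hopf_comul_assoc hH).
      * rewrite <- comul_πr; cbn [coinvariants ycoact]. diag with (hopf_comul_assoc hH, r_comul).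
Qed.

Lemma π_j : π ∘ j = hone A ∘ (ε ∘ j).
Proof.
  transitivity ((ε ⊗ id a) ∘ ((id h ⊗ π) ∘ Δ ∘ j)); [diag with (hopf_counit_comul hH)|].
  rewrite j_coinvariant; diag.
Qed.

Lemma coinvariant_counit_morphism :
  is_yd_morphism A coinvariants (yd_unit A) (ε ∘ j).
Proof.
  constructor; auto; [apply yd_unit_yd; auto | | |]; cbn [yd_unit ycar yact ycoact];
    change (ycar coinvariants) with k; try typed.
  - cbn [coinvariants yact]. diag with (r_counit, hopf_counit_mul hH, i_counit).
  - cbn [coinvariants ycoact]. diag with (r_counit, π_j, hopf_comul_counit hH).
Qed.

Lemma coinvariant_comul_mul : Dk ∘ mk =
  (mk ⊗ mk) ∘ (id k ⊗ yd_braid A coinvariants coinvariants ⊗ id k) ∘ (Dk ⊗ Dk).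
Proof.
  unfold yd_braid; change (ycar coinvariants) with k.
  transitivity (((r ∘ μ) ⊗ (r ∘ μ)) ∘ (id h ⊗ c h h ⊗ id h) ∘ ((Δ ∘ j) ⊗ (Δ ∘ j))).
  - diag with (r_comul, hopf_comul_mul hH).
  - rewrite comul_j at 1.
    transitivity (((r ∘ μ ∘ (j ⊗ id h)) ⊗ (r ∘ μ ∘ (j ⊗ id h))) ∘ (id k ⊗ (μ
      ∘ (i ⊗ id h)) ⊗ id (k ⊗ h))
     ∘ (id (k ⊗ a) ⊗ c k h ⊗ id h) ∘ (id k ⊗ δ ⊗ id (h ⊗ h)) ∘ (Dk ⊗ (Δ ∘ j))).
    + diag with (hopf_mul_assoc hH).
    + rewrite r_j_mul. diag with r_i_mul.
Qed.

(** In Sweedler notation [x ↦ i(π(x_(1))) S(x_(2))]; restricted to the coinvariants this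
    is their antipode, which is not the antipode of [H]. *)
Definition twisted_anti : mor C := μ ∘ ((i ∘ π) ⊗ S) ∘ Δ.
Local Notation f := twisted_anti.
Local Notation sk := (r ∘ f ∘ j).
Local Notation Si := (inv h h S).

Lemma twisted_anti_hom : hom C h h f.
Proof. unfold twisted_anti; typed. Qed.
Let f_hom : hom C h h f := twisted_anti_hom.

Let i_anti : i ∘ hanti A = S ∘ i := hopf_morphism_anti hC hA hH hi.
Let π_anti : π ∘ S = hanti A ∘ π := hopf_morphism_anti hC hH hA hπ.

Lemma twisted_anti_mul_i : f ∘ μ ∘ (id h ⊗ i) = f ⊗ hcounit A.
Proof.
  unfold twisted_anti.
  transitivity (μ ∘ (μ ⊗ id h) ∘ ((i ∘ π) ⊗ (i ∘ (hmul A ∘ (id a ⊗ hanti A) ∘ hcomul A)) ⊗ S)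
    ∘ (id h ⊗ c h a) ∘ (Δ ⊗ id a)).
  - diag with (hopf_comul_mul hH, i_comul, π_mul, πi, i_mul, anti_mul hC hH, i_anti,
      hopf_mul_assoc hH).
  - rewrite (hopf_anti_r hA). diag with (i_one, hopf_mul_one hH).
Qed.

(** The twisted antipode takes values in the coinvariants. *)
Lemma jr_twisted_anti : j ∘ r ∘ f = f.
Proof.
  apply (retraction_fixes (V := h)); auto.
  transitivity ((μ ⊗ id a) ∘ (id h ⊗ c a h) ∘
    ((i ∘ π) ⊗ (hmul A ∘ (id a ⊗ hanti A) ∘ hcomul A ∘ π) ⊗ S) ∘ (Δ ⊗ id h) ∘ Δ).
  - unfold twisted_anti.
    diag with (hopf_comul_mul hH, i_comul, π_mul, πi, π_comul, anti_comul hC hH, π_anti,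
      hopf_comul_assoc hH).
  - rewrite (hopf_anti_r hA); unfold twisted_anti. diag with (π_counit, hopf_comul_counit hH).
Qed.

Lemma sk_r : sk ∘ r = r ∘ f.
Proof.
  transitivity (r ∘ f ∘ e); [diag with jr|]; unfold coinvariant_projection.
  transitivity (r ∘ (f ∘ μ ∘ (id h ⊗ i)) ∘ (id h ⊗ (hanti A ∘ π)) ∘ Δ); [diag|].
  rewrite twisted_anti_mul_i; diag with (counit_anti hC hA, π_counit, hopf_comul_counit hH).
Qed.

Lemma j_sk : j ∘ sk = f ∘ j.
Proof. transitivity ((j ∘ r ∘ f) ∘ j); [diag | rewrite jr_twisted_anti; auto]. Qed.

Lemma r_twisted_anti_i_mul : r ∘ f ∘ μ ∘ (i ⊗ id h) = r ∘ μ ∘ (i ⊗ f).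
Proof.
  transitivity ((r ∘ μ ∘ (id h ⊗ i)) ∘ ((μ ∘ (i ⊗ f)) ⊗ hanti A) ∘ (id a ⊗ c a h)
    ∘ (hcomul A ⊗ id h)).
  - unfold twisted_anti.
    diag with (hopf_comul_mul hH, i_comul, π_mul, πi, i_mul, anti_mul hC hH, i_anti,
      hopf_mul_assoc hH).
  - rewrite r_mul_i; diag with (counit_anti hC hA, hopf_comul_counit hA).
Qed.

Lemma π_comul_twisted_anti : (π ⊗ id h) ∘ Δ ∘ f ∘ j = (π ⊗ f) ∘ Δ ∘ j.
Proof.
  transitivity ((hmul A ⊗ id h) ∘ (id a ⊗ c h a) ∘ (π ⊗ f ⊗ (hanti A ∘ π)) ∘ (Δ ⊗ id h) ∘ Δ ∘ j).
  - unfold twisted_anti.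
    diag with (hopf_comul_mul hH, i_comul, π_mul, πi, π_comul, anti_comul hC hH, π_anti,
      hopf_comul_assoc hH).
  - diag with (hopf_comul_assoc hH, j_coinvariant, anti_one hC hA, hopf_mul_one hA).
Qed.

Lemma coinvariant_anti_morphism : is_yd_morphism A coinvariants coinvariants sk.
Proof.
  constructor; auto; change (ycar coinvariants) with k; try typed.
  - apply (r_epi_l (W := a) (V := k)); try typed.
    transitivity (sk ∘ (ρ ∘ (id a ⊗ r))); [diag|]; rewrite <- r_i_mul.
    transitivity ((sk ∘ r) ∘ μ ∘ (i ⊗ id h)); [diag|]; rewrite sk_r, r_twisted_anti_i_mul.
    transitivity (ρ ∘ (id a ⊗ (sk ∘ r))); [|diag]; rewrite sk_r.
    diag with r_i_mul.
  - apply (j_mono_l (W := a) (V := k)); try typed.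
    transitivity (((id a ⊗ j) ∘ δ) ∘ sk); [diag|]; rewrite coaction_j.
    transitivity ((π ⊗ id h) ∘ Δ ∘ (j ∘ sk)); [diag|]; rewrite j_sk.
    transitivity ((id a ⊗ (j ∘ sk)) ∘ δ); [|diag]; rewrite j_sk.
    diag with (π_comul_twisted_anti, coaction_j).
Qed.

Lemma coinvariant_anti_l : mk ∘ (sk ⊗ id k) ∘ Dk = (r ∘ η) ∘ (ε ∘ j).
Proof.
  apply (j_mono (V := k)); try typed.
  transitivity (μ ∘ ((j ∘ sk ∘ r) ⊗ (j ∘ r)) ∘ Δ ∘ j); [diag with j_mul|].
  transitivity (μ ∘ ((j ∘ (sk ∘ r)) ⊗ (j ∘ r)) ∘ Δ ∘ j); [diag|].
  rewrite sk_r, jr; transitivity (μ ∘ ((j ∘ r ∘ f) ⊗ e) ∘ Δ ∘ j); [diag|].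
  rewrite jr_twisted_anti.
  transitivity (μ ∘ ((i ∘ π) ⊗ (μ ∘ ((μ ∘ (S ⊗ id h) ∘ Δ) ⊗ (i ∘ hanti A ∘ π)) ∘ Δ)) ∘ Δ ∘ j).
  - unfold twisted_anti, coinvariant_projection.
    diag with (hopf_mul_assoc hH, hopf_comul_assoc hH).
  - rewrite (hopf_anti_l hH).
    transitivity (i ∘ (hmul A ∘ (id a ⊗ hanti A) ∘ hcomul A) ∘ π ∘ j).
    + diag with (hopf_counit_comul hH, hopf_one_mul hH, i_mul, π_comul).
    + rewrite (hopf_anti_r hA). diag with (i_one, π_counit, j_one).
Qed.

Lemma coinvariant_anti_r : mk ∘ (id k ⊗ sk) ∘ Dk = (r ∘ η) ∘ (ε ∘ j).
Proof.
  apply (j_mono (V := k)); try typed.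
  transitivity (μ ∘ ((j ∘ r) ⊗ (j ∘ (sk ∘ r))) ∘ Δ ∘ j); [diag with j_mul|].
  rewrite sk_r, jr; transitivity (μ ∘ (e ⊗ (j ∘ r ∘ f)) ∘ Δ ∘ j); [diag|].
  rewrite jr_twisted_anti.
  transitivity (μ ∘ (id h ⊗ (μ ∘ ((i ∘ (hmul A ∘ (hanti A ⊗ id a) ∘ hcomul A) ∘ π) ⊗ S) ∘ Δ)) ∘ Δ
    ∘ j).
  - unfold twisted_anti, coinvariant_projection.
    diag with (hopf_mul_assoc hH, hopf_comul_assoc hH, i_mul, π_comul).
  - rewrite (hopf_anti_l hA).
    transitivity ((μ ∘ (id h ⊗ S) ∘ Δ) ∘ j).
    + diag with (hopf_counit_comul hH, hopf_one_mul hH, i_one, π_counit).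
    + rewrite (hopf_anti_r hH). diag with (j_one).
Qed.

(** The inverse of the antipode of [H] needs no twist here, because the part in [A] that
    it contributes is killed by [r] on one side and is trivial on coinvariants on the
    other. *)
Lemma coinvariant_anti_inverse : is_inverse (C := C) k k sk (r ∘ Si ∘ j).
Proof.
  destruct (inv_spec (hopf_anti_iso hH)) as (h1 & h2 & h3 & h4).
  assert (a1 := inv_spec (hopf_anti_iso hA)); destruct a1 as (a1 & a2 & a3 & a4).
  assert (i_anti_inv := hopf_morphism_anti_inv hC hA hH hi).
  assert (π_anti_inv := hopf_morphism_anti_inv hC hH hA hπ).
  split; [typed | split; [typed | split]].
  - transitivity (r ∘ Si ∘ (j ∘ sk)); [diag|]; rewrite j_sk.
    transitivity ((r ∘ μ ∘ (id h ⊗ i)) ∘ (id h ⊗ (inv a a (hanti A) ∘ π)) ∘ cinv h h ∘ Δ ∘ j).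
    + unfold twisted_anti. diag with (anti_inv_mul hC hH, h3, i_anti_inv).
    + rewrite r_mul_i.
      assert (e1 := counit_anti hC hA).
      assert (e2 : hcounit A ∘ inv a a (hanti A) = hcounit A).
      { transitivity (hcounit A ∘ hanti A ∘ inv a a (hanti A)); [diag with e1 | diag with a4]. }
      diag with (e2, π_counit, hopf_counit_comul hH, rj).
  - transitivity ((sk ∘ r) ∘ Si ∘ j); [diag|]; rewrite sk_r; unfold twisted_anti.
    transitivity (r ∘ μ ∘ (i ⊗ id h) ∘ cinv a h ∘ (id h ⊗ (inv a a (hanti A))) ∘ ((id h ⊗ π) ∘ Δ
      ∘ j)).
    + diag with (comul_anti_inv hC hH, h4, π_anti_inv).
    + rewrite j_coinvariant.
      assert (e1 := anti_one hC hA).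
      assert (e2 : inv a a (hanti A) ∘ hone A = hone A).
      { transitivity (inv a a (hanti A) ∘ hanti A ∘ hone A); [diag with e1 | diag with a3]. }
      diag with (e2, i_one, hopf_one_mul hH, rj).
Qed.

Lemma coinvariant_is_hopf : is_hopf (C := YD A) K.
Proof.
  assert (jm := j_mul); assert (rD := r_comul); assert (jo := j_one); assert (rc := r_counit).
  constructor; cbn [coinvariant_hopf hcar hmul hone hcomul hcounit hanti YD isob hom].
  - exact k_yd.
  - exact coinvariant_mul_morphism.
  - exact coinvariant_one_morphism.
  - exact coinvariant_comul_morphism.
  - exact coinvariant_counit_morphism.
  - cbn [YD comp tensm idm]; change (ycar coinvariants) with k.
    apply (j_mono (V := (k ⊗ k ⊗ k)%ob)); try typed.
    diag with (jm, hopf_mul_assoc hH).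
  - cbn [YD comp tensm idm]; change (ycar coinvariants) with k.
    diag with (jo, hopf_one_mul hH, rj).
  - cbn [YD comp tensm idm]; change (ycar coinvariants) with k.
    diag with (jo, hopf_mul_one hH, rj).
  - cbn [YD comp tensm idm]; change (ycar coinvariants) with k.
    apply (r_epi (V := (k ⊗ k ⊗ k)%ob)); try typed.
    diag with (rD, hopf_comul_assoc hH).
  - cbn [YD comp tensm idm]; change (ycar coinvariants) with k.
    diag with (rc, hopf_counit_comul hH, rj).
  - cbn [YD comp tensm idm]; change (ycar coinvariants) with k.
    diag with (rc, hopf_comul_counit hH, rj).
  - exact coinvariant_comul_mul.
  - cbn [YD comp tensm]. diag with (rc, hopf_counit_mul hH).
  - cbn [YD comp tensm]. diag with (jo, hopf_comul_one hH).
  - exact r_one_counit.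
  - exists (r ∘ Si ∘ j); apply (yd_inverse hC hA).
    + assert (m := coinvariant_anti_morphism).
      replace (r ∘ μ ∘ (i ∘ π) ⊗ S ∘ Δ ∘ j) with sk; [exact m|].
      unfold twisted_anti; diag.
    + replace (r ∘ μ ∘ (i ∘ π) ⊗ S ∘ Δ ∘ j) with sk; [exact coinvariant_anti_inverse|].
      unfold twisted_anti; diag.
  - refine (eq_trans _ coinvariant_anti_l); unfold twisted_anti; cbn [YD comp tensm idm].
    change (ycar coinvariants) with k; diag.
  - refine (eq_trans _ coinvariant_anti_r); unfold twisted_anti; cbn [YD comp tensm idm].
    change (ycar coinvariants) with k; diag.
Qed.

Lemma radford_morphism : is_hopf_morphism (biproduct K) H (μ ∘ (j ⊗ i)).
Proof.
  assert (jm := j_mul); assert (mij := coinvariant_mul_ij); assert (cj := comul_j).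
  constructor; cbn [biproduct coinvariant_hopf hcar hmul hone hcomul hcounit];
    change (ycar coinvariants) with k.
  - typed.
  - diag with (jm, mij, i_mul, hopf_mul_assoc hH).
  - diag with (j_one, i_one, hopf_one_mul hH).
  - diag with (cj, i_comul, i_mul, hopf_comul_mul hH, hopf_mul_assoc hH).
  - diag with (hopf_counit_mul hH, i_counit).
Qed.

Lemma radford_inverse : is_inverse (C := C) (k ⊗ a) h (μ ∘ (j ⊗ i)) ((r ⊗ π) ∘ Δ).
Proof.
  split; [typed | split; [typed | split]].
  - transitivity (((r ∘ μ ∘ (id h ⊗ i)) ⊗ (hmul A ∘ (π ⊗ id a)))
      ∘ (id h ⊗ c h a ⊗ id a) ∘ ((Δ ∘ j) ⊗ hcomul A)).
    + diag with (hopf_comul_mul hH, i_comul, π_mul, πi).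
    + rewrite r_mul_i. diag with (j_coinvariant, hopf_one_mul hA, hopf_counit_comul hA, rj).
  - refine (eq_trans _ retraction_factor); diag.
Qed.

Lemma radford_coinvariants_decomposition :
  is_equalizer (C := C) h (h ⊗ a) ((id h ⊗ π) ∘ Δ) (id h ⊗ hone A) k j ->
  is_radford_decomposition H π i K (μ ∘ (j ⊗ i)).
Proof.
  intros E; constructor.
  - exact coinvariant_is_hopf.
  - split; [exact radford_morphism|].
    exists ((r ⊗ π) ∘ Δ); exact radford_inverse.
  - cbn [coinvariant_hopf hcounit]. diag with (π_mul, πi, π_j, hopf_one_mul hA).
  - cbn [coinvariant_hopf hone]. diag with (j_one, hopf_one_mul hH).
  - cbn [coinvariant_hopf hcar]; change (ycar coinvariants) with k.
    replace (μ ∘ (j ⊗ i) ∘ (id k ⊗ hone A)) with j; [exact E|].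
    symmetry. diag with (i_one, hopf_mul_one hH).
Qed.

End Coinvariants.

(** The equalizer of [(id ⊗ π) ∘ Δ] and [id ⊗ hone A] is a split subobject of [H]: its
    retraction is the factorization of [coinvariant_projection]. *)
Theorem radford_projection :
  (forall X Y f g, hom C X Y f -> hom C X Y g -> exists E e, is_equalizer (C := C) X Y f g E e) ->
  exists (K : hopfData (YD A)) (phi : mor C), is_radford_decomposition H π i K phi.
Proof.
  intros heq.
  destruct (heq h (h ⊗ a)%ob ((id h ⊗ π) ∘ Δ) (id h ⊗ hone A)) as (k & j & hE); try typed.
  assert (hE' := hE); destruct hE' as (hj & ej & univ).
  destruct (univ h e projection_hom) as (r & (hr & er) & _).
  { exact projection_coinvariant. }
  assert (rj : r ∘ j = id k).
  { destruct (univ k j hj ej) as (u & _ & uniq).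
    transitivity u; [symmetry|]; apply uniq; split; try typed.
    - rewrite (comp_assoc hC hj hr hj), er; exact (projection_fixes hj ej).
    - apply (comp_id hC hj). }
  exists (coinvariant_hopf k j r), (μ ∘ (j ⊗ i)).
  apply radford_coinvariants_decomposition; auto.
Qed.

End Radford.

(** * The pairing behind Omega *)

Section Pairing.

Variable C : catData.
Hypothesis hC : is_braided_category C.
Variables (A B : hopfData C) (w : mor C).
Hypothesis hA : is_hopf A.
Hypothesis hB : is_hopf B.
Hypothesis hw : is_hopf_pairing A B w.
Hypothesis hnd : is_nondegenerate A B w.
Local Notation a := (hcar A).
Local Notation b := (hcar B).
Local Notation S := (hanti B).
Local Notation Si := (inv b b S).
Local Notation S2 := (S ∘ S).
Local Notation S2i := (inv b b S2).

Let w_hom : hom C (a ⊗ b) 𝟏 w := pairing_hom hw.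

Lemma copairing_inverse : is_inverse_copairing A B w (copairing A B w).
Proof. unfold copairing; apply epsilon_spec; exact hnd. Qed.

Lemma S2_inverse : is_inverse (C := C) b b S2 S2i.
Proof.
  apply inv_spec; destruct (hopf_anti_iso hB) as [g hg].
  exists (g ∘ g); exact (inverse_comp hC hg hg).
Qed.
Let S2i_hom : hom C b b S2i := proj1 (proj2 S2_inverse).

(** The square of the antipode is multiplicative up to a double braiding; this is the
    reason for which the double braidings in the definition of [Omega] disappear. *)
Lemma S2_mul : S2 ∘ hmul B = hmul B ∘ c b b ∘ c b b ∘ (S2 ⊗ S2).
Proof. diag with (anti_mul hC hB). Qed.
Lemma S2_comul : hcomul B ∘ S2 = c b b ∘ c b b ∘ (S2 ⊗ S2) ∘ hcomul B.
Proof. diag with (anti_comul hC hB). Qed.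

Lemma S2i_mul : S2i ∘ hmul B = hmul B ∘ cinv b b ∘ cinv b b ∘ (S2i ⊗ S2i).
Proof.
  destruct S2_inverse as (h1 & h2 & h3 & h4).
  apply (iso_mono hC (X := b) (Y := b) (f := S2) (Z := (b ⊗ b)%ob)); try typed.
  - exists S2i; apply S2_inverse.
  - assert (e := S2_mul); transitivity (hmul B ∘ ((S2 ∘ S2i) ⊗ (S2 ∘ S2i))).
    + rewrite h4; diag with h4.
    + symmetry; diag with e.
Qed.
Lemma S2i_comul : hcomul B ∘ S2i = cinv b b ∘ cinv b b ∘ (S2i ⊗ S2i) ∘ hcomul B.
Proof.
  destruct S2_inverse as (h1 & h2 & h3 & h4).
  apply (iso_epi hC (X := b) (Y := b) (f := S2) (Z := (b ⊗ b)%ob)); try typed.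
  - exists S2i; apply S2_inverse.
  - assert (e := S2_comul); transitivity (((S2i ∘ S2) ⊗ (S2i ∘ S2)) ∘ hcomul B).
    + rewrite h3; diag with h3.
    + symmetry; diag with e.
Qed.

(** [Omega] is built from [w] with squares of antipodes and inverse braidings.  All of
    these are absorbed in one arrow from [b ⊗ a] to the unit, which is itself a
    non-degenerate Hopf pairing ([turned_mul_l] to [turned_zigzag_r]); everything
    about [Omega] is proved in terms of it. *)
Definition turned : mor C := w ∘ cinv a b ∘ (S2i ⊗ id a).
Local Notation ν := turned.

Lemma turned_hom : hom C (b ⊗ a) 𝟏 ν.
Proof. unfold turned; typed. Qed.

Lemma turned_mul_l : ν ∘ (hmul B ⊗ id a) = ν ∘ (id b ⊗ ν ⊗ id a) ∘ (id (b ⊗ b) ⊗ hcomul A).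
Proof. unfold turned; diag all with (S2i_mul, pairing_mul_r hw). Qed.
Lemma turned_mul_r : ν ∘ (id b ⊗ hmul A) = ν ∘ (id b ⊗ ν ⊗ id a) ∘ (hcomul B ⊗ id (a ⊗ a)).
Proof. unfold turned; diag with (S2i_comul, pairing_mul_l hw). Qed.

Lemma S2i_one : S2i ∘ hone B = hone B.
Proof.
  destruct S2_inverse as (h1 & h2 & h3 & h4).
  assert (e := anti_one hC hB).
  transitivity (S2i ∘ S2 ∘ hone B); [diag with e|]; rewrite h3; diag.
Qed.
Lemma S2i_counit : hcounit B ∘ S2i = hcounit B.
Proof.
  destruct S2_inverse as (h1 & h2 & h3 & h4).
  assert (e := counit_anti hC hB).
  transitivity (hcounit B ∘ (S2 ∘ S2i)); [diag with e|]; rewrite h4; diag.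
Qed.

Lemma turned_one_l : ν ∘ (hone B ⊗ id a) = hcounit A.
Proof. unfold turned; diag with (S2i_one, pairing_one_r hw). Qed.
Lemma turned_one_r : ν ∘ (id b ⊗ hone A) = hcounit B.
Proof. unfold turned; diag with (S2i_counit, pairing_one_l hw). Qed.

Definition turned_copairing : mor C := (id a ⊗ S2) ∘ c b a ∘ copairing A B w.
Local Notation κ := turned_copairing.
Lemma turned_copairing_hom : hom C 𝟏 (a ⊗ b) κ.
Proof. destruct copairing_inverse as (h & _); unfold turned_copairing; typed. Qed.

Lemma turned_zigzag_l : (ν ⊗ id b) ∘ (id b ⊗ κ) = id b.
Proof.
  destruct copairing_inverse as (h1 & h2 & h3); destruct S2_inverse as (k1 & k2 & k3 & k4).
  unfold turned, turned_copairing.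
  assert (e : (w ⊗ id b) ∘ (cinv a b ⊗ id b) ∘ (id b ⊗ (c b a ∘ copairing A B w)) = id b).
  { transitivity ((w ⊗ id b) ∘ (cinv a b ⊗ id b) ∘ (id b ⊗ c b a) ∘ (c b b ⊗ id a)
      ∘ (id b ⊗ c a b) ∘ (copairing A B w ⊗ id b)); [diag|].
    assert (e : (w ⊗ id b) ∘ (cinv a b ⊗ id b) ∘ (id b ⊗ c b a) ∘ (c b b ⊗ id a) ∘ (id b ⊗ c a b)
       = id b ⊗ w) by diag.
    rewrite e; exact h3. }
  transitivity (S2 ∘ ((w ⊗ id b) ∘ (cinv a b ⊗ id b) ∘ (id b ⊗ (c b a ∘ copairing A B w))) ∘ S2i).
  - diag.
  - rewrite e. diag with k4.
Qed.
Lemma turned_zigzag_r : (id a ⊗ ν) ∘ (κ ⊗ id a) = id a.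
Proof.
  destruct copairing_inverse as (h1 & h2 & h3); destruct S2_inverse as (k1 & k2 & k3 & k4).
  unfold turned, turned_copairing.
  transitivity ((id a ⊗ w) ∘ (id a ⊗ cinv a b) ∘ ((c b a ∘ copairing A B w) ⊗ id a)).
  - diag with k3.
  - transitivity ((id a ⊗ w) ∘ (id a ⊗ cinv a b) ∘ (c b a ⊗ id a) ∘ (id b ⊗ c a a)
      ∘ (c a b ⊗ id a) ∘ (id a ⊗ copairing A B w)); [diag|].
    assert (e : (id a ⊗ w) ∘ (id a ⊗ cinv a b) ∘ (c b a ⊗ id a) ∘ (id b ⊗ c a a) ∘ (c a b ⊗ id a)
       = w ⊗ id a) by diag.
    rewrite e; exact h2.
Qed.
End Pairing.

Section Transposition.

Variable C : catData.
Hypothesis hC : is_braided_category C.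

Variables (a b : ob C) (ν κ : mor C).
Hypothesis a_ob : isob C a.
Hypothesis b_ob : isob C b.
Hypothesis ν_hom : hom C (b ⊗ a) 𝟏 ν.
Hypothesis κ_hom : hom C 𝟏 (a ⊗ b) κ.
Hypothesis zigzag_l : (ν ⊗ id b) ∘ (id b ⊗ κ) = id b.
Hypothesis zigzag_r : (id a ⊗ ν) ∘ (κ ⊗ id a) = id a.

(** Non-degeneracy: an arrow into [a ⊗ X] is determined by its pairing with [b], and in
    [transpose_r_inj] an arrow into [b ⊗ X] by its pairing with [a]. *)
Lemma transpose_l_inj Z X f g : isob C X -> hom C Z (a ⊗ X) f -> hom C Z (a ⊗ X) g ->
  (ν ⊗ id X) ∘ (id b ⊗ f) = (ν ⊗ id X) ∘ (id b ⊗ g) -> f = g.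
Proof.
  intros hX hf hg e.
  transitivity ((id a ⊗ ((ν ⊗ id X) ∘ (id b ⊗ f))) ∘ (κ ⊗ id Z)); [diag with zigzag_r|].
  rewrite e; diag with zigzag_r.
Qed.

Lemma transpose_r_inj Z X f g : isob C X -> hom C Z (b ⊗ X) f -> hom C Z (b ⊗ X) g ->
  (ν ⊗ id X) ∘ (id b ⊗ c X a) ∘ (f ⊗ id a) = (ν ⊗ id X) ∘ (id b ⊗ c X a) ∘ (g ⊗ id a) -> f = g.
Proof.
  intros hX hf hg e.
  assert (k : forall t, hom C Z (b ⊗ X) t ->
    c X b ∘ (((ν ⊗ id X) ∘ (id b ⊗ c X a) ∘ (t ⊗ id a)) ⊗ id b) ∘ (id Z ⊗ κ) = t).
  { intros t ht.
    assert (k : c X b ∘ (ν ⊗ id X ⊗ id b) ∘ (id b ⊗ c X a ⊗ id b) ∘ (id (b ⊗ X) ⊗ κ) = id (b ⊗ X)).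
    { transitivity (((ν ⊗ id b) ∘ (id b ⊗ κ)) ⊗ id X); [|rewrite zigzag_l; diag].
      diag. }
    transitivity (c X b ∘ (ν ⊗ id X ⊗ id b) ∘ (id b ⊗ c X a ⊗ id b) ∘ (id (b ⊗ X) ⊗ κ) ∘ t);
      [diag|].
    rewrite k; diag. }
  rewrite <- (k f hf), <- (k g hg), e; auto.
Qed.
End Transposition.

(** * Exchanging actions and coactions *)

Section Omega.

Variable C : catData.
Hypothesis hC : is_braided_category C.

Variables (A B : hopfData C) (w : mor C).
Hypothesis hA : is_hopf A.
Hypothesis hB : is_hopf B.
Hypothesis hw : is_hopf_pairing A B w.
Hypothesis hnd : is_nondegenerate A B w.
Local Notation a := (hcar A).
Local Notation b := (hcar B).
Local Notation S2 := (hanti B ∘ hanti B).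
Local Notation S2i := (inv b b S2).
Local Notation ν := (turned A B w).
Local Notation κ := (turned_copairing A B w).
Local Notation Ω := (Omega_ob A B w).

(** The arrow [X ⊗ a -> X] that a coaction [d : X -> b ⊗ X] becomes under the pairing. *)
Local Notation τ X d := ((ν ⊗ id X) ∘ (id b ⊗ c X a) ∘ (d ⊗ id a)).

Let w_hom : hom C (a ⊗ b) 𝟏 w := pairing_hom hw.
Let S2i_hom : hom C b b S2i := proj1 (proj2 (S2_inverse hC hB)).
Let ν_hom : hom C (b ⊗ a) 𝟏 ν := turned_hom hC hA hB hw.
Let κ_hom : hom C 𝟏 (a ⊗ b) κ := turned_copairing_hom hC hA hB hnd.
Let w'_hom : hom C 𝟏 (b ⊗ a) (copairing A B w) := proj1 (copairing_inverse hnd).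
Let zigzag_l := turned_zigzag_l hC hA hB hw hnd.
Let zigzag_r := turned_zigzag_r hC hA hB hw hnd.
Let mul_l := turned_mul_l hC hA hB hw.
Let mul_r := turned_mul_r hC hA hB hw.
Let one_l := turned_one_l hC hA hB hw.
Let one_r := turned_one_r hC hA hB hw.
Let inj_l := @transpose_l_inj C hC a b ν κ (hopf_ob hA) (hopf_ob hB) ν_hom κ_hom zigzag_r.
Let inj_r := @transpose_r_inj C hC a b ν κ (hopf_ob hA) (hopf_ob hB) ν_hom κ_hom zigzag_l.

(** [B] acts by coacting with [A] and pairing. *)
Lemma omega_act X : isob C (ycar X) -> hom C (ycar X) (a ⊗ ycar X) (ycoact X) ->
  yact (Ω X) = (ν ⊗ id (ycar X)) ∘ (id b ⊗ ycoact X).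
Proof.
  intros hX hc; unfold turned; cbn [Omega_ob yact ycar].
  diag.
Qed.

Lemma omega_coact_hom X : isob C (ycar X) -> hom C (a ⊗ ycar X) (ycar X) (yact X) ->
  hom C (ycar X) (b ⊗ ycar X) (ycoact (Ω X)).
Proof. intros hX hc; cbn [Omega_ob ycoact]; typed. Qed.

(** Sliding a strand around a pairing turns a crossing with one leg into the opposite
    crossing with the other leg.  These equations follow from naturality, but they
    create crossings. *)
Lemma slide_pairing X p : isob C X -> hom C (b ⊗ a) 𝟏 p ->
  (id X ⊗ p) ∘ (c b X ⊗ id a) = (p ⊗ id X) ∘ (id b ⊗ cinv a X).
Proof.
  intros hX hp.
  transitivity (((id X ⊗ p) ∘ (c b X ⊗ id a) ∘ (id b ⊗ c a X)) ∘ (id b ⊗ cinv a X)); [diag|].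
  assert (e : (id X ⊗ p) ∘ (c b X ⊗ id a) ∘ (id b ⊗ c a X) = p ⊗ id X) by diag.
  rewrite e; auto.
Qed.

Lemma slide_pairing_r X p : isob C X -> hom C (b ⊗ a) 𝟏 p ->
  (p ⊗ id X) ∘ (id b ⊗ c X a) = (id X ⊗ p) ∘ (cinv X b ⊗ id a).
Proof.
  intros hX hp.
  transitivity (((p ⊗ id X) ∘ (id b ⊗ c X a) ∘ (c X b ⊗ id a)) ∘ (cinv X b ⊗ id a)); [diag|].
  assert (e : (p ⊗ id X) ∘ (id b ⊗ c X a) ∘ (c X b ⊗ id a) = id X ⊗ p) by diag.
  rewrite e; auto.
Qed.

(** The coaction of [B] is the transpose of the action of [A]. *)
Lemma omega_coact X : isob C (ycar X) -> hom C (a ⊗ ycar X) (ycar X) (yact X) ->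
  τ (ycar X) (ycoact (Ω X)) = yact X ∘ cinv a (ycar X).
Proof.
  intros hX hc; cbn [Omega_ob ycoact].
  destruct (S2_inverse hC hB) as (h1 & h2 & h3 & h4).
  transitivity (yact X ∘ (((id a ⊗ ν) ∘ (κ ⊗ id a)) ⊗ id (ycar X)) ∘ cinv a (ycar X)).
  - assert (p_hom : hom C (b ⊗ a) 𝟏 (w ∘ cinv a b)) by typed.
    assert (e1 := slide_pairing hX p_hom); assert (e2 := slide_pairing (hopf_ob hA) p_hom).
    unfold turned, turned_copairing.
    transitivity (((id (ycar X) ⊗ (w ∘ cinv a b)) ∘ (c b (ycar X) ⊗ id a)) ∘
      (id b ⊗ yact X ⊗ id a) ∘ (copairing A B w ⊗ id (ycar X) ⊗ id a)).
    + diag all with h3.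
    + rewrite e1.
      transitivity (yact X ∘ (((id a ⊗ (w ∘ cinv a b)) ∘ (c b a ⊗ id a)) ⊗ id (ycar X)) ∘
        (copairing A B w ⊗ id a ⊗ id (ycar X)) ∘ cinv a (ycar X)).
      * rewrite e2; diag all with tt.
      * diag all with h3.
  - rewrite zigzag_r; diag.
Qed.

(** Transposition turns coassociativity over [A] into associativity over [B], because
    the pairing exchanges coproducts and products. *)
Lemma omega_module X : is_comodule A X -> is_module B (Ω X).
Proof.
  intros [hX hc e1 e2]; assert (h := omega_act hX hc).
  constructor; rewrite ?h; cbn [Omega_ob ycar]; auto; try typed.
  - diag with (mul_l, e1).
  - diag with (one_l, e2).
Qed.

Lemma module_omega X : isob C (ycar X) -> hom C (ycar X) (a ⊗ ycar X) (ycoact X) ->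
  is_module B (Ω X) -> is_comodule A X.
Proof.
  intros hX hc [_ _ e1 e2]; rewrite omega_act in e1, e2 by auto; cbn [Omega_ob ycar] in e1, e2.
  constructor; auto.
  - apply (@inj_l (ycar X) (a ⊗ ycar X)%ob); try typed.
    apply (@inj_l (b ⊗ ycar X)%ob (ycar X)%ob); try typed.
    diag with (mul_l, e1).
  - diag with (one_l, e2).
Qed.

(** The same with the roles exchanged.  Of two arguments in [a] standing on the right of
    [X] the first one acts first, whence the crossing in [hmul A ∘ cinv a a]. *)
Lemma omega_comodule X : is_module A X -> is_comodule B (Ω X).
Proof.
  intros [hX hc e1 e2]; assert (h := omega_coact hX hc); assert (k := omega_coact_hom hX hc).
  assert (e := slide_pairing (hopf_ob hA) ν_hom).
  constructor; cbn [Omega_ob ycar]; auto; revert h k; generalize (ycoact (Ω X)); intros d h k.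
  - apply (@inj_r (ycar X) (b ⊗ ycar X)%ob); try typed.
    apply (@inj_r (ycar X ⊗ a)%ob (ycar X)%ob); try typed.
    transitivity ((τ (ycar X) d) ∘
      ((τ (ycar X) d) ⊗ id a)).
    + rewrite h.
      transitivity ((τ (ycar X) d) ∘ (id (ycar X) ⊗ (hmul A ∘ cinv a a))).
      * diag all with (mul_r, e).
      * rewrite h. diag all with e1.
    + diag all with tt.
  - transitivity ((τ (ycar X) d) ∘ (id (ycar X) ⊗ hone A)).
    + diag all with one_r.
    + rewrite h; diag all with e2.
Qed.

Lemma comodule_omega X : isob C (ycar X) -> hom C (a ⊗ ycar X) (ycar X) (yact X) ->
  is_comodule B (Ω X) -> is_module A X.
Proof.
  intros hX hc [_ k e1 e2]; assert (h := omega_coact hX hc).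
  assert (e := slide_pairing (hopf_ob hA) ν_hom).
  change (ycar (Ω X)) with (ycar X) in *; revert h k e1 e2; generalize (ycoact (Ω X));
    intros d h k e1 e2.
  constructor; auto.
  - assert (t : (τ (ycar X) d) ∘ (id (ycar X) ⊗ (hmul A ∘ cinv a a)) =
      (τ (ycar X) d) ∘
      ((τ (ycar X) d) ⊗ id a)).
    { transitivity ((ν ⊗ id (ycar X)) ∘ (id b ⊗ c (ycar X) a) ∘ (((ν ⊗ id (b ⊗ ycar X))
        ∘ (id b ⊗ c (b ⊗ ycar X) a)
      ∘ (((hcomul B ⊗ id (ycar X)) ∘ d) ⊗ id a)) ⊗ id a)).
      - diag all with (mul_r, e).
      - rewrite e1; diag all with tt. }
    rewrite h in t.
    transitivity (yact X ∘ cinv a (ycar X) ∘ (id (ycar X) ⊗ (hmul A ∘ cinv a a))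
      ∘ (c a (ycar X) ⊗ id a) ∘
      (id a ⊗ c a (ycar X)) ∘ (c a a ⊗ id (ycar X))); [diag|].
    rewrite t; diag all with tt.
  - transitivity ((τ (ycar X) d) ∘ (id (ycar X) ⊗ hone A)).
    + rewrite h; diag all with tt.
    + diag all with (one_r, e2).
Qed.

(** The coaction of [B] on [X] and its action on [Y] meet in one zigzag of pairing and
    copairing: what remains is the action of [A] on [X] by the coaction on [Y], that is,
    the braiding over [A] in the opposite order. *)
Lemma omega_braid X Y : is_comodule A Y -> is_module A X ->
  yd_braid B (Ω X) (Ω Y) = c (ycar X) (ycar Y) ∘ yd_braid A Y X ∘ cinv (ycar Y) (ycar X).
Proof.
  intros [hY dY _ _] [hX rX _ _].
  unfold yd_braid; rewrite (omega_act hY dY).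
  assert (h := omega_coact hX rX); assert (k := omega_coact_hom hX rX).
  change (ycar (Ω X)) with (ycar X); change (ycar (Ω Y)) with (ycar Y).
  revert h k; generalize (ycoact (Ω X)); intros d h k.
  transitivity (c (ycar X) (ycar Y) ∘ ((τ (ycar X) d) ⊗ id (ycar Y)) ∘
     (id (ycar X) ⊗ ycoact Y)).
  - diag all with tt.
  - rewrite h; diag all with tt.
Qed.

(** [B] acts on [Y ⊗ X] through the product of the two coactions of [A], and on
    [Ω X ⊗ Ω Y] through the coproduct of [B].  The pairing relates these, and reverses the
    order of the factors. *)
Lemma omega_tens_linear X Y : is_comodule A X -> is_comodule A Y ->
  linear B (yd_tens B (Ω X) (Ω Y)) (Ω (yd_tens A Y X)) (cinv (ycar Y) (ycar X)).
Proof.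
  intros hX hY; unfold linear.
  assert (hT := comodule_tens hC hA hY hX).
  rewrite (omega_act (comod_ob hT) (comod_hom hT)).
  destruct hX as [hX dX _ _], hY as [hY dY _ _].
  unfold yd_tens; cbn [yact ycar ycoact].
  rewrite (omega_act hX dX), (omega_act hY dY).
  change (ycar (Ω X)) with (ycar X); change (ycar (Ω Y)) with (ycar Y).
  assert (e1 := slide_pairing_r hY ν_hom).
  transitivity ((((ν ⊗ id (ycar Y)) ∘ (id b ⊗ ycoact Y)) ⊗ ((ν ⊗ id (ycar X)) ∘ (id b ⊗ ycoact X)))
    ∘ (id b ⊗ cinv (ycar Y) b ⊗ id (ycar X)) ∘ (cinv b b ⊗ id (ycar Y ⊗ ycar X))
    ∘ (hcomul B ⊗ id (ycar Y ⊗ ycar X)) ∘ (id b ⊗ cinv (ycar Y) (ycar X))).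
  - assert (e2 := slide_pairing hX ν_hom); assert (e3 := slide_pairing (hopf_ob hA) ν_hom).
    diag all with (e2, e3).
  - transitivity ((ν ⊗ id (ycar Y ⊗ ycar X)) ∘ (id b ⊗ ν ⊗ id a ⊗ id (ycar Y ⊗ ycar X))
      ∘ (hcomul B ⊗ id a ⊗ id a ⊗ id (ycar Y ⊗ ycar X))
     ∘ (id b ⊗ id a ⊗ c (ycar Y) a ⊗ id (ycar X)) ∘ (id b ⊗ ycoact Y ⊗ ycoact X)
       ∘ (id b ⊗ cinv (ycar Y) (ycar X))).
    + assert (e2 := slide_pairing hX ν_hom); assert (e3 := slide_pairing (hopf_ob hA) ν_hom).
      assert (e4 := slide_pairing_r (hopf_ob hB) ν_hom). diag all with (e1, e2, e3, e4).
    + diag all with mul_r.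
Qed.

Lemma omega_tens_colinear X Y : is_module A X -> is_module A Y ->
  colinear B (yd_tens B (Ω X) (Ω Y)) (Ω (yd_tens A Y X)) (cinv (ycar Y) (ycar X)).
Proof.
  intros hX hY; unfold colinear.
  assert (hT := module_tens hC hA hY hX).
  assert (h := omega_coact (mod_ob hT) (mod_hom hT));
    assert (k := omega_coact_hom (mod_ob hT) (mod_hom hT)).
  destruct hX as [hX rX _ _], hY as [hY rY _ _].
  assert (hx := omega_coact hX rX); assert (kx := omega_coact_hom hX rX).
  assert (hy := omega_coact hY rY); assert (ky := omega_coact_hom hY rY).
  set (T := Ω (yd_tens A Y X)) in *.
  change (ycar T) with (ycar Y ⊗ ycar X)%ob in *.
  cbn [yd_tens yact ycar ycoact] in h, k |- *.
  change (ycar (Ω X)) with (ycar X) in *; change (ycar (Ω Y)) with (ycar Y) in *.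
  revert h k hx kx hy ky; generalize (ycoact T), (ycoact (Ω X)), (ycoact (Ω Y)).
  intros d dX dY h k hx kx hy ky.
  apply (@inj_r (ycar X ⊗ ycar Y)%ob (ycar Y ⊗ ycar X)%ob); try typed.
  transitivity ((τ (ycar Y ⊗ ycar X) d) ∘ (cinv (ycar Y) (ycar X) ⊗ id a)).
  { diag. }
  rewrite h.
  transitivity (cinv (ycar Y) (ycar X) ∘ ((τ (ycar X) dX) ⊗ id (ycar Y))
    ∘ (id (ycar X) ⊗ c (ycar Y) a) ∘ (id (ycar X) ⊗ (τ (ycar Y) dY) ⊗ id a)
    ∘ (id (ycar X ⊗ ycar Y) ⊗ hcomul A)).
  - rewrite hx, hy. diag all with tt.
  - diag all with mul_l.
Qed.
End Omega.

(** * Yetter-Drinfel'd modules and braidings *)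

Section Detection.

Variable C : catData.
Hypothesis hC : is_braided_category C.

Variable A : hopfData C.
Hypothesis hA : is_hopf A.
Local Notation a := (hcar A).

(** The compatibility condition says that the braidings with all comodules are colinear,
    and it suffices to test the regular one: apply the counit to its last strand. *)
Lemma colinear_yd_condition X : is_module A X -> is_comodule A X ->
  colinear A (yd_tens A (regular A) X) (yd_tens A X (regular A)) (yd_braid A (regular A) X) ->
  yd_condition A X.
Proof.
  unfold colinear, yd_condition, yd_braid; cbn [yd_tens regular ycar yact ycoact]; intros hX hX' e.
  transitivity ((id (a ⊗ ycar X) ⊗ hcounit A) ∘ ((id a ⊗ ((yact X ⊗ id a) ∘ (id a ⊗ c a (ycar X))
    ∘ (hcomul A ⊗ id (ycar X))))
     ∘ ((hmul A ⊗ id (a ⊗ ycar X)) ∘ (id a ⊗ c a a ⊗ id (ycar X)) ∘ (hcomul A ⊗ ycoact X)))).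
  - diag with (hopf_comul_counit hA).
  - rewrite <- e; diag with (hopf_comul_counit hA).
Qed.

(** The dual test, with the unit in the last strand. *)
Lemma linear_yd_condition X : is_module A X -> is_comodule A X ->
  linear A (yd_tens A X (regular A)) (yd_tens A (regular A) X) (yd_braid A X (regular A)) ->
  yd_condition A X.
Proof.
  unfold linear, yd_condition, yd_braid; cbn [yd_tens regular ycar yact ycoact]; intros hX hX' e.
  transitivity (((hmul A ⊗ yact X) ∘ (id a ⊗ c a a ⊗ id (ycar X)) ∘ (hcomul A ⊗ id (a ⊗ ycar X)) ∘
     (id a ⊗ ((hmul A ⊗ id (ycar X)) ∘ (id a ⊗ c (ycar X) a) ∘ (ycoact X ⊗ id a))))
       ∘ (id (a ⊗ ycar X) ⊗ hone A)).
  - diag with (hopf_mul_one hA).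
  - rewrite <- e; diag with (hopf_mul_one hA).
Qed.
End Detection.

Section Linear.

Variable C : catData.
Hypothesis hC : is_braided_category C.

Variable A : hopfData C.
Hypothesis hA : is_hopf A.
Local Notation a := (hcar A).

Lemma linear_comp X Y Z f g : is_module A X -> is_module A Y -> is_module A Z ->
  hom C (ycar X) (ycar Y) f -> hom C (ycar Y) (ycar Z) g ->
  linear A X Y f -> linear A Y Z g -> linear A X Z (g ∘ f).
Proof. unfold linear; intros hX hY hZ hf hg e e'; diag with (e, e'). Qed.

Lemma linear_inverse X Y f g : is_module A X -> is_module A Y ->
  is_inverse (C := C) (ycar X) (ycar Y) f g -> linear A X Y f -> linear A Y X g.
Proof.
  unfold linear; intros hX hY (h1 & h2 & h3 & h4) e.
  transitivity (g ∘ yact Y ∘ (id a ⊗ (f ∘ g))); [rewrite h4; diag | diag with (e, h3)].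
Qed.
End Linear.

(** * The braided functor Omega *)

Section OmegaFunctor.

Variable C : catData.
Hypothesis hC : is_braided_category C.

Variables (A B : hopfData C) (w : mor C).
Hypothesis hA : is_hopf A.
Hypothesis hB : is_hopf B.
Hypothesis hw : is_hopf_pairing A B w.
Hypothesis hnd : is_nondegenerate A B w.
Local Notation a := (hcar A).
Local Notation b := (hcar B).
Local Notation ν := (turned A B w).
Local Notation κ := (turned_copairing A B w).
Local Notation Ω := (Omega_ob A B w).
Local Notation τ X d := ((ν ⊗ id X) ∘ (id b ⊗ c X a) ∘ (d ⊗ id a)).
Let ν_hom : hom C (b ⊗ a) 𝟏 ν := turned_hom hC hA hB hw.
Let κ_hom : hom C 𝟏 (a ⊗ b) κ := turned_copairing_hom hC hA hB hnd.
Let zigzag_l := turned_zigzag_l hC hA hB hw hnd.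
Let zigzag_r := turned_zigzag_r hC hA hB hw hnd.
Let inj_l := @transpose_l_inj C hC a b ν κ (hopf_ob hA) (hopf_ob hB) ν_hom κ_hom zigzag_r.
Let inj_r := @transpose_r_inj C hC a b ν κ (hopf_ob hA) (hopf_ob hB) ν_hom κ_hom zigzag_l.

(** The formulas of [omega_act] and [omega_coact] solved for the structures over [A]. *)
Definition Omega_inv_ob (Z : ydData C) : ydData C := YDData (ycar Z)
  (τ (ycar Z) (ycoact Z) ∘ c a (ycar Z))
  ((id a ⊗ yact Z) ∘ (κ ⊗ id (ycar Z))).
Local Notation Ωi := Omega_inv_ob.

Lemma Omega_inv_r Z : isob C (ycar Z) -> hom C (b ⊗ ycar Z) (ycar Z) (yact Z) ->
  hom C (ycar Z) (b ⊗ ycar Z) (ycoact Z) -> Ω (Ωi Z) = Z.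
Proof.
  intros hZ hr hd.
  assert (hr' : hom C (a ⊗ ycar Z) (ycar Z) (yact (Ωi Z))) by (cbn; typed).
  assert (hd' : hom C (ycar Z) (a ⊗ ycar Z) (ycoact (Ωi Z))) by (cbn; typed).
  apply ydData_eq; [reflexivity | |].
  - rewrite omega_act by auto; cbn. diag with zigzag_l.
  - assert (k := @omega_coact_hom C hC A B w hA hB hnd (Ωi Z) hZ hr').
    apply (@inj_r (ycar Z) (ycar Z)); auto.
    etransitivity; [apply (@omega_coact C hC A B w hA hB hw hnd (Ωi Z)); auto|].
    cbn [Ωi ycar yact]; diag.
Qed.

Lemma Omega_inv_l X : isob C (ycar X) -> hom C (a ⊗ ycar X) (ycar X) (yact X) ->
  hom C (ycar X) (a ⊗ ycar X) (ycoact X) -> Ωi (Ω X) = X.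
Proof.
  intros hX hr hd; apply ydData_eq; [reflexivity | |]; cbn [Ωi yact ycoact].
  - assert (h := omega_coact hC hA hB hw hnd hX hr).
    change (ycar (Ω X)) with (ycar X).
    rewrite h; diag.
  - rewrite (omega_act hC hA hB hw hX hd); change (ycar (Ω X)) with (ycar X); diag with zigzag_r.
Qed.

Lemma Omega_inv_comodule Z : hom C (ycar Z) (b ⊗ ycar Z) (ycoact Z) -> is_module B Z ->
  is_comodule A (Ωi Z).
Proof.
  intros hd h; assert (e := Omega_inv_r (mod_ob h) (mod_hom h) hd).
  destruct (h) as [hZ hr _ _].
  apply (module_omega hC hA hB hw hnd); [exact hZ | cbn; typed | rewrite e; exact h].
Qed.
Lemma Omega_inv_module Z : hom C (b ⊗ ycar Z) (ycar Z) (yact Z) -> is_comodule B Z ->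
  is_module A (Ωi Z).
Proof.
  intros hd h; assert (e := Omega_inv_r (comod_ob h) hd (comod_hom h)).
  destruct (h) as [hZ hr _ _].
  apply (comodule_omega hC hA hB hw hnd); [exact hZ | cbn; typed | rewrite e; exact h].
Qed.

Lemma omega_linear X Y f : isob C (ycar X) -> isob C (ycar Y) ->
  hom C (ycar X) (a ⊗ ycar X) (ycoact X) -> hom C (ycar Y) (a ⊗ ycar Y) (ycoact Y) ->
  hom C (ycar X) (ycar Y) f -> (colinear A X Y f <-> linear B (Ω X) (Ω Y) f).
Proof.
  intros hX hY dX dY hf; unfold linear, colinear.
  rewrite (omega_act hC hA hB hw hX dX), (omega_act hC hA hB hw hY dY); split; intros e.
  - symmetry; diag with e.
  - apply (@inj_l (ycar X) (ycar Y)); try typed; symmetry; diag with e.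
Qed.

Lemma omega_colinear X Y f : isob C (ycar X) -> isob C (ycar Y) ->
  hom C (a ⊗ ycar X) (ycar X) (yact X) -> hom C (a ⊗ ycar Y) (ycar Y) (yact Y) ->
  hom C (ycar X) (ycar Y) f -> (linear A X Y f <-> colinear B (Ω X) (Ω Y) f).
Proof.
  intros hX hY rX rY hf; unfold linear, colinear.
  assert (h := omega_coact hC hA hB hw hnd hX rX); assert (k := omega_coact_hom hC hA hB hnd hX rX).
  assert (h' := omega_coact hC hA hB hw hnd hY rY);
    assert (k' := omega_coact_hom hC hA hB hnd hY rY).
  revert h k h' k'; generalize (ycoact (Ω X)), (ycoact (Ω Y)); intros d d' h k h' k'.
  split; intros e.
  - apply (@inj_r (ycar X) (ycar Y)); try typed.
    transitivity ((τ (ycar Y) d') ∘ (f ⊗ id a)); [diag|].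
    transitivity (f ∘ (τ (ycar X) d)); [|diag].
    rewrite h, h'; diag with e.
  - transitivity (f ∘ (yact X ∘ cinv a (ycar X)) ∘ c a (ycar X)); [diag|].
    transitivity ((yact Y ∘ cinv a (ycar Y)) ∘ (f ⊗ id a) ∘ c a (ycar X)); [|diag].
    rewrite <- h, <- h'; symmetry; diag with e.
Qed.

(** Up to inverse braidings, which are linear by [omega_tens_linear], the braiding over [B]
    is the one over [A] in the opposite order; and [omega_linear] translates between
    linearity over [B] and colinearity over [A]. *)
Lemma omega_braid_linear X Y : is_module A X -> is_comodule A X -> is_comodule A Y ->
  (colinear A (yd_tens A Y X) (yd_tens A X Y) (yd_braid A Y X) <->
   linear B (yd_tens B (Ω X) (Ω Y)) (yd_tens B (Ω Y) (Ω X)) (yd_braid B (Ω X) (Ω Y))).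
Proof.
  intros hX hX' hY.
  assert (mX := omega_module hC hA hB hw hX'); assert (mY := omega_module hC hA hB hw hY).
  assert (cXY := comodule_tens hC hA hX' hY); assert (cYX := comodule_tens hC hA hY hX').
  assert (mXY := module_tens hC hB mX mY); assert (mYX := module_tens hC hB mY mX).
  assert (oXY := omega_module hC hA hB hw cXY); assert (oYX := omega_module hC hA hB hw cYX).
  assert (e1 := omega_tens_linear hC hA hB hw hX' hY).
  assert (e2 := omega_tens_linear hC hA hB hw hY hX').
  assert (oX := comod_ob hX'); assert (oY := comod_ob hY).
  assert (i1 := inverse_sym (braid_inverse hC oY oX)).
  assert (i2 := inverse_sym (braid_inverse hC oX oY)).
  assert (hs := yd_braid_hom hC hA hY hX).
  assert (e3 := omega_linear (comod_ob cYX) (comod_ob cXY) (comod_hom cYX) (comod_hom cXY) hs).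
  rewrite e3; clear e3.
  assert (e4 := @linear_inverse C hC B hB (yd_tens B (Ω X) (Ω Y)) (Ω
    (yd_tens A Y X)) _ _ mXY oYX i1 e1).
  assert (e5 := @linear_inverse C hC B hB (yd_tens B (Ω Y) (Ω X)) (Ω
    (yd_tens A X Y)) _ _ mYX oXY i2 e2).
  split; intros e.
  - rewrite (omega_braid hC hA hB hw hnd hY hX).
    apply (@linear_comp C hC B hB _ (Ω (yd_tens A Y X)) _); auto;
      try (cbn [Omega_ob ycar yd_tens]; typed).
    apply (@linear_comp C hC B hB _ (Ω (yd_tens A X Y)) _); auto;
      try (cbn [Omega_ob ycar yd_tens]; typed).
  - assert (e' : yd_braid A Y X = cinv (ycar X) (ycar Y) ∘ yd_braid B (Ω X) (Ω Y)
      ∘ c (ycar Y) (ycar X)).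
    { rewrite (omega_braid hC hA hB hw hnd hY hX); symmetry; diag. }
    assert (hs' : hom C (ycar X ⊗ ycar Y) (ycar Y ⊗ ycar X) (yd_braid B (Ω X) (Ω Y))).
    { rewrite (omega_braid hC hA hB hw hnd hY hX); typed. }
    rewrite e'.
    apply (@linear_comp C hC B hB _ (yd_tens B (Ω X) (Ω Y)) _); auto;
      try (cbn [Omega_ob ycar yd_tens]; typed).
    apply (@linear_comp C hC B hB _ (yd_tens B (Ω Y) (Ω X)) _); auto;
      try (cbn [Omega_ob ycar yd_tens]; typed).
Qed.

(** The regular module over [B] is the image of a comodule over [A], so that
    [omega_braid_linear] and [linear_yd_condition] apply. *)
Lemma omega_yd X : is_yd A X -> is_yd B (Ω X).
Proof.
  intros hX.
  assert (mX := omega_module hC hA hB hw (yd_comodule hX)).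
  assert (cX := omega_comodule hC hA hB hw hnd (yd_module hX)).
  apply yd_intro; auto.
  apply (linear_yd_condition hC hB mX cX).
  assert (mR := module_regular hB); assert (cR := comodule_regular hB).
  rewrite <- (Omega_inv_r (mod_ob mR) (mod_hom mR) (comod_hom cR)).
  assert (cY := Omega_inv_comodule (comod_hom cR) mR).
  apply omega_braid_linear; auto using yd_module, yd_comodule.
  apply yd_braid_colinear; auto.
Qed.

Lemma omega_inv_yd Z : is_yd B Z -> is_yd A (Ωi Z).
Proof.
  intros hZ; assert (e := Omega_inv_r (yd_ob hZ) (yd_act_hom hZ) (yd_coact_hom hZ)).
  assert (cX := Omega_inv_comodule (yd_coact_hom hZ) (yd_module hZ)).
  assert (mX := Omega_inv_module (yd_act_hom hZ) (yd_comodule hZ)).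
  apply yd_intro; auto.
  apply (colinear_yd_condition hC hA mX cX).
  apply omega_braid_linear; auto using comodule_regular.
  rewrite e; apply yd_braid_linear; auto.
  apply (omega_module hC hA hB hw); apply comodule_regular; auto.
Qed.

Lemma omega_morphism X Y f : is_yd_morphism A X Y f -> is_yd_morphism B (Ω X) (Ω Y) f.
Proof.
  intros [hX hY hf e1 e2]; constructor; auto using omega_yd.
  - apply omega_linear; auto; apply _ || typed.
  - apply omega_colinear; auto; apply _ || typed.
Qed.

Lemma omega_inv_morphism X Y f : is_yd_morphism B X Y f -> is_yd_morphism A (Ωi X) (Ωi Y) f.
Proof.
  intros [hX hY hf e1 e2].
  assert (hX' := omega_inv_yd hX); assert (hY' := omega_inv_yd hY).
  rewrite <- (Omega_inv_r (yd_ob hX) (yd_act_hom hX) (yd_coact_hom hX)) in e1, e2.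
  rewrite <- (Omega_inv_r (yd_ob hY) (yd_act_hom hY) (yd_coact_hom hY)) in e1, e2.
  constructor; auto.
  - apply (omega_colinear (yd_ob hX') (yd_ob hY') (yd_act_hom hX') (yd_act_hom hY') hf); exact e2.
  - apply (omega_linear (yd_ob hX') (yd_ob hY') (yd_coact_hom hX') (yd_coact_hom hY') hf); exact e1.
Qed.

Lemma omega_unit : Ω (yd_unit A) = yd_unit B.
Proof.
  assert (h := module_unit hC hA); assert (h' := comodule_unit hC hA).
  apply ydData_eq; [reflexivity | |].
  - rewrite (omega_act hC hA hB hw (comod_ob h') (comod_hom h')); cbn [yd_unit ycar yact ycoact].
    assert (e := turned_one_r hC hA hB hw); diag with e.
  - assert (k := omega_coact_hom hC hA hB hnd (mod_ob h) (mod_hom h)).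
    assert (e := omega_coact hC hA hB hw hnd (mod_ob h) (mod_hom h)).
    assert (e1 := turned_one_l hC hA hB hw).
    change (ycar (yd_unit A)) with (unit1 C)%ob in *;
      change (yact (yd_unit A)) with (hcounit A) in *.
    assert (o := unit_ob hC).
    assert (k' : hom C 𝟏 (b ⊗ 𝟏) (hone B)) by typed.
    apply (@inj_r 𝟏%ob 𝟏%ob); auto; cbn [yd_unit ycoact];
      change (ycar (Ω (yd_unit A))) with (unit1 C) in *.
    rewrite e; diag with e1.
Qed.

(** [Omega2] is an inverse braiding followed by the braiding over [A], which are morphisms
    over [B] separately. *)
Lemma omega2_morphism X Y : is_yd A X -> is_yd A Y ->
  is_yd_morphism B (yd_tens B (Ω X) (Ω Y)) (Ω (yd_tens A X Y)) (Omega2 A X Y).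
Proof.
  intros hX hY; unfold Omega2.
  assert (hX' := omega_yd hX); assert (hY' := omega_yd hY).
  assert (h1 := yd_tens_yd hC hA hX hY); assert (h2 := yd_tens_yd hC hA hY hX).
  apply (comp_hom (yd_braided_category hC hB)) with (Y := Ω (yd_tens A Y X)).
  - constructor; auto using yd_tens_yd, omega_yd.
    + cbn [Omega_ob ycar yd_tens]; typed.
    + apply omega_tens_linear; auto using yd_comodule.
    + apply omega_tens_colinear; auto using yd_module.
  - apply omega_morphism, yd_braid_morphism; auto.
Qed.

Lemma omega2_inverse X Y : is_yd A X -> is_yd A Y ->
  is_inverse (C := YD B) (yd_tens B (Ω X) (Ω Y)) (Ω (yd_tens A X Y)) (Omega2 A X Y)
    (c (ycar Y) (ycar X) ∘ yd_braid_inv A Y X).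
Proof.
  intros hX hY; apply yd_inverse; auto using omega2_morphism.
  apply (inverse_comp hC (Y := (ycar Y ⊗ ycar X)%ob)).
  - exact (inverse_sym (braid_inverse hC (yd_ob hY) (yd_ob hX))).
  - apply yd_braid_inverse; auto using yd_module, yd_comodule.
Qed.

Lemma omega2_natural X X' Y Y' f g : is_yd_morphism A X X' f -> is_yd_morphism A Y Y' g ->
  Omega2 A X' Y' ∘ (f ⊗ g) = (f ⊗ g) ∘ Omega2 A X Y.
Proof.
  intros [hX hX' hf e1 _] [hY hY' hg _ e2]; unfold Omega2, yd_braid.
  diag with (e1, e2).
Qed.

(** After pulling the inverse braidings of [C] apart, both sides are three braidings of
    Yetter-Drinfel'd modules, and they agree by the Yang-Baxter equation. *)
Lemma omega2_assoc X Y Z : is_yd A X -> is_yd A Y -> is_yd A Z ->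
  Omega2 A (yd_tens A X Y) Z ∘ (Omega2 A X Y ⊗ id (ycar Z)) =
  Omega2 A X (yd_tens A Y Z) ∘ (id (ycar X) ⊗ Omega2 A Y Z).
Proof.
  intros hX hY hZ; unfold Omega2.
  assert (hXY := yd_tens_yd hC hA hX hY); assert (hYX := yd_tens_yd hC hA hY hX).
  assert (e : yd_braid A Z (yd_tens A X Y) ∘ (id (ycar Z) ⊗ yd_braid A Y X) =
    (yd_braid A Y X ⊗ id (ycar Z)) ∘ yd_braid A Z (yd_tens A Y X)).
  { apply (braid_natural (yd_braided_category hC hA)) with (X := Z) (f := id (ycar Z)).
    - apply (id_hom (yd_braided_category hC hA) hZ).
    - apply yd_braid_morphism; auto. }
  assert (e1 := yd_braid_tens_r hC hA (yd_comodule hZ) (yd_module hY) (yd_module hX)).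
  assert (e2 := yd_braid_tens_l hC hA (yd_comodule hY) (yd_comodule hZ) (yd_module hX)).
  rewrite e1 in e; rewrite e2; clear e1 e2.
  assert (h1 := yd_braid_hom hC hA (yd_comodule hZ) (yd_module hXY)).
  assert (h2 := yd_braid_hom hC hA (yd_comodule hY) (yd_module hX)).
  assert (h3 := yd_braid_hom hC hA (yd_comodule hZ) (yd_module hX)).
  assert (h4 := yd_braid_hom hC hA (yd_comodule hZ) (yd_module hY)).
  change (ycar (yd_tens A X Y)) with (ycar X ⊗ ycar Y)%ob in *.
  change (ycar (yd_tens A Y Z)) with (ycar Y ⊗ ycar Z)%ob in *.
  diag with e.
Qed.

Lemma omega2_unit_l X : is_yd A X -> Omega2 A (yd_unit A) X = id (ycar X).
Proof.
  intros hX; unfold Omega2, yd_braid; cbn [yd_unit ycar yact ycoact].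
  diag with (yd_coact_counit hX).
Qed.
Lemma omega2_unit_r X : is_yd A X -> Omega2 A X (yd_unit A) = id (ycar X).
Proof.
  intros hX; unfold Omega2, yd_braid; cbn [yd_unit ycar yact ycoact].
  diag with (yd_act_one hX).
Qed.

Lemma omega2_braid X Y : is_yd A X -> is_yd A Y ->
  yd_braid A X Y ∘ Omega2 A X Y = Omega2 A Y X ∘ yd_braid B (Ω X) (Ω Y).
Proof.
  intros hX hY; rewrite (omega_braid hC hA hB hw hnd (yd_comodule hY) (yd_module hX)).
  assert (h1 := yd_braid_hom hC hA (yd_comodule hX) (yd_module hY)).
  assert (h2 := yd_braid_hom hC hA (yd_comodule hY) (yd_module hX)).
  unfold Omega2; diag.
Qed.

Lemma omega_braided : is_braided_functor (Omega A B w).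
Proof.
  assert (hYA := yd_braided_category hC hA); assert (hYB := yd_braided_category hC hB).
  constructor; auto.
  - constructor; simpl; auto using omega_yd, omega_morphism.
  - intros X Y hX hY; eexists; apply omega2_inverse; auto.
  - simpl; rewrite omega_unit; exists (idm C 𝟏); apply (inverse_id hYB (unit_ob hYB)).
  - intros X X' Y Y' f g; apply omega2_natural.
  - exact omega2_assoc.
  - intros X hX; change (is_yd A X) in hX; simpl; rewrite omega2_unit_l by auto; diag.
  - intros X hX; change (is_yd A X) in hX; simpl; rewrite omega2_unit_r by auto; diag.
  - exact omega2_braid.
Qed.

Definition Omega_inv : functorData (YD B) (YD A) :=
  FunctorData (C := YD B) (D := YD A) Omega_inv_ob (fun _ _ f => f) (fun _ _ => id 𝟏) (idm C 𝟏).

Lemma omega_inverse : are_inverse (Omega A B w) Omega_inv.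
Proof.
  constructor; try constructor; simpl; auto using omega_yd, omega_morphism, omega_inv_yd,
    omega_inv_morphism.
  - intros X hX; apply Omega_inv_l; apply hX.
  - intros X hX; apply Omega_inv_r; apply hX.
Qed.

End OmegaFunctor.

(** * Hopf algebras under a braided functor

    A braided functor sends Hopf algebras to Hopf algebras and their Yetter-Drinfel'd
    modules to Yetter-Drinfel'd modules.  For every law there is an equation that
    expresses the image of either side by the transported structure, composed with an
    isomorphism built from the monoidal structure [m]; the same equations
    serve to transport a law and to reflect it. *)

Section Induced.

Variables D E : catData.
Reserved Notation "X ⊠ Y" (at level 38, left associativity).
Reserved Notation "g • f" (at level 40, left associativity).
Local Notation "X ⊗ Y" := (tens D X Y) : ob_scope.
Local Notation "f ⊗ g" := (tensm D f g) : mor_scope.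
Local Notation "g ∘ f" := (comp D g f) : mor_scope.
Local Notation "X ⊠ Y" := (tens E X Y) : ob_scope.
Local Notation "f ⊠ g" := (tensm E f g) : mor_scope.
Local Notation "g • f" := (comp E g f) : mor_scope.
Local Notation "𝟏" := (unit1 D) : ob_scope.
Local Notation id := (idm D).
Local Notation ie := (idm E).
Local Notation c := (braid D).
Local Notation ce := (braid E).
Local Open Scope mor_scope.
Hypothesis hD : is_braided_category D.
Hypothesis hE : is_braided_category E.

Variable F : functorData D E.
Hypothesis hF : is_braided_functor F.
Hypothesis F_unit : fob F 𝟏 = unit1 E.
Hypothesis F_eta : feta F = ie (unit1 E).
Local Notation m := (fmu F).
Variable mi : ob D -> ob D -> mor E.
Hypothesis hmi : forall X Y, isob D X -> isob D Y ->
  is_inverse (C := E) (fob F X ⊠ fob F Y) (fob F (X ⊗ Y)) (m X Y) (mi X Y).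

Let F_ob X : isob D X -> isob E (fob F X) := @functor_ob _ _ F (braided_functor hF) X.
Let F_hom X Y f : hom D X Y f -> hom E (fob F X) (fob F Y) (fmap F X Y f) :=
  @functor_hom _ _ F (braided_functor hF) X Y f.
Let F_comp X Y Z f g : hom D X Y f -> hom D Y Z g ->
    fmap F X Z (comp D g f) = comp E (fmap F Y Z g) (fmap F X Y f) :=
  @functor_map_comp _ _ F (braided_functor hF) X Y Z f g.

#[local] Instance F_is_obj X : is_obj X -> is_obj (fob F X).
Proof. apply F_ob. Qed.
#[local] Instance F_is_hom X Y f : is_hom X Y f -> is_hom (fob F X) (fob F Y) (fmap F X Y f).
Proof. apply F_hom. Qed.
#[local] Instance tens_is_obj X Y : is_obj X -> is_obj Y -> is_obj (X ⊗ Y)%ob.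
Proof. intros; apply tens_ob; auto. Qed.
#[local] Instance unit_is_obj : is_obj 𝟏%ob.
Proof. apply (unit_ob hD). Qed.
#[local] Instance m_is_hom X Y : is_obj X -> is_obj Y ->
  is_hom (fob F X ⊠ fob F Y)%ob (fob F (X ⊗ Y)) (m X Y) | 5.
Proof. intros hX hY; apply (hmi hX hY). Qed.
#[local] Instance mi_is_hom X Y : is_obj X -> is_obj Y ->
  is_hom (fob F (X ⊗ Y)) (fob F X ⊠ fob F Y)%ob (mi X Y) | 5.
Proof. intros hX hY; apply (hmi hX hY). Qed.
#[local] Instance m_is_hom' X Y Z : is_obj X -> is_obj Y -> is_obj Z ->
  is_hom (fob F X ⊠ fob F (Y ⊗ Z))%ob (fob F (X ⊗ Y ⊗ Z)) (m X (Y ⊗ Z)%ob) | 4.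
Proof. intros hX hY hZ; rewrite <- (tens_assoc hD hX hY hZ); apply m_is_hom; apply _. Qed.

#[local] Hint Extern 6 (is_hom _ _ (fmap F ?X ?Y ?f)) =>
  (refine (@F_hom X Y f _); typed) : typeclass_instances.

Lemma F_tens_l X X' Y f : hom D X X' f -> isob D Y ->
  fmap F (X ⊗ Y) (X' ⊗ Y) (f ⊗ id Y) • m X Y = m X' Y • (fmap F X X' f ⊠ ie (fob F Y)).
Proof.
  intros hf hY; rewrite <- (functor_map_id (braided_functor hF) hY); symmetry.
  apply (braided_mu_natural hF hf (id_hom hD hY)).
Qed.

Lemma F_tens_r X Y Y' f : hom D Y Y' f -> isob D X ->
  fmap F (X ⊗ Y) (X ⊗ Y') (id X ⊗ f) • m X Y = m X Y' • (ie (fob F X) ⊠ fmap F Y Y' f).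
Proof.
  intros hf hX; rewrite <- (functor_map_id (braided_functor hF) hX); symmetry.
  apply (braided_mu_natural hF (id_hom hD hX) hf).
Qed.

Lemma m_unit_l X : isob D X -> m 𝟏 X = ie (fob F X).
Proof.
  intros hX; assert (e := braided_mu_unit_l hF hX).
  rewrite F_eta in e; rewrite <- e; clear e.
  assert (h := F_ob hX); rewrite (tensm_id hE (unit_ob hE) h), (unit_tens hE h).
  assert (h' := m_is_hom (X := 𝟏%ob) (Y := X) _ hX).
  unfold is_hom in h'; rewrite F_unit, (unit_tens hE h) in h'.
  symmetry; exact (comp_id hE h').
Qed.

Lemma m_unit_r X : isob D X -> m X 𝟏 = ie (fob F X).
Proof.
  intros hX; assert (e := braided_mu_unit_r hF hX).
  rewrite F_eta in e; rewrite <- e; clear e.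
  assert (h := F_ob hX); rewrite (tensm_id hE h (unit_ob hE)), (tens_unit hE h).
  assert (h' := m_is_hom (X := X) (Y := 𝟏%ob) hX _).
  unfold is_hom in h'; rewrite F_unit, (tens_unit hE h) in h'.
  symmetry; exact (comp_id hE h').
Qed.

Lemma m_assoc x y z : isob D x -> isob D y -> isob D z ->
  m (x ⊗ y)%ob z • (m x y ⊠ ie (fob F z)) = m x (y ⊗ z)%ob • (ie (fob F x) ⊠ m y z).
Proof. apply (braided_mu_assoc hF). Qed.

(** The exchange of the two middle factors occurs in the compatibility between products and
    coproducts, in that of actions and coactions, and in tensor products of modules. *)
Lemma m_middle p q r s : isob D p -> isob D q -> isob D r -> isob D s ->
  fmap F (p ⊗ q ⊗ r ⊗ s) (p ⊗ r ⊗ q ⊗ s) (id p ⊗ c q r ⊗ id s) •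
    (m (p ⊗ q)%ob (r ⊗ s)%ob • (m p q ⊠ m r s)) =
  m (p ⊗ r)%ob (q ⊗ s)%ob • (m p r ⊠ m q s) •
    (ie (fob F p) ⊠ ce (fob F q) (fob F r) ⊠ ie (fob F s)).
Proof.
  intros hp hq hr hs.
  assert (hb : hom D (q ⊗ r) (r ⊗ q) (c q r)) by typed; assert (hb' := F_hom hb).
  assert (hpb : hom D (p ⊗ q ⊗ r) (p ⊗ r ⊗ q) (id p ⊗ c q r)) by typed; assert (hpb' := F_hom hpb).
  assert (b := braided_mu_braid hF hq hr).
  assert (e1 := F_tens_r hb hp); rewrite !(tens_assoc hD) in e1 by auto.
  assert (e2 := F_tens_l hpb hs).
  assert (a1 := m_assoc (tens_ob hD hp hq) hr hs); assert (a2 := m_assoc (tens_ob hD hp hr) hq hs).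
  assert (a3 := m_assoc hp hq hr); assert (a4 := m_assoc hp hr hq).
  transitivity (fmap F (p ⊗ q ⊗ r ⊗ s) (p ⊗ r ⊗ q ⊗ s) (id p ⊗ c q r ⊗ id s) • m (p ⊗ q ⊗ r)%ob s •
    ((m p (q ⊗ r)%ob • (ie (fob F p) ⊠ m q r)) ⊠ ie (fob F s))).
  - diag with (a1, a3).
  - transitivity (m (p ⊗ r ⊗ q)%ob s • ((m p (r ⊗ q)%ob • (ie (fob F p) ⊠ m r q)) ⊠ ie (fob F s)) •
      (ie (fob F p) ⊠ ce (fob F q) (fob F r) ⊠ ie (fob F s))).
    + diag with (e1, e2, b).
    + diag with (a2, a4).
Qed.

(** For [x] equal to [k] these also transport the product and the coproduct. *)
Definition act k x ρ := fmap F (k ⊗ x) x ρ • m k x.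
Definition coact k x δ := mi k x • fmap F x (k ⊗ x) δ.

Lemma act_hom k x ρ : isob D k -> isob D x ->
  hom D (k ⊗ x) x ρ -> hom E (fob F k ⊠ fob F x) (fob F x) (act k x ρ).
Proof. intros hk hx h; unfold act; typed. Qed.
Lemma coact_hom k x δ : isob D k -> isob D x ->
  hom D x (k ⊗ x) δ -> hom E (fob F x) (fob F k ⊠ fob F x) (coact k x δ).
Proof. intros hk hx h; unfold coact; typed. Qed.

Lemma coact_spec k x δ : isob D k -> isob D x -> hom D x (k ⊗ x) δ ->
  fmap F x (k ⊗ x) δ = m k x • coact k x δ.
Proof.
  intros hk hx h; unfold coact; destruct (hmi hk hx) as (h1 & h2 & _ & e).
  rewrite (comp_assoc hE (F_hom h) h2 h1), e; symmetry; exact (id_comp hE (F_hom h)).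
Qed.

Section Arrows.
Variables k x y : ob D.
Hypothesis k_ob : isob D k.
Hypothesis x_ob : isob D x.
Hypothesis y_ob : isob D y.

Lemma act_mul mul ρ : hom D (k ⊗ k) k mul -> hom D (k ⊗ x) x ρ ->
  fmap F (k ⊗ k ⊗ x) x (ρ ∘ (mul ⊗ id x)) • (m (k ⊗ k)%ob x • (m k k ⊠ ie (fob F x))) =
  act k x ρ • (act k k mul ⊠ ie (fob F x)).
Proof.
  intros hm hr; unfold act.
  assert (h : hom D (k ⊗ k ⊗ x) (k ⊗ x) (mul ⊗ id x)) by typed.
  rewrite (F_comp h hr); diag with (F_tens_l hm x_ob).
Qed.

Lemma act_act ρ : hom D (k ⊗ x) x ρ ->
  fmap F (k ⊗ k ⊗ x) x (ρ ∘ (id k ⊗ ρ)) • (m (k ⊗ k)%ob x • (m k k ⊠ ie (fob F x))) =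
  act k x ρ • (ie (fob F k) ⊠ act k x ρ).
Proof.
  intros hr; unfold act; rewrite m_assoc by auto.
  assert (h : hom D (k ⊗ k ⊗ x) (k ⊗ x) (id k ⊗ ρ)) by typed.
  assert (e := F_tens_r hr k_ob); rewrite (tens_assoc hD k_ob k_ob x_ob) in e.
  rewrite (F_comp h hr); diag with e.
Qed.

Lemma act_one one ρ : hom D 𝟏 k one -> hom D (k ⊗ x) x ρ ->
  fmap F x x (ρ ∘ (one ⊗ id x)) = act k x ρ • (fmap F 𝟏 k one ⊠ ie (fob F x)).
Proof.
  intros ho hr; unfold act.
  assert (h : hom D x (k ⊗ x) (one ⊗ id x)) by typed.
  assert (e := F_tens_l ho x_ob); rewrite m_unit_l, (unit_tens hD x_ob) in e by auto.
  assert (ho' := F_hom ho); rewrite F_unit in ho'.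
  rewrite (F_comp h hr); diag with e.
Qed.

Lemma coact_comul comul δ : hom D k (k ⊗ k) comul -> hom D x (k ⊗ x) δ ->
  fmap F x (k ⊗ k ⊗ x) ((comul ⊗ id x) ∘ δ) =
  (m (k ⊗ k)%ob x • (m k k ⊠ ie (fob F x))) • ((coact k k comul ⊠ ie (fob F x)) • coact k x δ).
Proof.
  intros hm hd; assert (h : hom D (k ⊗ x) (k ⊗ k ⊗ x) (comul ⊗ id x)) by typed.
  assert (c1 := coact_hom k_ob k_ob hm); assert (c2 := coact_hom k_ob x_ob hd).
  rewrite (F_comp hd h).
  diag with (F_tens_l hm x_ob, coact_spec k_ob k_ob hm, coact_spec k_ob x_ob hd).
Qed.

Lemma coact_coact δ : hom D x (k ⊗ x) δ ->
  fmap F x (k ⊗ k ⊗ x) ((id k ⊗ δ) ∘ δ) =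
  (m (k ⊗ k)%ob x • (m k k ⊠ ie (fob F x))) • ((ie (fob F k) ⊠ coact k x δ) • coact k x δ).
Proof.
  intros hd; rewrite m_assoc by auto.
  assert (h : hom D (k ⊗ x) (k ⊗ k ⊗ x) (id k ⊗ δ)) by typed.
  assert (c2 := coact_hom k_ob x_ob hd).
  assert (e := F_tens_r hd k_ob); rewrite (tens_assoc hD k_ob k_ob x_ob) in e.
  rewrite (F_comp hd h); diag with (e, coact_spec k_ob x_ob hd).
Qed.

Lemma coact_counit counit δ : hom D k 𝟏 counit -> hom D x (k ⊗ x) δ ->
  fmap F x x ((counit ⊗ id x) ∘ δ) = (fmap F k 𝟏 counit ⊠ ie (fob F x)) • coact k x δ.
Proof.
  intros ho hd; assert (h : hom D (k ⊗ x) x (counit ⊗ id x)) by typed.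
  assert (c2 := coact_hom k_ob x_ob hd).
  assert (e := F_tens_l ho x_ob); rewrite m_unit_l, (unit_tens hD x_ob) in e by auto.
  assert (ho' := F_hom ho); rewrite F_unit in ho'.
  rewrite (F_comp hd h); diag with (e, coact_spec k_ob x_ob hd).
Qed.

(** The arrows of this shape are the braidings of Yetter-Drinfel'd modules and
    the two halves of the right-hand side of their compatibility condition. *)
Lemma transport_braid ρ δ : hom D (k ⊗ x) x ρ -> hom D y (k ⊗ y) δ ->
  fmap F (y ⊗ x) (x ⊗ y) ((ρ ⊗ id y) ∘ (id k ⊗ c y x) ∘ (δ ⊗ id x)) • m y x =
  m x y • ((act k x ρ ⊠ ie (fob F y)) • (ie (fob F k) ⊠ ce (fob F y) (fob F x))
    • (coact k y δ ⊠ ie (fob F x))).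
Proof.
  intros hr hd; unfold act.
  assert (h1 : hom D (y ⊗ x) (k ⊗ y ⊗ x) (δ ⊗ id x)) by typed.
  assert (h2 : hom D (k ⊗ y ⊗ x) (k ⊗ x ⊗ y) (id k ⊗ c y x)) by typed.
  assert (h3 : hom D (k ⊗ x ⊗ y) (x ⊗ y) (ρ ⊗ id y)) by typed.
  assert (hc := coact_hom k_ob y_ob hd).
  assert (hb : hom D (y ⊗ x) (x ⊗ y) (c y x)) by typed; assert (hb' := F_hom hb).
  assert (e1 := F_tens_l hd x_ob); assert (e3 := F_tens_l hr y_ob).
  assert (e2 := F_tens_r hb k_ob); rewrite !(tens_assoc hD) in e2 by auto.
  rewrite (F_comp h1 (comp_hom hD h2 h3)), (F_comp h2 h3).
  diag with (e1, coact_spec k_ob y_ob hd, m_assoc k_ob y_ob x_ob, m_assoc k_ob x_ob y_ob,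
    braided_mu_braid hF y_ob x_ob, e2, e3).
Qed.

Lemma transport_compat mul comul ρ δ : hom D (k ⊗ k) k mul -> hom D k (k ⊗ k) comul ->
  hom D (k ⊗ x) x ρ -> hom D x (k ⊗ x) δ ->
  fmap F (k ⊗ x) (k ⊗ x) ((mul ⊗ ρ) ∘ (id k ⊗ c k k ⊗ id x) ∘ (comul ⊗ δ)) • m k x =
  m k x • ((act k k mul ⊠ act k x ρ) • (ie (fob F k) ⊠ ce (fob F k) (fob F k) ⊠ ie (fob F x))
     • (coact k k comul ⊠ coact k x δ)).
Proof.
  intros hm hm' hr hd; unfold act.
  assert (h1 : hom D (k ⊗ x) (k ⊗ k ⊗ k ⊗ x) (comul ⊗ δ)) by typed.
  assert (h2 : hom D (k ⊗ k ⊗ k ⊗ x) (k ⊗ k ⊗ k ⊗ x) (id k ⊗ c k k ⊗ id x)) by typed.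
  assert (h3 : hom D (k ⊗ k ⊗ k ⊗ x) (k ⊗ x) (mul ⊗ ρ)) by typed.
  assert (c1 := coact_hom k_ob k_ob hm'); assert (c2 := coact_hom k_ob x_ob hd).
  assert (e1 := braided_mu_natural hF hm' hd); assert (e3 := braided_mu_natural hF hm hr).
  rewrite (tens_assoc hD (tens_ob hD k_ob k_ob) k_ob x_ob) in e1, e3.
  rewrite (F_comp h1 (comp_hom hD h2 h3)), (F_comp h2 h3).
  diag with (e1, coact_spec k_ob k_ob hm', coact_spec k_ob x_ob hd, m_middle k_ob k_ob k_ob x_ob,
    e3).
Qed.

Lemma act_tens comul ρ ρ' : hom D k (k ⊗ k) comul ->
  hom D (k ⊗ x) x ρ -> hom D (k ⊗ y) y ρ' ->
  act k (x ⊗ y)%ob ((ρ ⊗ ρ') ∘ (id k ⊗ c k x ⊗ id y) ∘ (comul ⊗ id (x ⊗ y)))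
    • (ie (fob F k) ⊠ m x y) =
  m x y • ((act k x ρ ⊠ act k y ρ') • (ie (fob F k) ⊠ ce (fob F k) (fob F x) ⊠ ie (fob F y))
    • (coact k k comul ⊠ ie (fob F x ⊠ fob F y))).
Proof.
  intros hm hr hr'; unfold act.
  assert (h1 : hom D (k ⊗ x ⊗ y) (k ⊗ k ⊗ x ⊗ y) (comul ⊗ id (x ⊗ y))) by typed.
  assert (h2 : hom D (k ⊗ k ⊗ x ⊗ y) (k ⊗ x ⊗ k ⊗ y) (id k ⊗ c k x ⊗ id y)) by typed.
  assert (h3 : hom D (k ⊗ x ⊗ k ⊗ y) (x ⊗ y) (ρ ⊗ ρ')) by typed.
  assert (hc := coact_hom k_ob k_ob hm).
  assert (e1 := F_tens_l hm (tens_ob hD x_ob y_ob)); assert (e3 := braided_mu_natural hF hr hr').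
  rewrite (tens_assoc hD k_ob x_ob y_ob), (tens_assoc hD (tens_ob hD k_ob k_ob) x_ob y_ob) in e1.
  rewrite (tens_assoc hD (tens_ob hD k_ob x_ob) k_ob y_ob) in e3.
  rewrite (tens_assoc hD) by auto.
  rewrite (F_comp h1 (comp_hom hD h2 h3)), (F_comp h2 h3).
  diag with (e1, coact_spec k_ob k_ob hm, m_middle k_ob k_ob x_ob y_ob, e3).
Qed.

Lemma coact_tens mul δ δ' : hom D (k ⊗ k) k mul ->
  hom D x (k ⊗ x) δ -> hom D y (k ⊗ y) δ' ->
  coact k (x ⊗ y)%ob ((mul ⊗ id (x ⊗ y)) ∘ (id k ⊗ c x k ⊗ id y) ∘ (δ ⊗ δ')) • m x y =
  (ie (fob F k) ⊠ m x y) • ((act k k mul ⊠ ie (fob F x ⊠ fob F y))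
    • (ie (fob F k) ⊠ ce (fob F x) (fob F k) ⊠ ie (fob F y))
    • (coact k x δ ⊠ coact k y δ')).
Proof.
  intros hm hd hd'; unfold coact at 1; unfold act.
  assert (h1 : hom D (x ⊗ y) (k ⊗ x ⊗ k ⊗ y) (δ ⊗ δ')) by typed.
  assert (h2 : hom D (k ⊗ x ⊗ k ⊗ y) (k ⊗ k ⊗ x ⊗ y) (id k ⊗ c x k ⊗ id y)) by typed.
  assert (h3 : hom D (k ⊗ k ⊗ x ⊗ y) (k ⊗ x ⊗ y) (mul ⊗ id (x ⊗ y))) by typed.
  assert (c1 := coact_hom k_ob x_ob hd); assert (c2 := coact_hom k_ob y_ob hd').
  assert (e1 := braided_mu_natural hF hd hd'); assert (e3 := F_tens_l hm (tens_ob hD x_ob y_ob)).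
  rewrite (tens_assoc hD (tens_ob hD k_ob x_ob) k_ob y_ob) in e1.
  destruct (hmi k_ob (tens_ob hD x_ob y_ob)) as (mh & mih & e4 & _).
  rewrite (tens_assoc hD k_ob x_ob y_ob), (tens_assoc hD (tens_ob hD k_ob k_ob) x_ob y_ob) in e3.
  rewrite (tens_assoc hD k_ob x_ob y_ob) in mh, mih |- *.
  rewrite (F_comp h1 (comp_hom hD h2 h3)), (F_comp h2 h3).
  diag with (e1, coact_spec k_ob x_ob hd, coact_spec k_ob y_ob hd', m_middle k_ob x_ob k_ob y_ob,
    e3, e4).
Qed.
End Arrows.

Lemma m_cancel_l X Y Z f g : isob D X -> isob D Y ->
  hom E Z (fob F X ⊠ fob F Y) f -> hom E Z (fob F X ⊠ fob F Y) g -> m X Y • f = m X Y • g -> f = g.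
Proof.
  intros hX hY hf hg; apply (iso_mono hE (X := (fob F X ⊠ fob F Y)%ob) (Y := fob F (X
    ⊗ Y)) (Z := Z)); auto.
  exists (mi X Y); auto.
Qed.

Lemma m_cancel_r X Y Z f g : isob D X -> isob D Y ->
  hom E (fob F (X ⊗ Y)) Z f -> hom E (fob F (X ⊗ Y)) Z g -> f • m X Y = g • m X Y -> f = g.
Proof.
  intros hX hY hf hg; apply (iso_epi hE (X := (fob F X ⊠ fob F Y)%ob) (Y := fob F (X
    ⊗ Y)) (Z := Z)); auto.
  exists (mi X Y); auto.
Qed.

Lemma m3_iso X Y Z : isob D X -> isob D Y -> isob D Z ->
  is_iso (fob F X ⊠ fob F Y ⊠ fob F Z)%ob (fob F (X ⊗ Y ⊗ Z)) (m (X ⊗ Y)%ob Z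
    • (m X Y ⊠ ie (fob F Z))).
Proof.
  intros hX hY hZ; eexists; eapply (inverse_comp hE).
  - apply (inverse_tens hE); [apply (hmi hX hY) | apply (inverse_id hE (F_ob hZ))].
  - apply hmi; auto; apply (tens_ob hD); auto.
Qed.

Section Hopf.
Variable K : hopfData D.
Hypothesis hK : is_hopf K.
Local Notation k := (hcar K).

Definition induced_hopf : hopfData E := HopfData (fob F k) (act k k (hmul K)) (fmap F 𝟏 k (hone K))
  (coact k k (hcomul K)) (fmap F k 𝟏 (hcounit K)) (fmap F k k (hanti K)).

Lemma act_one_r : fmap F k k (hmul K ∘ (id k ⊗ hone K)) = act k k (hmul K)
  • (ie (fob F k) ⊠ fmap F 𝟏 k (hone K)).
Proof.
  assert (ho := hopf_one_hom hK); assert (k_ob := hopf_ob hK); unfold act.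
  assert (h : hom D k (k ⊗ k) (id k ⊗ hone K)) by typed.
  assert (e := F_tens_r ho k_ob); rewrite m_unit_r, (tens_unit hD k_ob) in e by auto.
  assert (ho' := F_hom ho); rewrite F_unit in ho'.
  rewrite (F_comp h (hopf_mul_hom hK)); diag with e.
Qed.

Lemma coact_counit_r : fmap F k k ((id k ⊗ hcounit K) ∘ hcomul K)
  = (ie (fob F k) ⊠ fmap F k 𝟏 (hcounit K)) • coact k k (hcomul K).
Proof.
  assert (ho := hopf_counit_hom hK); assert (k_ob := hopf_ob hK); assert (hd := hopf_comul_hom hK).
  assert (h : hom D (k ⊗ k) k (id k ⊗ hcounit K)) by typed.
  assert (e := F_tens_r ho k_ob); rewrite m_unit_r, (tens_unit hD k_ob) in e by auto.
  assert (ho' := F_hom ho); rewrite F_unit in ho'.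
  assert (hc := coact_hom k_ob k_ob hd).
  rewrite (F_comp hd h); diag with (e, coact_spec k_ob k_ob hd).
Qed.

Lemma induced_convolution f g : hom D k k f -> hom D k k g ->
  act k k (hmul K) • (fmap F k k f ⊠ fmap F k k g) • coact k k (hcomul K) = fmap F k k (hmul K
    ∘ (f ⊗ g) ∘ hcomul K).
Proof.
  intros hf hg; assert (k_ob := hopf_ob hK); assert (hd := hopf_comul_hom hK); unfold act.
  assert (h : hom D (k ⊗ k) (k ⊗ k) (f ⊗ g)) by typed.
  assert (hc := coact_hom k_ob k_ob hd).
  rewrite (F_comp hd (comp_hom hD h (hopf_mul_hom hK))), (F_comp h (hopf_mul_hom hK)).
  diag with (braided_mu_natural hF hf hg, coact_spec k_ob k_ob hd).
Qed.

Lemma induced_is_hopf : is_hopf induced_hopf.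
Proof.
  destruct hK as [k_ob hm h1 hd he ma om mo ca cc cr cm em c1 e1 ia al ar].
  destruct (hmi k_ob k_ob) as (hmm & hmi' & i1 & i2).
  assert (u := unit_ob hD); assert (ha := iso_hom ia); assert (hi := id_hom hD k_ob).
  constructor; cbn [induced_hopf hcar hmul hone hcomul hcounit hanti].
  - auto.
  - apply act_hom; auto.
  - rewrite <- F_unit; auto.
  - apply coact_hom; auto.
  - rewrite <- F_unit; auto.
  - rewrite <- act_mul, <- act_act, ma by auto; reflexivity.
  - rewrite <- act_one, om by auto; apply (functor_map_id (braided_functor hF)); auto.
  - rewrite <- act_one_r, mo by auto; apply (functor_map_id (braided_functor hF)); auto.
  - assert (h := coact_hom k_ob k_ob hd).
    apply (iso_mono hE (m3_iso k_ob k_ob k_ob) (Z := fob F k)); try typed.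
    rewrite <- coact_comul, <- coact_coact, ca by auto; reflexivity.
  - rewrite <- coact_counit, cc by auto; apply (functor_map_id (braided_functor hF)); auto.
  - rewrite <- coact_counit_r, cr by auto; apply (functor_map_id (braided_functor hF)); auto.
  - assert (h := coact_hom k_ob k_ob hd); assert (h' := act_hom k_ob k_ob hm).
    apply (@m_cancel_l k k (fob F k ⊠ fob F k)%ob); try typed.
    rewrite <- transport_compat by auto.
    rewrite <- cm, (F_comp hm hd); unfold act; diag with (coact_spec k_ob k_ob hd).
  - assert (e := braided_mu_natural hF he he).
    rewrite m_unit_l, (tens_unit hD u), <- em, (F_comp hm he) in e by auto.
    assert (he' := F_hom he); rewrite F_unit in he', e.
    unfold act; transitivity (ie (unit1 E) • (fmap F k 𝟏 (hcounit K) ⊠ fmap F k 𝟏 (hcounit K)));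
      [|diag].
    rewrite e; diag.
  - assert (e := braided_mu_natural hF h1 h1).
    rewrite m_unit_l, (tens_unit hD u), <- c1, (F_comp h1 hd) in e by auto.
    assert (h1' := F_hom h1); rewrite F_unit in h1', e.
    unfold coact; transitivity (mi k k • (m k k • (fmap F 𝟏 k (hone K) ⊠ fmap F 𝟏 k (hone K)))).
    + rewrite e; diag.
    + diag with i1.
  - rewrite <- (F_comp h1 he), e1, <- F_unit; apply (functor_map_id (braided_functor hF)); auto.
  - apply (functor_iso (braided_functor hF)); auto.
  - rewrite <- (functor_map_id (braided_functor hF) k_ob), induced_convolution, al,
      (F_comp he h1) by auto.
    reflexivity.
  - rewrite <- (functor_map_id (braided_functor hF) k_ob), induced_convolution, ar,
      (F_comp he h1) by auto.
    reflexivity.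
Qed.

Definition induced_ob (X : ydData D) : ydData E :=
  YDData (fob F (ycar X)) (act k (ycar X) (yact X)) (coact k (ycar X) (ycoact X)).

(** Cutting the diagram after the action gives two diagrams to which [transport_braid]
    applies. *)
Lemma transport_compat_rhs x ρ δ : isob D x -> hom D (k ⊗ x) x ρ -> hom D x (k ⊗ x) δ ->
  fmap F (k ⊗ x) (k ⊗ x) ((hmul K ⊗ id x) ∘ (id k ⊗ c x k) ∘ (δ ⊗ id k) ∘ (ρ ⊗ id k)
      ∘ (id k ⊗ c k x) ∘ (hcomul K ⊗ id x)) • m k x =
  m k x • ((act k k (hmul K) ⊠ ie (fob F x)) • (ie (fob F k) ⊠ ce (fob F x) (fob F k)) •
    (coact k x δ ⊠ ie (fob F k)) • (act k x ρ ⊠ ie (fob F k))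
      • (ie (fob F k) ⊠ ce (fob F k) (fob F x))
     • (coact k k (hcomul K) ⊠ ie (fob F x))).
Proof.
  intros hx hr hd.
  assert (k_ob := hopf_ob hK).
  assert (e1 := transport_braid k_ob hx k_ob hr (hopf_comul_hom hK)).
  assert (e2 := transport_braid k_ob k_ob hx (hopf_mul_hom hK) hd).
  assert (h1 : hom D (k ⊗ x) (x ⊗ k) ((ρ ⊗ id k) ∘ (id k ⊗ c k x) ∘ (hcomul K ⊗ id x))) by typed.
  assert (h2 : hom D (x ⊗ k) (k ⊗ x) ((hmul K ⊗ id x) ∘ (id k ⊗ c x k) ∘ (δ ⊗ id k))) by typed.
  assert (e : (hmul K ⊗ id x) ∘ (id k ⊗ c x k) ∘ (δ ⊗ id k) ∘ (ρ ⊗ id k)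
      ∘ (id k ⊗ c k x) ∘ (hcomul K ⊗ id x) =
    ((hmul K ⊗ id x) ∘ (id k ⊗ c x k) ∘ (δ ⊗ id k)) ∘
    ((ρ ⊗ id k) ∘ (id k ⊗ c k x) ∘ (hcomul K ⊗ id x))) by diag.
  rewrite e, (F_comp h1 h2); clear e.
  assert (a1 := act_hom k_ob hx hr); assert (a2 := act_hom k_ob k_ob (hopf_mul_hom hK)).
  assert (a3 := coact_hom k_ob hx hd); assert (a4 := coact_hom k_ob k_ob (hopf_comul_hom hK)).
  diag with (e1, e2).
Qed.

Lemma induced_yd X : is_yd K X -> is_yd induced_hopf (induced_ob X).
Proof.
  intros [x_ob hr hd am a1 cc c1 e].
  assert (k_ob := hopf_ob hK); assert (hm := hopf_mul_hom hK); assert (hm' := hopf_comul_hom hK).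
  assert (ho := hopf_one_hom hK); assert (ho' := hopf_counit_hom hK).
  assert (b1 := act_hom k_ob x_ob hr); assert (b2 := act_hom k_ob k_ob hm).
  assert (b3 := coact_hom k_ob x_ob hd); assert (b4 := coact_hom k_ob k_ob hm').
  constructor; cbn [induced_ob induced_hopf ycar yact ycoact hcar hmul hone hcomul hcounit]; auto.
  - rewrite <- act_mul, <- act_act, am by auto; reflexivity.
  - rewrite <- act_one, a1 by auto; apply (functor_map_id (braided_functor hF)); auto.
  - apply (iso_mono hE (m3_iso k_ob k_ob x_ob) (Z := fob F (ycar X))); try typed.
    rewrite <- coact_comul, <- coact_coact, cc by auto; reflexivity.
  - rewrite <- coact_counit, c1 by auto; apply (functor_map_id (braided_functor hF)); auto.
  - apply (@m_cancel_l k (ycar X) (fob F k ⊠ fob F (ycar X))%ob); try typed.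
    rewrite <- transport_compat, <- transport_compat_rhs, e by auto; reflexivity.
Qed.

(** For a faithful functor the laws also descend; this provides the inverse functor. *)
Lemma induced_yd_reflect X :
  (forall X Y f g, hom D X Y f -> hom D X Y g -> fmap F X Y f = fmap F X Y g -> f = g) ->
  isob D (ycar X) -> hom D (k ⊗ ycar X) (ycar X) (yact X) ->
  hom D (ycar X) (k ⊗ ycar X) (ycoact X) -> is_yd induced_hopf (induced_ob X) -> is_yd K X.
Proof.
  intros F_faithful x_ob hr hd [_ _ _ am a1 cc c1 e].
  cbn [induced_ob induced_hopf ycar yact ycoact hcar hmul hone hcomul hcounit] in *.
  assert (k_ob := hopf_ob hK); assert (hm := hopf_mul_hom hK); assert (hm' := hopf_comul_hom hK).
  assert (ho := hopf_one_hom hK); assert (ho' := hopf_counit_hom hK).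
  constructor; auto.
  - apply (F_faithful ((k ⊗ k ⊗ ycar X)%ob) (ycar X)); try typed.
    apply (iso_epi hE (m3_iso k_ob k_ob x_ob) (Z := fob F (ycar X))); try typed.
    rewrite act_mul, act_act by auto; exact am.
  - apply (F_faithful (ycar X) (ycar X)); try typed.
    rewrite (act_one k_ob x_ob ho hr), (functor_map_id (braided_functor hF)) by auto; exact a1.
  - apply (F_faithful (ycar X) ((k ⊗ k ⊗ ycar X)%ob)); try typed.
    rewrite coact_comul, coact_coact, cc by auto; reflexivity.
  - apply (F_faithful (ycar X) (ycar X)); try typed.
    rewrite (coact_counit k_ob x_ob ho' hd), (functor_map_id (braided_functor hF)) by auto;
      exact c1.
  - apply (F_faithful ((k ⊗ ycar X)%ob) ((k ⊗ ycar X)%ob)); try typed.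
    apply (@m_cancel_r k (ycar X) (fob F (k ⊗ ycar X))); try typed.
    rewrite transport_compat, transport_compat_rhs, e by auto; reflexivity.
Qed.

Lemma induced_linear X Y f : is_yd K X -> is_yd K Y -> hom D (ycar X) (ycar Y) f ->
  f ∘ yact X = yact Y ∘ (id k ⊗ f) ->
  fmap F (ycar X) (ycar Y) f • act k (ycar X) (yact X) =
  act k (ycar Y) (yact Y) • (ie (fob F k) ⊠ fmap F (ycar X) (ycar Y) f).
Proof.
  intros hX hY hf e; unfold act.
  assert (h : hom D (k ⊗ ycar X) (k ⊗ ycar Y) (id k ⊗ f)) by typed.
  assert (r := F_comp (yd_act_hom hX) hf); rewrite e, (F_comp h (yd_act_hom hY)) in r.
  diag with (r, F_tens_r hf (hopf_ob hK)).
Qed.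

Lemma induced_colinear X Y f : is_yd K X -> is_yd K Y -> hom D (ycar X) (ycar Y) f ->
  ycoact Y ∘ f = (id k ⊗ f) ∘ ycoact X ->
  coact k (ycar Y) (ycoact Y) • fmap F (ycar X) (ycar Y) f =
  (ie (fob F k) ⊠ fmap F (ycar X) (ycar Y) f) • coact k (ycar X) (ycoact X).
Proof.
  intros hX hY hf e; assert (k_ob := hopf_ob hK).
  assert (cX := coact_hom k_ob (yd_ob hX) (yd_coact_hom hX)).
  assert (cY := coact_hom k_ob (yd_ob hY) (yd_coact_hom hY)).
  assert (h : hom D (k ⊗ ycar X) (k ⊗ ycar Y) (id k ⊗ f)) by typed.
  assert (r := F_comp hf (yd_coact_hom hY)); rewrite e, (F_comp (yd_coact_hom hX) h) in r.
  apply (@m_cancel_l k (ycar Y) (fob F (ycar X))); try typed.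
  symmetry; diag with (r, F_tens_r hf k_ob, coact_spec k_ob (yd_ob hX) (yd_coact_hom hX),
    coact_spec k_ob (yd_ob hY) (yd_coact_hom hY)).
Qed.

Lemma induced_morphism X Y f : is_yd_morphism K X Y f ->
  is_yd_morphism induced_hopf (induced_ob X) (induced_ob Y) (fmap F (ycar X) (ycar Y) f).
Proof.
  intros [hX hY hf e1 e2]; constructor; auto using induced_yd.
  - exact (F_hom hf).
  - exact (induced_linear hX hY hf e1).
  - exact (induced_colinear hX hY hf e2).
Qed.

Definition induced_functor : functorData (YD K) (YD induced_hopf) :=
  FunctorData (C := YD K) (D := YD induced_hopf) induced_ob
   (fun X Y f => fmap F (ycar X) (ycar Y) f) (fun X Y => m (ycar X) (ycar Y)) (ie (unit1 E)).

Lemma induced_is_functor : is_functor induced_functor.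
Proof.
  constructor.
  - exact induced_yd.
  - exact induced_morphism.
  - intros X hX; apply (functor_map_id (braided_functor hF)), hX.
  - intros X Y Z f g hf hg; apply (F_comp (yd_morphism_hom hf) (yd_morphism_hom hg)).
Qed.

Lemma induced_mu X Y : is_yd K X -> is_yd K Y ->
  is_inverse (C := YD induced_hopf) (yd_tens induced_hopf (induced_ob X) (induced_ob Y))
    (induced_ob (yd_tens K X Y)) (m (ycar X) (ycar Y)) (mi (ycar X) (ycar Y)).
Proof.
  intros hX hY; assert (hL := induced_is_hopf).
  assert (k_ob := hopf_ob hK).
  apply yd_inverse; auto; [|apply (hmi (yd_ob hX) (yd_ob hY))].
  assert (hT := yd_tens_yd hD hK hX hY).
  constructor; auto using induced_yd, yd_tens_yd.
  - apply (hmi (yd_ob hX) (yd_ob hY)).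
  - symmetry.
    exact (act_tens k_ob (yd_ob hX) (yd_ob hY) (hopf_comul_hom hK) (yd_act_hom hX) (yd_act_hom hY)).
  - exact (coact_tens k_ob (yd_ob hX) (yd_ob hY) (hopf_mul_hom hK) (yd_coact_hom hX)
      (yd_coact_hom hY)).
Qed.

Lemma induced_unit : induced_ob (yd_unit K) = yd_unit induced_hopf.
Proof.
  assert (k_ob := hopf_ob hK); assert (u := unit_ob hD).
  assert (ho := F_hom (hopf_counit_hom hK)); assert (ho' := F_hom (hopf_one_hom hK)).
  rewrite F_unit in ho, ho'.
  unfold induced_ob, yd_unit; cbn [ycar yact ycoact induced_hopf hone hcounit]; f_equal; auto.
  - unfold act; rewrite m_unit_r, (tens_unit hD k_ob) by auto; diag.
  - unfold coact; rewrite (tens_unit hD k_ob).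
    destruct (hmi k_ob u) as (_ & _ & i & _); rewrite m_unit_r, F_unit in i by auto.
    assert (h := mi_is_hom (X := k) (Y := 𝟏%ob) _ _); unfold is_hom in h.
    rewrite F_unit, (tens_unit hD k_ob), (tens_unit hE (F_ob k_ob)) in h.
    rewrite (tens_unit hE (F_ob k_ob)), (comp_id hE h) in i.
    rewrite i; diag.
Qed.

Lemma induced_braided : is_braided_functor induced_functor.
Proof.
  assert (hL := induced_is_hopf); assert (hYL := yd_braided_category hE hL).
  assert (k_ob := hopf_ob hK).
  constructor.
  - exact (yd_braided_category hD hK).
  - exact hYL.
  - exact induced_is_functor.
  - intros X Y hX hY; exists (mi (ycar X) (ycar Y)); apply induced_mu; auto.
  - simpl; rewrite induced_unit; exists (ie (unit1 E)); apply (inverse_id hYL (unit_ob hYL)).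
  - intros X X' Y Y' f g hf hg.
    exact (braided_mu_natural hF (yd_morphism_hom hf) (yd_morphism_hom hg)).
  - intros X Y Z hX hY hZ; exact (braided_mu_assoc hF (yd_ob hX) (yd_ob hY) (yd_ob hZ)).
  - intros X hX; simpl; rewrite <- F_eta; exact (braided_mu_unit_l hF (yd_ob hX)).
  - intros X hX; simpl; rewrite <- F_eta; exact (braided_mu_unit_r hF (yd_ob hX)).
  - intros X Y hX hY.
    exact (transport_braid k_ob (yd_ob hY) (yd_ob hX) (yd_act_hom hY) (yd_coact_hom hX)).
Qed.

Variable Fi : functorData E D.
Hypothesis hFi : are_inverse F Fi.
Let Fi_ob X : isob E X -> isob D (fob Fi X) := @functor_ob _ _ Fi (inverse_functor_r hFi) X.
Let Fi_hom X Y f : hom E X Y f -> hom D (fob Fi X) (fob Fi Y) (fmap Fi X Y f) :=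
  @functor_hom _ _ Fi (inverse_functor_r hFi) X Y f.

Lemma inverse_faithful X Y f g : hom D X Y f -> hom D X Y g -> fmap F X Y f = fmap F X Y g -> f = g.
Proof.
  intros hf hg e; rewrite <- (inverse_map_l hFi hf), <- (inverse_map_l hFi hg), e; reflexivity.
Qed.

Definition induced_inv_ob (Z : ydData E) : ydData D :=
  YDData (fob Fi (ycar Z))
    (fmap Fi (fob F (k ⊗ fob Fi (ycar Z))) (ycar Z) (yact Z • mi k (fob Fi (ycar Z))))
    (fmap Fi (ycar Z) (fob F (k ⊗ fob Fi (ycar Z))) (m k (fob Fi (ycar Z)) • ycoact Z)).

Definition induced_inverse : functorData (YD induced_hopf) (YD K) :=
  FunctorData (C := YD induced_hopf) (D := YD K) induced_inv_ob
   (fun X Y f => fmap Fi (ycar X) (ycar Y) f) (fun _ _ => id 𝟏) (id 𝟏).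

Lemma full_faithful x y f : isob D x -> isob D y -> hom E (fob F x) (fob F y) f ->
  hom D x y (fmap Fi (fob F x) (fob F y) f) /\ fmap F x y (fmap Fi (fob F x) (fob F y) f) = f.
Proof.
  intros hx hy hf; assert (h := Fi_hom hf); assert (e := inverse_map_r hFi hf).
  rewrite (inverse_ob_l hFi hx), (inverse_ob_l hFi hy) in h, e; auto.
Qed.

Lemma induced_inv_homs Z : is_yd induced_hopf Z ->
  isob D (fob Fi (ycar Z)) /\
  hom D (k ⊗ fob Fi (ycar Z)) (fob Fi (ycar Z)) (yact (induced_inv_ob Z)) /\
  hom D (fob Fi (ycar Z)) (k ⊗ fob Fi (ycar Z)) (ycoact (induced_inv_ob Z)) /\
  induced_ob (induced_inv_ob Z) = Z.
Proof.
  intros hZ; assert (k_ob := hopf_ob hK).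
  destruct Z as [z r d]; unfold induced_ob, induced_inv_ob; cbn [ycar yact ycoact].
  assert (hz := yd_ob hZ); assert (hr := yd_act_hom hZ); assert (hd := yd_coact_hom hZ).
  cbn [ycar yact ycoact induced_hopf hcar] in hz, hr, hd; clear hZ.
  assert (hx := Fi_ob hz); assert (e := inverse_ob_r hFi hz).
  revert hx hr hd e; generalize (fob Fi z); intros x hx hr hd e; subst z.
  destruct (hmi k_ob hx) as (h1 & h2 & i1 & i2).
  destruct (full_faithful (tens_ob hD k_ob hx) hx (comp_hom hE h2 hr)) as [a1 a2].
  destruct (full_faithful hx (tens_ob hD k_ob hx) (comp_hom hE hd h1)) as [b1 b2].
  repeat split; auto.
  unfold act, coact; rewrite a2, b2; f_equal.
  - rewrite <- (comp_assoc hE h1 h2 hr), i1; apply (comp_id hE hr).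
  - rewrite (comp_assoc hE hd h1 h2), i1; apply (id_comp hE hd).
Qed.

Lemma induced_inv_yd Z : is_yd induced_hopf Z -> is_yd K (induced_inv_ob Z).
Proof.
  intros hZ; destruct (induced_inv_homs hZ) as (h1 & h2 & h3 & e).
  apply induced_yd_reflect; auto; [exact inverse_faithful | rewrite e; exact hZ].
Qed.

Lemma induced_inv_morphism X Y f : is_yd_morphism induced_hopf X Y f ->
  is_yd_morphism K (induced_inv_ob X) (induced_inv_ob Y) (fmap Fi (ycar X) (ycar Y) f).
Proof.
  intros [hX hY hf e1 e2].
  assert (k_ob := hopf_ob hK).
  assert (hX' := induced_inv_yd hX); assert (hY' := induced_inv_yd hY).
  destruct (induced_inv_homs hX) as (x1 & x2 & x3 & ex).
  destruct (induced_inv_homs hY) as (y1 & y2 & y3 & ey).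
  assert (hf' := Fi_hom hf); assert (ef := inverse_map_r hFi hf).
  revert hX' hY' x1 x2 x3 y1 y2 y3 ex ey hf' ef.
  change (fob Fi (ycar X)) with (ycar (induced_inv_ob X)).
  change (fob Fi (ycar Y)) with (ycar (induced_inv_ob Y)).
  generalize (fmap Fi (ycar X) (ycar Y) f), (induced_inv_ob X), (induced_inv_ob Y).
  intros g U V hU hV x1 x2 x3 y1 y2 y3 ex ey hg eg; subst X Y.
  cbn [induced_ob ycar yact ycoact induced_hopf hcar] in *.
  rewrite <- eg in e1, e2; clear eg hf; unfold act in e1.
  assert (r := F_tens_r hg k_ob).
  assert (h : hom D (k ⊗ ycar U) (k ⊗ ycar V) (id k ⊗ g)) by typed.
  assert (cU := coact_hom k_ob x1 x3); assert (cV := coact_hom k_ob y1 y3).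
  constructor; auto.
  - apply (inverse_faithful (X := (k ⊗ ycar U)%ob) (Y := ycar V)); try typed.
    rewrite (F_comp x2 hg), (F_comp h y2).
    apply (@m_cancel_r k (ycar U) (fob F (ycar V))); try typed.
    diag with (e1, r).
  - apply (inverse_faithful (X := ycar U) (Y := (k ⊗ ycar V)%ob)); try typed.
    rewrite (F_comp hg y3), (F_comp x3 h).
    diag with (coact_spec k_ob x1 x3, coact_spec k_ob y1 y3, e2, r).
Qed.

Lemma induced_inverse_spec : are_inverse induced_functor induced_inverse.
Proof.
  assert (k_ob := hopf_ob hK).
  constructor.
  - exact induced_is_functor.
  - constructor.
    + exact induced_inv_yd.
    + exact induced_inv_morphism.
    + intros Z hZ; apply (functor_map_id (inverse_functor_r hFi)), hZ.
    + intros X Y Z f g hf hg.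
      apply (functor_map_comp (inverse_functor_r hFi) (yd_morphism_hom hf) (yd_morphism_hom hg)).
  - intros X hX; simpl.
    destruct X as [x r d]; assert (hx := yd_ob hX); assert (hr := yd_act_hom hX);
      assert (hd := yd_coact_hom hX); cbn [ycar yact ycoact] in hx, hr, hd.
    unfold induced_inv_ob, induced_ob; cbn [ycar yact ycoact].
    assert (ex := inverse_ob_l hFi hx); rewrite ex.
    destruct (hmi k_ob hx) as (h1 & h2 & i1 & i2).
    f_equal; unfold act, coact.
    + rewrite <- (comp_assoc hE h2 h1 (F_hom hr)), i2, (comp_id hE (F_hom hr)).
      apply (inverse_map_l hFi hr).
    + rewrite (comp_assoc hE (F_hom hd) h2 h1), i2, (id_comp hE (F_hom hd)).
      apply (inverse_map_l hFi hd).
  - intros Z hZ; apply (induced_inv_homs hZ).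
  - intros X Y f hf; apply (inverse_map_l hFi (yd_morphism_hom hf)).
  - intros X Y f hf; apply (inverse_map_r hFi (yd_morphism_hom hf)).
Qed.

End Hopf.
End Induced.

(** * Partial duals *)

Section PartialDual.

Variable C : catData.
Hypothesis hC : is_braided_category C.
Variables (A B : hopfData C) (w : mor C).
Hypothesis hA : is_hopf A.
Hypothesis hB : is_hopf B.
Hypothesis hw : is_hopf_pairing A B w.
Hypothesis hnd : is_nondegenerate A B w.
Local Notation F := (Omega A B w).

Let hF : is_braided_functor F := omega_braided hC hA hB hw hnd.
Let F_unit : fob F (unit1 (YD A)) = unit1 (YD B) := omega_unit hC hA hB hw hnd.
Let F_eta : feta F = idm (YD B) (unit1 (YD B)) := eq_refl.

Lemma Omega2_inverse X Y : isob (YD A) X -> isob (YD A) Y ->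
  is_inverse (C := YD B) (tens (YD B) (fob F X) (fob F Y)) (fob F (tens (YD A) X Y))
    (fmu F X Y) (Omega2_inv A X Y).
Proof.
  intros hX hY; assert (h := omega2_inverse hC hA hB hw hnd hX hY).
  simpl; unfold Omega2_inv.
  rewrite (inv_eq hC (X := tens C (ycar X) (ycar Y)) (Y := tens C (ycar X) (ycar Y))
    (g := comp C (braid C (ycar Y) (ycar X)) (yd_braid_inv A Y X))); [exact h|].
  destruct h as (h1 & h2 & h3 & h4); repeat split; try apply h1; try apply h2; auto.
Qed.

Variable K : hopfData (YD A).
Hypothesis hK : is_hopf K.

Lemma omega_hopf : is_hopf (Omega_hopf B w K).
Proof.
  exact (induced_is_hopf (yd_braided_category hC hA) (yd_braided_category hC hB) hF F_unit F_eta
    Omega2_inverse hK).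
Qed.

Lemma omega_tilde_braided : is_braided_functor (Omega_tilde B w K).
Proof.
  exact (induced_braided (yd_braided_category hC hA) (yd_braided_category hC hB) hF F_unit F_eta
    Omega2_inverse hK).
Qed.

Lemma omega_tilde_inverse : exists G, are_inverse (Omega_tilde B w K) G.
Proof.
  eexists; exact (induced_inverse_spec (yd_braided_category hC hA)
    (yd_braided_category hC hB) hF F_unit F_eta
    Omega2_inverse hK (omega_inverse hC hA hB hw hnd)).
Qed.
End PartialDual.

Theorem theorem4p4 (C : catData) (H A B : hopfData C) (pi iota w : mor C)
    (hC : is_braided_category C)
    (hH : is_hopf H)
    (hdatum : is_partial_dualization_datum H A pi iota B w)
    (hequalizers : has_equalizers C)
    (hpreserve : tens_preserves_equalizers (hcar A)) :
  (exists (K : hopfData (YD A)) (phi : mor C),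
     is_radford_decomposition H pi iota K phi) /\
  forall (K : hopfData (YD A)) (phi : mor C),
    is_radford_decomposition H pi iota K phi ->
    let L := Omega_hopf B w K in
    let r := partial_dual B w K in
    let toYDK : functorData (YD H) (YD K) :=
      functor_comp (biproduct_restriction K)
                   (yd_transport (biproduct K) H phi) in
    is_hopf L /\
    is_hopf r /\
    is_braided_equivalence (Omega A B w) /\
    is_braided_isomorphism toYDK /\
    is_braided_equivalence (Omega_tilde B w K) /\
    exists fromYDL : functorData (YD L) (YD r),
      is_inverse_braided_iso (biproduct_restriction L) fromYDL /\
      is_braided_equivalence
        (functor_comp fromYDL (functor_comp (Omega_tilde B w K) toYDK)).
Proof.
  destruct hdatum as [hA hpi hiota split hB hw hnd].
  split; [exact (radford_projection hC hH hA hiota hpi split hequalizers)|].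
  intros K phi [hK hphi _ _ _] L r toYDK.
  assert (hL : is_hopf L) by exact (omega_hopf hC hA hB hw hnd hK).
  assert (hr : is_hopf r) by exact (biproduct_hopf hC hB hL).
  assert (hP := biproduct_hopf hC hA hK).
  assert (hYA := yd_braided_category hC hA); assert (hYB := yd_braided_category hC hB).
  assert (hYH := yd_braided_category hC hH); assert (hYP := yd_braided_category hC hP).
  assert (hYK := yd_braided_category hYA hK); assert (hYL := yd_braided_category hYB hL).
  assert (hYr := yd_braided_category hC hr).
  assert (omega : is_braided_equivalence (Omega A B w)).
  { split; [exact (omega_braided hC hA hB hw hnd)|].
    exact (inverse_equivalence hYA hYB (omega_inverse hC hA hB hw hnd)). }
  assert (tilde_braided := omega_tilde_braided hC hA hB hw hnd hK).
  destruct (omega_tilde_inverse hC hA hB hw hnd hK) as [G tilde_inverse].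
  destruct (transport_inverse hC hP hH hphi) as [s1' i1].
  assert (s1 := transport_strict hC hP hH hphi).
  assert (s2 := restriction_strict hC hA hK); assert (s2' := extension_strict hC hA hK).
  assert (i2 := restriction_inverse hC hA hK).
  assert (s : is_strict_functor toYDK) by exact (strict_functor_comp hYH hYP hYK s1 s2).
  assert (s' := strict_functor_comp hYK hYP hYH s2' s1').
  assert (i := inverse_functor_comp hYP i1 i2).
  assert (s3 := restriction_strict hC hB hL); assert (s3' := extension_strict hC hB hL).
  assert (i3 := restriction_inverse hC hB hL).
  split; [exact hL|]; split; [exact hr|]; split; [exact omega|].
  split; [exists (functor_comp (yd_transport H (biproduct K) (inv (C := C) (hcar (biproduct K)) (hcar H) phi)) (biproduct_extension K)); exact (strict_inverse hYH hYK s s' i)|].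
  split; [split; [exact tilde_braided | exact (inverse_equivalence hYK hYL tilde_inverse)]|].
  exists (biproduct_extension (Omega_hopf B w K)).
  split; [exact (strict_inverse hYr hYL s3 s3' i3)|].
  split.
  - apply braided_functor_comp; [|exact (strict_braided hYL hYr s3')].
    apply braided_functor_comp; [exact (strict_braided hYH hYK s) | exact tilde_braided].
  - assert (i4 := inverse_functor_comp hYK i tilde_inverse).
    exact (inverse_equivalence hYH hYr (inverse_functor_comp hYL i4 (are_inverse_sym i3))).
Qed.
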